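(* The system $\mathsf{Z}_2^\omega+\mathsf{QF\text{-}AC}^{0,1}$ does not prove $\mathsf{NIN}$, while the system $\mathsf{Z}_2^\Omega+\mathsf{QF\text{-}AC}^{0,1}$ does prove $\mathsf{NIN}$. Here $\mathsf{NIN}$ is the statement: for any $Y:[0,1]\to\mathbb{N}$ there are $x,y\in[0,1]$ such that $x\neq_{\mathbb{R}}y$ and $Y(x)=Y(y)$.
   Context: Finite types: $0$ is a type (natural numbers), and if $\sigma,\tau$ are types then so is $\sigma\to\tau$ (maps from type $\sigma$ objects to type $\tau$ objects); $1:=0\to 0$ and $n+1:=n\to 0$; superscripts indicate types. $\mathsf{L}_\omega$ is the many-sorted language with variables of every finite type, constants $0,1,<_0,+_0,\times_0,=_0$ (with usual meaning), typed combinators $\Pi,\Sigma$, and recursor constants $\mathbf{R}_\sigma$. For $\tau=(\tau_1\to\dots\to\tau_k\to 0)$, $x=_\tau y$ abbreviates $\forall z_1^{\tau_1}\dots z_k^{\tau_k}(xz_1\dots z_k=_0 yz_1\dots z_k)$. $\mathsf{QF\text{-}AC}^{\sigma,\tau}$ is the schema $(\forall x^\sigma)(\exists y^\tau)A(x,y)\to(\exists Y^{\sigma\to\tau})(\forall x^\sigma)A(x,Y(x))$ for quantifier-free $A$ of $\mathsf{L}_\omega$ (parameters of any type allowed). $\mathsf{RCA}_0^\omega$ (Kohlenbach's base theory, classical logic) has the following axioms: ordered semi-ring axioms for $0,1,<_0,+_0,\times_0$; defining axioms of $\Pi,\Sigma$ (giving $\lambda$-abstraction); $\mathbf{R}_0(f,m,0)=m$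 and $\mathbf{R}_0(f,m,n+1)=f(n,\mathbf{R}_0(f,m,n))$; extensionality $x=_\rho y\to\varphi(x)=_\tau\varphi(y)$ for all types $\rho,\tau$; induction for quantifier-free formulas of $\mathsf{L}_\omega$; and $\mathsf{QF\text{-}AC}^{1,0}$. Finite sequences are coded as usual. For $g^1$, $\overline{g}n$ is the (code of the) sequence $\langle g(0),\dots,g(n-1)\rangle$. $(\mathsf{S}_k^2)$ is the axiom stating the existence of a type 2 functional $\mathsf{S}_k^2$ with values in $\{0,1\}$ deciding the truth of $\Sigma^1_k$-formulas of second-order arithmetic (function parameters allowed), e.g. for $k=1$: $(\forall f^1)[(\exists g^1)(\forall n^0)(f(\overline{g}n)=0)\leftrightarrow \mathsf{S}_1(f)=0]$, and for general $k$ the same with the normal form of $\Sigma^1_k$-formulas. $\mathsf{Z}_2^\omega:=\bigcup_k(\mathsf{RCA}_0^\omega+(\mathsf{S}_k^2))$. $\mathsf{Z}_2^\Omega:=\mathsf{RCA}_0^\omega+(\exists^3)$, where $(\exists^3)$ is: there is $E^3$ with values in $\{0,1\}$ such that $(\forall Y^2)[(\exists f^1)(Y(f)=0)\leftrightarrow E(Y)=0]$. Inside these theories a real is a sequence of rationals $(q_n)$ with $|q_n-q_{n+i}|<2^{-n}$ for all $n,i$; reals $x,y$ represented by $(q_n),(r_n)$ satisfy $x=_{\mathbb{R}}y$ iff $|q_n-r_n|\le 2^{-n+1}$ for all $n$. Functions on $[0,1]$ or $\mathbb{R}$ with values in $\mathbb{N}$ or $\mathbb{R}$ are objects of the corresponding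 finite type that map $=_{\mathbb{R}}$-equal reals to equal values. *)

(* Defs.v *)
From Stdlib Require Import List.
Import ListNotations.

Set Implicit Arguments.
Unset Strict Implicit.
Unset Printing Implicit Defensive.

(* The language L_omega, classical derivability and the systems of higher-order
   arithmetic are deeply embedded: terms and formulas are intrinsically typed,
   with de Bruijn variables over a context of finite types whose head is the
   innermost variable. *)

Declare Scope ho_scope.
Delimit Scope ho_scope with ho.
Local Open Scope ho_scope.

Inductive ty : Type :=
| ty0 : ty
| Arr : ty -> ty -> ty.

Notation "s ⇒ t" := (Arr s t) (at level 55, right associativity) : ho_scope.

Definition ty1 : ty := ty0 ⇒ ty0.
Definition ty2 : ty := ty1 ⇒ ty0.
Definition ty3 : ty := ty2 ⇒ ty0.

Definition ctx : Type := list ty.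

Inductive var : ctx -> ty -> Type :=
| vz : forall G s, var (s :: G) s
| vs : forall G s t, var G s -> var (t :: G) s.

(* The recursors [cR s] with s <> ty0 belong to the language, but only [cR ty0]
   has axioms. *)
Inductive cst : ty -> Type :=
| c0 : cst ty0
| c1 : cst ty0
| cadd : cst (ty0 ⇒ ty0 ⇒ ty0)
| cmul : cst (ty0 ⇒ ty0 ⇒ ty0)
| cPi : forall s t, cst (s ⇒ t ⇒ s)
| cSigma : forall r s t, cst ((r ⇒ s ⇒ t) ⇒ (r ⇒ s) ⇒ r ⇒ t)
| cR : forall s, cst ((ty0 ⇒ s ⇒ s) ⇒ s ⇒ ty0 ⇒ s).

Inductive tm (G : ctx) : ty -> Type :=
| tvar : forall s, var G s -> tm G s
| tcst : forall s, cst s -> tm G s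
| tapp : forall s t, tm G (s ⇒ t) -> tm G s -> tm G t.

(* Only equality and order at type 0 are primitive relations. *)
Inductive fm (G : ctx) : Type :=
| feq : tm G ty0 -> tm G ty0 -> fm G
| flt : tm G ty0 -> tm G ty0 -> fm G
| fbot : fm G
| fimp : fm G -> fm G -> fm G
| fand : fm G -> fm G -> fm G
| for_ : fm G -> fm G -> fm G
| fall : forall s, fm (s :: G) -> fm G
| fex : forall s, fm (s :: G) -> fm G.

Arguments tcst {G s} _.
Arguments fbot {G}.
Arguments fall {G} s _.
Arguments fex {G} s _.

Definition sentence : Type := fm [].

Fixpoint qf (G : ctx) (A : fm G) : Prop :=
  match A with
  | feq _ _ | flt _ _ | fbot => True
  | fimp A B | fand A B | for_ A B => qf A /\ qf B
  | fall _ _ | fex _ _ => False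
  end.

Notation "s · t" := (tapp s t) (at level 20, left associativity) : ho_scope.
Notation "s ≐ t" := (feq s t) (at level 70, no associativity) : ho_scope.
Notation "s ≺ t" := (flt s t) (at level 70, no associativity) : ho_scope.
Notation "A ⊃ B" := (fimp A B) (at level 86, right associativity) : ho_scope.
Notation "A ∧' B" := (fand A B) (at level 80, right associativity) : ho_scope.
Notation "A ∨' B" := (for_ A B) (at level 85, right associativity) : ho_scope.

Definition fneg (G : ctx) (A : fm G) : fm G := A ⊃ fbot.
Definition fiff (G : ctx) (A B : fm G) : fm G := (A ⊃ B) ∧' (B ⊃ A).
Definition fle (G : ctx) (s t : tm G ty0) : fm G := (s ≺ t) ∨' (s ≐ t).

Notation "A ≡ B" := (fiff A B) (at level 87, no associativity) : ho_scope.
Notation "s ⪯ t" := (fle s t) (at level 70, no associativity) : ho_scope.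

Definition zero {G : ctx} : tm G ty0 := tcst c0.
Definition one {G : ctx} : tm G ty0 := tcst c1.
Definition add (G : ctx) (s t : tm G ty0) : tm G ty0 := tcst cadd · s · t.
Definition mul (G : ctx) (s t : tm G ty0) : tm G ty0 := tcst cmul · s · t.

Notation "s ⊕ t" := (add s t) (at level 50, left associativity) : ho_scope.
Notation "s ⊗ t" := (mul s t) (at level 40, left associativity) : ho_scope.

Definition v0 {G : ctx} {a : ty} : tm (a :: G) a := tvar (vz G a).
Definition v1 {G : ctx} {a b : ty} : tm (b :: a :: G) a := tvar (vs b (vz G a)).
Definition v2 {G : ctx} {a b c : ty} : tm (c :: b :: a :: G) a :=
  tvar (vs c (vs b (vz G a))).
Definition v3 {G : ctx} {a b c d : ty} : tm (d :: c :: b :: a :: G) a :=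
  tvar (vs d (vs c (vs b (vz G a)))).
Definition v4 {G : ctx} {a b c d e : ty} : tm (e :: d :: c :: b :: a :: G) a :=
  tvar (vs e (vs d (vs c (vs b (vz G a))))).
Definition v5 {G : ctx} {a b c d e f : ty} :
  tm (f :: e :: d :: c :: b :: a :: G) a :=
  tvar (vs f (vs e (vs d (vs c (vs b (vz G a)))))).

Definition ren (G D : ctx) : Type := forall s, var G s -> var D s.
Definition sub (G D : ctx) : Type := forall s, var G s -> tm D s.

Definition var_case (s : ty) (G : ctx) (P : ty -> Type)
    (p0 : P s) (pS : forall t, var G t -> P t) (t : ty) (x : var (s :: G) t) :
    P t :=
  match x in var D t' return
        match D with
        | [] => unit
        | s' :: G' =>
            forall Q : ty -> Type, Q s' -> (forall u, var G' u -> Q u) -> Q t'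
        end
  with
  | vz _ _ => fun Q q0 _ => q0
  | vs _ y => fun Q _ qS => qS _ y
  end P p0 pS.

Definition ren_shift (G : ctx) (a : ty) : ren G (a :: G) := fun _ x => vs a x.

Definition ren_lift (G D : ctx) (a : ty) (r : ren G D) :
    ren (a :: G) (a :: D) :=
  var_case (P := var (a :: D)) (vz D a) (fun _ x => vs a (r _ x)).

Fixpoint tren (G D : ctx) (r : ren G D) (s : ty) (t : tm G s) : tm D s :=
  match t with
  | tvar x => tvar (r _ x)
  | tcst c => tcst c
  | tapp t u => tren r t · tren r u
  end.

Fixpoint fren (G D : ctx) (r : ren G D) (A : fm G) : fm D :=
  match A with
  | feq s t => tren r s ≐ tren r t
  | flt s t => tren r s ≺ tren r t
  | fbot => fbot
  | fimp A B => fren r A ⊃ fren r B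
  | fand A B => fren r A ∧' fren r B
  | for_ A B => fren r A ∨' fren r B
  | fall a A => fall a (fren (ren_lift r) A)
  | fex a A => fex a (fren (ren_lift r) A)
  end.

Definition twk (G : ctx) (a s : ty) (t : tm G s) : tm (a :: G) s :=
  tren (@ren_shift G a) t.
Definition fwk (G : ctx) (a : ty) (A : fm G) : fm (a :: G) :=
  fren (@ren_shift G a) A.

Arguments twk {G a s} t.
Arguments fwk {G} a A.

Definition scons (G D : ctx) (a : ty) (t : tm D a) (f : sub G D) :
    sub (a :: G) D :=
  var_case (P := tm D) t f.

Definition sub_lift (G D : ctx) (a : ty) (f : sub G D) :
    sub (a :: G) (a :: D) :=
  scons v0 (fun _ x => twk (f _ x)).

Fixpoint tsub (G D : ctx) (f : sub G D) (s : ty) (t : tm G s) : tm D s :=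
  match t with
  | tvar x => f _ x
  | tcst c => tcst c
  | tapp t u => tsub f t · tsub f u
  end.

Fixpoint fsub (G D : ctx) (f : sub G D) (A : fm G) : fm D :=
  match A with
  | feq s t => tsub f s ≐ tsub f t
  | flt s t => tsub f s ≺ tsub f t
  | fbot => fbot
  | fimp A B => fsub f A ⊃ fsub f B
  | fand A B => fsub f A ∧' fsub f B
  | for_ A B => fsub f A ∨' fsub f B
  | fall a A => fall a (fsub (sub_lift f) A)
  | fex a A => fex a (fsub (sub_lift f) A)
  end.

Definition inst (G : ctx) (a : ty) (A : fm (a :: G)) (t : tm G a) : fm G :=
  fsub (scons t (fun _ x => tvar x)) A.

(* Natural deduction for classical many-sorted first-order logic with
   equality at type 0. *)
Inductive nd : forall G : ctx, list (fm G) -> fm G -> Prop :=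
| nd_hyp : forall G (H : list (fm G)) A, In A H -> nd H A
| nd_raa : forall G (H : list (fm G)) A, nd (fneg A :: H) fbot -> nd H A
| nd_impI : forall G (H : list (fm G)) A B, nd (A :: H) B -> nd H (A ⊃ B)
| nd_impE : forall G (H : list (fm G)) A B, nd H (A ⊃ B) -> nd H A -> nd H B
| nd_andI : forall G (H : list (fm G)) A B, nd H A -> nd H B -> nd H (A ∧' B)
| nd_andE1 : forall G (H : list (fm G)) A B, nd H (A ∧' B) -> nd H A
| nd_andE2 : forall G (H : list (fm G)) A B, nd H (A ∧' B) -> nd H B
| nd_orI1 : forall G (H : list (fm G)) A B, nd H A -> nd H (A ∨' B)
| nd_orI2 : forall G (H : list (fm G)) A B, nd H B -> nd H (A ∨' B)
| nd_orE : forall G (H : list (fm G)) A B C,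
    nd H (A ∨' B) -> nd (A :: H) C -> nd (B :: H) C -> nd H C
| nd_allI : forall G (H : list (fm G)) a (A : fm (a :: G)),
    nd (map (fwk a) H) A -> nd H (fall a A)
| nd_allE : forall G (H : list (fm G)) a (A : fm (a :: G)) t,
    nd H (fall a A) -> nd H (inst A t)
| nd_exI : forall G (H : list (fm G)) a (A : fm (a :: G)) t,
    nd H (inst A t) -> nd H (fex a A)
| nd_exE : forall G (H : list (fm G)) a (A : fm (a :: G)) C,
    nd H (fex a A) -> nd (A :: map (fwk a) H) (fwk a C) -> nd H C
| nd_refl : forall G (H : list (fm G)) t, nd H (t ≐ t)
| nd_subst : forall G (H : list (fm G)) (A : fm (ty0 :: G)) s t,
    nd H (s ≐ t) -> nd H (inst A s) -> nd H (inst A t).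

Definition theory : Type := sentence -> Prop.

Definition union (T U : theory) : theory := fun A => T A \/ U A.

Definition proves (T : theory) (A : sentence) : Prop :=
  exists H : list sentence, (forall B, In B H -> T B) /\ nd H A.

Fixpoint closure (G : ctx) : fm G -> sentence :=
  match G with
  | [] => fun A => A
  | a :: G' => fun A => closure (fall a A)
  end.

Fixpoint eq_at (s : ty) : forall G : ctx, tm G s -> tm G s -> fm G :=
  match s with
  | ty0 => fun G x y => x ≐ y
  | Arr a b => fun G x y => fall a (eq_at (twk x · v0) (twk y · v0))
  end.

(* Bracket abstraction of the innermost variable. *)
Fixpoint lam (G : ctx) (a s : ty) (t : tm (a :: G) s) : tm G (a ⇒ s) :=
  match t with
  | tvar x =>
      var_case (P := fun s => tm G (a ⇒ s))
        (tcst (cSigma a (a ⇒ a) a) · tcst (cPi a (a ⇒ a)) · tcst (cPi a a))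
        (fun s y => tcst (cPi s a) · tvar y) x
  | tcst c => tcst (cPi _ a) · tcst c
  | tapp t u => tcst (cSigma a _ _) · lam t · lam u
  end.

(* Non-negativity and discreteness of the order follow by induction. *)
Inductive semiring_axiom : theory :=
| sr_addA : semiring_axiom (closure (G := [ty0; ty0; ty0])
    ((v0 ⊕ v1) ⊕ v2 ≐ v0 ⊕ (v1 ⊕ v2)))
| sr_addC : semiring_axiom (closure (G := [ty0; ty0]) (v0 ⊕ v1 ≐ v1 ⊕ v0))
| sr_add0 : semiring_axiom (closure (G := [ty0]) (v0 ⊕ zero ≐ v0))
| sr_mulA : semiring_axiom (closure (G := [ty0; ty0; ty0])
    ((v0 ⊗ v1) ⊗ v2 ≐ v0 ⊗ (v1 ⊗ v2)))
| sr_mulC : semiring_axiom (closure (G := [ty0; ty0]) (v0 ⊗ v1 ≐ v1 ⊗ v0))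
| sr_mul1 : semiring_axiom (closure (G := [ty0]) (v0 ⊗ one ≐ v0))
| sr_mul0 : semiring_axiom (closure (G := [ty0]) (v0 ⊗ zero ≐ zero))
| sr_mulD : semiring_axiom (closure (G := [ty0; ty0; ty0])
    (v0 ⊗ (v1 ⊕ v2) ≐ v0 ⊗ v1 ⊕ v0 ⊗ v2))
| sr_lt_irrefl : semiring_axiom (closure (G := [ty0]) (fneg (v0 ≺ v0)))
| sr_lt_trans : semiring_axiom (closure (G := [ty0; ty0; ty0])
    (v0 ≺ v1 ⊃ v1 ≺ v2 ⊃ v0 ≺ v2))
| sr_lt_total : semiring_axiom (closure (G := [ty0; ty0])
    (v0 ≺ v1 ∨' v0 ≐ v1 ∨' v1 ≺ v0))
| sr_lt01 : semiring_axiom (zero ≺ one)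
| sr_lt_add : semiring_axiom (closure (G := [ty0; ty0; ty0])
    (v0 ≺ v1 ⊃ v0 ⊕ v2 ≺ v1 ⊕ v2))
| sr_lt_mul : semiring_axiom (closure (G := [ty0; ty0; ty0])
    (zero ≺ v2 ⊃ v0 ≺ v1 ⊃ v0 ⊗ v2 ≺ v1 ⊗ v2)).

Inductive combinator_axiom : theory :=
| ax_Pi : forall s t, combinator_axiom (closure (G := [t; s])
    (eq_at (tcst (cPi s t) · v1 · v0) v1))
| ax_Sigma : forall r s t,
    combinator_axiom (closure (G := [r; r ⇒ s; r ⇒ s ⇒ t])
      (eq_at (tcst (cSigma r s t) · v2 · v1 · v0) (v2 · v0 · (v1 · v0)))).

Inductive recursor_axiom : theory :=
| ax_R0 : recursor_axiom (closure (G := [ty0; ty0 ⇒ ty0 ⇒ ty0])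
    (tcst (cR ty0) · v1 · v0 · zero ≐ v0))
| ax_RS : recursor_axiom (closure (G := [ty0; ty0; ty0 ⇒ ty0 ⇒ ty0])
    (tcst (cR ty0) · v2 · v1 · (v0 ⊕ one)
      ≐ v2 · v0 · (tcst (cR ty0) · v2 · v1 · v0))).

Inductive extensionality_axiom : theory :=
| ax_ext : forall s t, extensionality_axiom (closure (G := [s; s; s ⇒ t])
    (eq_at v1 v0 ⊃ eq_at (v2 · v1) (v2 · v0))).

Inductive qf_induction : theory :=
| ax_ind : forall (G : ctx) (A : fm (ty0 :: G)), qf A ->
    qf_induction (closure (G := G)
      (inst A zero
       ∧' fall ty0 (A ⊃ fsub (scons (v0 ⊕ one) (fun _ x => tvar (vs ty0 x))) A)
       ⊃ fall ty0 A)).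

Inductive QF_AC (s t : ty) : theory :=
| ax_ac : forall (G : ctx) (A : fm (t :: s :: G)), qf A ->
    QF_AC s t (closure (G := G)
      (fall s (fex t A)
       ⊃ fex (s ⇒ t) (fall s
           (fsub (scons (v1 · v0) (scons v0
                   (fun _ x => tvar (vs s (vs (s ⇒ t) x))))) A)))).

Definition RCA0_omega : theory :=
  union semiring_axiom (union combinator_axiom (union recursor_axiom
    (union extensionality_axiom (union qf_induction (QF_AC ty1 ty0))))).

(* Triangular numbers, for the Cantor pairing (s + t)(s + t + 1)/2 + t, a
   bijection from pairs of numbers to numbers. *)
Definition tri {G : ctx} (t : tm G ty0) : tm G ty0 :=
  tcst (cR ty0) · lam (lam (v0 ⊕ (v1 ⊕ one))) · zero · t.

Definition cpair {G : ctx} (s t : tm G ty0) : tm G ty0 := tri (s ⊕ t) ⊕ t.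

Definition pow2 {G : ctx} (t : tm G ty0) : tm G ty0 :=
  tcst (cR ty0) · lam (lam (v0 ⊕ v0)) · one · t.

(* The code of the empty sequence is 0 and the code of s * <m> is
   cpair s m + 1, so every number codes exactly one finite sequence. *)
Definition initseg {G : ctx} (g : tm G ty1) (n : tm G ty0) : tm G ty0 :=
  tcst (cR ty0) · lam (lam (cpair v0 (twk (twk g) · v1) ⊕ one)) · zero · n.

Fixpoint initseg_tuple {G : ctx} (gs : list (tm G ty1)) (n : tm G ty0) :
    tm G ty0 :=
  match gs with
  | [] => zero
  | [g] => initseg g n
  | g :: gs' => cpair (initseg g n) (initseg_tuple gs' n)
  end.

Definition quant (ex : bool) {G : ctx} (a : ty) (A : fm (a :: G)) : fm G :=
  if ex then fex a A else fall a A.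

Arguments quant ex {G} a A.

(* k further alternating function quantifiers, the first existential iff [ex],
   then a number quantifier dual to the last of them; [gs] lists the function
   variables bound so far. *)
Fixpoint normal_form (k : nat) (ex : bool) {G : ctx}
    (f : tm G ty1) (gs : list (tm G ty1)) : fm G :=
  match k with
  | O => quant ex ty0 (twk f · initseg_tuple (map twk gs) v0 ≐ zero)
  | S k' => quant ex ty1 (normal_form k' (negb ex) (twk f) (map twk gs ++ [v0]))
  end.

(* (∃g1)(∀g2)...(Q gk)(Q' n) (f(<g1|n, ..., gk|n>) = 0) *)
Definition Sigma1 (k : nat) {G : ctx} (f : tm G ty1) : fm G :=
  normal_form k true f [].

Definition S_axiom (k : nat) : sentence :=
  fex ty2 (fall ty1
    ((v1 · v0 ≐ zero ∨' v1 · v0 ≐ one)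
     ∧' (Sigma1 k v0 ≡ v1 · v0 ≐ zero))).

Inductive S_axioms : theory :=
| ax_S : forall k, 1 <= k -> S_axioms (S_axiom k).

Definition exists3_sentence : sentence :=
  fex ty3 (fall ty2
    ((v1 · v0 ≐ zero ∨' v1 · v0 ≐ one)
     ∧' (fex ty1 (v1 · v0 ≐ zero) ≡ v1 · v0 ≐ zero))).

Inductive exists3_axiom : theory :=
| ax_exists3 : exists3_axiom exists3_sentence.

Definition Z2_omega : theory := union RCA0_omega S_axioms.
Definition Z2_Omega : theory := union RCA0_omega exists3_axiom.

(* The code of the rational (a - b)/(d + 1); every number is such a code. *)
Definition rat {G : ctx} (a b d : tm G ty0) : tm G ty0 := cpair a (cpair b d).

(* For codes p, q of rationals: p rel q + c/2^n, where rel is < or <=, with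
   denominators cleared and negative terms moved to the other side. *)
Definition rat_cmp (rel : forall G : ctx, tm G ty0 -> tm G ty0 -> fm G)
    {G : ctx} (p q c n : tm G ty0) : fm G :=
  let w (t : tm G ty0) : tm (ty0 :: ty0 :: ty0 :: ty0 :: ty0 :: ty0 :: G) ty0 :=
    twk (twk (twk (twk (twk (twk t))))) in
  let a := v5 in let b := v4 in let d := v3 ⊕ one in
  let a' := v2 in let b' := v1 in let d' := v0 ⊕ one in
  fall ty0 (fall ty0 (fall ty0 (fall ty0 (fall ty0 (fall ty0
    (w p ≐ rat v5 v4 v3 ⊃ w q ≐ rat v2 v1 v0 ⊃
     rel _ (pow2 (w n) ⊗ (a ⊗ d' ⊕ b' ⊗ d))
           (pow2 (w n) ⊗ (a' ⊗ d ⊕ b ⊗ d') ⊕ w c ⊗ (d ⊗ d')))))))).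

Definition two {G : ctx} : tm G ty0 := one ⊕ one.

(* |x(n) - x(n+i)| < 2^(-n) for all n, i *)
Definition is_real {G : ctx} (x : tm G ty1) : fm G :=
  let x' := twk (twk x) in
  fall ty0 (fall ty0
    (rat_cmp flt (x' · v1) (x' · (v1 ⊕ v0)) one v1
     ∧' rat_cmp flt (x' · (v1 ⊕ v0)) (x' · v1) one v1)).

(* x(n) <= y(n) + 2^(-n+1) for all n *)
Definition real_le {G : ctx} (x y : tm G ty1) : fm G :=
  fall ty0 (rat_cmp fle (twk x · v0) (twk y · v0) two v0).

(* |x(n) - y(n)| <= 2^(-n+1) for all n *)
Definition real_eq {G : ctx} (x y : tm G ty1) : fm G :=
  fall ty0 (rat_cmp fle (twk x · v0) (twk y · v0) two v0
          ∧' rat_cmp fle (twk y · v0) (twk x · v0) two v0).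

Definition real0 {G : ctx} : tm G ty1 := lam (rat zero zero zero).
Definition real1 {G : ctx} : tm G ty1 := lam (rat one zero zero).

Definition in_unit {G : ctx} (x : tm G ty1) : fm G :=
  is_real x ∧' real_le real0 x ∧' real_le x real1.

Definition unit_to_nat {G : ctx} (Y : tm G ty2) : fm G :=
  let Y' := twk (twk Y) in
  fall ty1 (fall ty1
    (in_unit v1 ⊃ in_unit v0 ⊃ real_eq v1 v0 ⊃ Y' · v1 ≐ Y' · v0)).

Definition NIN : sentence :=
  fall ty2
    (unit_to_nat v0
     ⊃ fex ty1 (fex ty1
         (in_unit v1 ∧' in_unit v0 ∧' fneg (real_eq v1 v0)
          ∧' v2 · v1 ≐ v2 · v0))).

(* Main.v *)
(* Provability half.  By completeness one may argue in an arbitrary model.  A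
   function h has an associated real x_h in [0,1] with base 4 digits sg (h n),
   and different digits give different reals.  If Y were injective on these
   reals, (∃^3) would decide whether n = Y(x_h) for some h, so QF-AC^{0,1} would
   yield a sequence (H_n) with Y(x_{H_n}) = n for all such n; a function d with
   sg (d n) <> sg (H_n n) contradicts this at n = Y(x_d).

   Unprovability half.  Force with partial injections p from Baire space to N
   together with a coinfinite set of forbidden values, where new values must not
   have been forbidden.  A fusion argument decides countably many questions at
   once, although the conditions are not closed under countable unions.  Take a
   countable hull of Skolem functions with ground reals A, and a generic
   injection Y : A -> N.  The functionals A -> N named in the hull contain Y and
   the S_k, whose truth is computed in the full Baire space, of which A is an
   elementary substructure; by fusion and genericity they are closed under
   substitution, recursion, total search and QF-AC^{0,1}.  They determine a model of
   all finite types: type s objects are hereditarily those that preserve a logical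
   relation between families indexed by A.  Composing Y with a choice of
   representatives of reals refutes NIN. *)

From Stdlib Require Import List Arith Lia Lra Reals Classical ClassicalEpsilon Cantor.
From Stdlib Require Import Eqdep Setoid Morphisms Ring Ring_theory.
From Stdlib Require Import FunctionalExtensionality PropExtensionality ProofIrrelevance.
Require Import Defs.
Import ListNotations.

Set Implicit Arguments.
Unset Strict Implicit.
Unset Printing Implicit Defensive.
Local Open Scope ho_scope.

(** * Syntax, models and soundness *)

(** Infinite conditions are forced by type 2 functionals that take reals as arguments. In the model,
    the sequence of values of [Y] at the reals [push n a] is again a type 1 object, so it must
    already lie in A. With finite conditions it would be a new real, and adding it would enlarge the
    domain of [Y], spoiling A as an elementary substructure. Hence a single condition has to decide
    all of its values, and the conditions used have to be members of the hull, so that whatever they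
    decide is a ground real. A logical relation is needed because QF-AC^{1,0} admits parameters of
    all types. A quantifier-free formula with a type 1 variable has to define a computable
    functional of that variable, whatever higher type objects occur in it. So an object of arrow
    type must send computable families of arguments to computable families of values, also after a
    change of index. *)

Lemma var_inv (a : ty) (G : ctx) (P : forall t, var (a :: G) t -> Prop) :
  P a (vz G a) -> (forall t (x : var G t), P t (vs a x)) ->
  forall t (x : var (a :: G) t), P t x.
Proof.
  intros H0 HS t x.
  refine (match x as x' in var D t' return
    match D as D' return var D' t' -> Prop with
    | [] => fun _ => True
    | b :: E => fun y => forall Q : forall t, var (b :: E) t -> Prop,
        Q b (vz E b) -> (forall t z, Q t (vs b z)) -> Q t' y
    end x' with vz _ _ => _ | vs _ _ => _ end P H0 HS); auto.
Qed.

Lemma var_nil (P : forall t, var [] t -> Prop) t (x : var [] t) : P t x.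
Proof.
  refine (match x as x' in var D t' return
    match D as D' return var D' t' -> Prop with
    | [] => fun y => forall Q : forall t, var [] t -> Prop, Q t' y
    | _ => fun _ => True
    end x' with vz _ _ => I | vs _ _ => I end P).
Qed.

Ltac vinv :=
  match goal with |- forall (t : ty) (x : var ?D t), @?P t x =>
    match eval hnf in D with ?a :: ?G => apply (@var_inv a G P); cbv beta end
  end.
Ltac fext := apply functional_extensionality_dep; intro.
Ltac varext := fext; fext;
  match goal with x : var _ ?t |- _ => revert t x end; vinv.

Definition sid (G : ctx) : sub G G := fun _ x => tvar x.
Definition scomp (G D E : ctx) (g : sub D E) (f : sub G D) : sub G E :=
  fun _ x => tsub g (f _ x).
Definition rsub (G D : ctx) (r : ren G D) : sub G D := fun _ x => tvar (r _ x).

Lemma sub_lift_rsub G D a (r : ren G D) :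
  sub_lift (a := a) (rsub r) = rsub (ren_lift r).
Proof. varext; reflexivity. Qed.

Lemma tren_tsub G D (r : ren G D) s (t : tm G s) : tren r t = tsub (rsub r) t.
Proof. induction t; simpl; try reflexivity; congruence. Qed.

Lemma fren_fsub G (A : fm G) : forall D (r : ren G D), fren r A = fsub (rsub r) A.
Proof.
  induction A; intros D r; simpl; rewrite ?tren_tsub, ?sub_lift_rsub; f_equal; auto.
Qed.

Lemma tsub_tsub G D E (g : sub D E) (f : sub G D) s (t : tm G s) :
  tsub g (tsub f t) = tsub (scomp g f) t.
Proof. induction t; simpl; try reflexivity; congruence. Qed.

Lemma tsub_id G s (t : tm G s) : tsub (sid (G := G)) t = t.
Proof. induction t; simpl; unfold sid in *; congruence. Qed.

Lemma scomp_lift G D E a (g : sub D E) (f : sub G D) :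
  scomp (sub_lift (a := a) g) (sub_lift f) = sub_lift (scomp g f).
Proof.
  varext; [reflexivity|intros t x]. unfold scomp at 1; simpl.
  unfold twk, scomp at 1. rewrite !tren_tsub, !tsub_tsub. f_equal.
  fext; fext. unfold scomp; simpl. unfold twk. now rewrite tren_tsub.
Qed.

Lemma sub_lift_id G a : sub_lift (a := a) (sid (G := G)) = sid (G := a :: G).
Proof. varext; reflexivity. Qed.

Lemma fsub_fsub G (A : fm G) : forall D E (g : sub D E) (f : sub G D),
  fsub g (fsub f A) = fsub (scomp g f) A.
Proof.
  induction A; intros D E g f; simpl; rewrite ?tsub_tsub, <- ?scomp_lift; f_equal; auto.
Qed.

Lemma fsub_id G (A : fm G) : fsub (sid (G := G)) A = A.
Proof.
  induction A; simpl; rewrite ?tsub_id, ?sub_lift_id; congruence.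
Qed.

Lemma inst_fwk G a (A : fm G) (t : tm G a) : inst (fwk a A) t = A.
Proof.
  unfold inst, fwk. rewrite fren_fsub, fsub_fsub. apply fsub_id.
Qed.

Lemma inst_lift_wk_v0 G a (A : fm (a :: G)) :
  inst (fren (ren_lift (@ren_shift G a)) A) v0 = A.
Proof.
  unfold inst. rewrite fren_fsub, fsub_fsub.
  transitivity (fsub (sid (G := a :: G)) A); [|apply fsub_id].
  f_equal. varext; reflexivity.
Qed.

Lemma inst_lift G D a (f : sub G D) (A : fm (a :: G)) t :
  inst (fsub (sub_lift f) A) t = fsub (scons t f) A.
Proof.
  unfold inst. rewrite fsub_fsub. f_equal.
  varext; [reflexivity|]. intros s x. unfold scomp; simpl. unfold twk.
  rewrite tren_tsub, tsub_tsub. apply tsub_id.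
Qed.

Lemma nd_weaken G (H : list (fm G)) A : nd H A -> forall H', incl H H' -> nd H' A.
Proof.
  induction 1; intros H' I; try (econstructor; eauto; fail).
  - apply nd_raa, IHnd. intros B [<-|?]; [left|right]; auto.
  - apply nd_impI, IHnd. intros C [<-|?]; [left|right]; auto.
  - eapply nd_orE; [eauto|apply IHnd2|apply IHnd3];
      intros D [<-|?]; [left|right|left|right]; auto.
  - apply nd_allI, IHnd, incl_map, I.
  - eapply nd_exE; [eauto|apply IHnd2].
    intros D [<-|?]; [left|right]; auto. now apply (incl_map (fwk a) I).
Qed.

Lemma nd_botE G (H : list (fm G)) A : nd H fbot -> nd H A.
Proof. intro. apply nd_raa. eapply nd_weaken; eauto. now right. Qed.

Record model : Type := Model {
  dom : ty -> Type;
  app : forall s t, dom (s ⇒ t) -> dom s -> dom t;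
  ci : forall s, cst s -> dom s;
  eq0 : dom ty0 -> dom ty0 -> Prop;
  lt0 : dom ty0 -> dom ty0 -> Prop }.

Arguments app {m s t}.
Arguments ci {m s}.
Arguments eq0 {m}.
Arguments lt0 {m}.

Section Satisfaction.

Variable M : model.

Definition env (G : ctx) : Type := forall s, var G s -> dom M s.

Definition econs (G : ctx) a (x : dom M a) (e : env G) : env (a :: G) :=
  var_case (P := dom M) x e.

Definition enil : env [] := fun s x =>
  match x in var D _ return match D with [] => dom M s | _ => unit end with
  | vz _ _ => tt | vs _ _ => tt end.

Fixpoint teval (G : ctx) (e : env G) s (t : tm G s) : dom M s :=
  match t with
  | tvar x => e _ x
  | tcst c => ci c
  | tapp t u => app (teval e t) (teval e u)
  end.

Fixpoint sat (G : ctx) (A : fm G) : env G -> Prop :=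
  match A with
  | feq s t => fun e => eq0 (teval e s) (teval e t)
  | flt s t => fun e => lt0 (teval e s) (teval e t)
  | fbot => fun _ => False
  | fimp A B => fun e => sat A e -> sat B e
  | fand A B => fun e => sat A e /\ sat B e
  | for_ A B => fun e => sat A e \/ sat B e
  | fall a A => fun e => forall x : dom M a, sat A (econs x e)
  | fex a A => fun e => exists x : dom M a, sat A (econs x e)
  end.

Definition models (A : sentence) : Prop := sat A enil.

Lemma env_eta G a (e : env (a :: G)) :
  econs (e a (vz G a)) (fun s x => e s (vs a x)) = e.
Proof. varext; reflexivity. Qed.

Lemma env_nil (e : env []) : e = enil.
Proof. fext; fext. apply (var_nil (fun t x => e t x = enil x)). Qed.

Lemma teval_sub G D (e : env D) (f : sub G D) s (t : tm G s) :
  teval e (tsub f t) = teval (fun _ x => teval e (f _ x)) t.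
Proof. induction t; simpl; try reflexivity; congruence. Qed.

Lemma teval_wk G a (e : env G) (x : dom M a) s (t : tm G s) :
  teval (econs x e) (twk t) = teval e t.
Proof. unfold twk. rewrite tren_tsub, teval_sub. reflexivity. Qed.

Lemma sat_sub G (A : fm G) : forall D (f : sub G D) (e : env D),
  sat (fsub f A) e <-> sat A (fun _ x => teval e (f _ x)).
Proof.
  induction A; intros D f e; simpl; rewrite ?teval_sub; try tauto.
  - now rewrite IHA1, IHA2.
  - now rewrite IHA1, IHA2.
  - now rewrite IHA1, IHA2.
  - assert (E : forall x : dom M s,
      (fun _ y => teval (econs x e) (sub_lift f y)) =
      econs x (fun _ y => teval e (f _ y))).
    { intro x. varext; [reflexivity|intros; apply teval_wk]. }
    split; intros K x; specialize (K x); apply IHA in K || apply IHA;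
      [rewrite E in K|rewrite E]; exact K.
  - assert (E : forall x : dom M s,
      (fun _ y => teval (econs x e) (sub_lift f y)) =
      econs x (fun _ y => teval e (f _ y))).
    { intro x. varext; [reflexivity|intros; apply teval_wk]. }
    split; intros [x K]; exists x; apply IHA in K || apply IHA;
      [rewrite E in K|rewrite E]; exact K.
Qed.

Lemma sat_wk G (A : fm G) a (e : env G) (x : dom M a) :
  sat (fwk a A) (econs x e) <-> sat A e.
Proof. unfold fwk. rewrite fren_fsub. apply sat_sub. Qed.

Lemma sat_inst G a (A : fm (a :: G)) t (e : env G) :
  sat (inst A t) e <-> sat A (econs (teval e t) e).
Proof.
  unfold inst. rewrite sat_sub.
  replace (fun s (x : var (a :: G) s) =>
    teval e (scons t (fun s x => tvar x) x)) with (econs (teval e t) e);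
    [tauto|]. varext; reflexivity.
Qed.

Lemma models_closure G (A : fm G) :
  models (closure A) <-> forall e : env G, sat A e.
Proof.
  induction G as [|a G IH].
  - split; [intros H e; now rewrite (env_nil e)|intro H; apply H].
  - simpl. rewrite IH. simpl. split.
    + intros H e. rewrite <- (env_eta e). apply H.
    + intros H e x. apply H.
Qed.

Lemma sat_induction G (A : fm (ty0 :: G)) (e : env (ty0 :: G)) :
  sat (fsub (scons (v0 ⊕ one) (fun _ x => tvar (vs ty0 x))) A) e <->
  sat A (econs (app (app (ci cadd) (e ty0 (vz G ty0))) (ci c1))
    (fun s x => e s (vs ty0 x))).
Proof.
  rewrite sat_sub.
  match goal with |- sat A ?f <-> sat A ?g => replace g with f; [tauto|] end.
  varext; reflexivity.
Qed.

Lemma sat_choice s t G (A : fm (t :: s :: G)) (e : env G) x Y :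
  sat (fsub (scons (v1 · v0) (scons v0
        (fun _ x => tvar (vs s (vs (s ⇒ t) x))))) A) (econs x (econs Y e)) <->
  sat A (econs (app Y x) (econs x e)).
Proof.
  rewrite sat_sub.
  match goal with |- sat A ?f <-> sat A ?g => replace g with f; [tauto|] end.
  varext; [reflexivity|]. vinv; reflexivity.
Qed.

(** Equality is only required to be a congruence for formulas, not identity, so that the Henkin term
    model needs no quotient. *)
Definition eq_ok : Prop :=
  (forall x : dom M ty0, eq0 x x) /\
  forall G (A : fm (ty0 :: G)) (e : env G) x y,
    eq0 x y -> sat A (econs x e) -> sat A (econs y e).

Lemma soundness (HE : eq_ok) G (H : list (fm G)) A : nd H A ->
  forall e : env G, (forall B, In B H -> sat B e) -> sat A e.
Proof.
  induction 1; intros e He; simpl in *.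
  - auto.
  - apply NNPP. intro N. apply (IHnd e). intros B [<-|?]; auto.
  - intro HA. apply IHnd. intros C [<-|?]; auto.
  - apply IHnd1; auto.
  - auto.
  - now apply IHnd.
  - now apply (IHnd e).
  - auto.
  - auto.
  - destruct (IHnd1 e He) as [K|K]; [apply IHnd2|apply IHnd3];
      intros D [<-|?]; auto.
  - intro x. apply IHnd. intros B HB.
    apply in_map_iff in HB. destruct HB as [C [<- HC]]. apply sat_wk; auto.
  - apply sat_inst. apply IHnd; auto.
  - specialize (IHnd e He). apply sat_inst in IHnd. eauto.
  - destruct (IHnd1 e He) as [x Hx]. apply (sat_wk C e x). apply IHnd2.
    intros B [<-|HB]; auto.
    apply in_map_iff in HB. destruct HB as [D [<- HD]]. apply sat_wk; auto.
  - apply HE.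
  - apply sat_inst. specialize (IHnd2 e He). apply sat_inst in IHnd2.
    eapply HE; [apply IHnd1; auto|]; auto.
Qed.

Lemma proves_models (HE : eq_ok) (T : theory) A :
  (forall B, T B -> models B) -> proves T A -> models A.
Proof.
  intros HT [H [HH HA]]. apply (soundness HE HA). intros; apply HT; auto.
Qed.

End Satisfaction.

Arguments enil {M}.

(** * Completeness *)

Definition pr (a b : nat) : nat := Cantor.to_nat (a, b).

Lemma pr_inj a b c d : pr a b = pr c d -> a = c /\ b = d.
Proof.
  unfold pr. intro H. apply Cantor.to_nat_inj in H. now injection H.
Qed.

Fixpoint tycode (s : ty) : nat :=
  match s with ty0 => 0 | Arr a b => S (pr (tycode a) (tycode b)) end.

Lemma tycode_inj s : forall t, tycode s = tycode t -> s = t.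
Proof.
  induction s; intros [|u v]; simpl; intro H; try discriminate; auto.
  injection H as H. apply pr_inj in H as [H1 H2]. f_equal; auto.
Qed.

Definition ccode s (c : cst s) : nat :=
  match c with
  | c0 => pr 0 0
  | c1 => pr 1 0
  | cadd => pr 2 0
  | cmul => pr 3 0
  | cPi s t => pr 4 (pr (tycode s) (tycode t))
  | cSigma r s t => pr 5 (pr (tycode r) (pr (tycode s) (tycode t)))
  | cR s => pr 6 (tycode s)
  end.

Ltac code_inj :=
  repeat match goal with
  | H : pr _ _ = pr _ _ |- _ => apply pr_inj in H; destruct H
  | H : tycode _ = tycode _ |- _ => apply tycode_inj in H; subst
  | H : existT _ ?a _ = existT _ ?a _ |- _ => apply inj_pair2 in H; subst
  | H : existT _ ?a _ = existT _ ?b _ |- _ =>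
      let E := fresh in assert (E := f_equal (@projT1 _ _) H); simpl in E;
      first [injection E as; subst|subst]
  end.

Lemma ccode_inj s (c : cst s) t (d : cst t) :
  ccode c = ccode d -> existT cst s c = existT cst t d.
Proof.
  destruct c, d; simpl; intro; code_inj; try discriminate; reflexivity.
Qed.

Fixpoint vcode G s (x : var G s) : nat :=
  match x with vz _ _ => 0 | vs _ y => S (vcode y) end.

Lemma vcode_inj G s (x : var G s) : forall t (y : var G t),
  vcode x = vcode y -> existT (var G) s x = existT (var G) t y.
Proof.
  induction x as [G s|G s a x IH]; vinv; simpl; try discriminate; auto.
  intros t y H. injection H as H. apply IH in H. code_inj. reflexivity.
Qed.

Fixpoint tcode G s (t : tm G s) : nat :=
  match t with
  | tvar x => pr 0 (vcode x)
  | tcst c => pr 1 (ccode c)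
  | tapp t u => pr 2 (pr (tcode t) (tcode u))
  end.

Lemma tcode_inj G s (t : tm G s) : forall s' (u : tm G s'),
  tcode t = tcode u -> existT (tm G) s t = existT (tm G) s' u.
Proof.
  induction t as [s x|s c|s s' t1 IH1 t2 IH2]; intros s'' [r y|r d|r r' u1 u2];
    simpl; intro H; code_inj; try discriminate.
  - apply vcode_inj in H0. code_inj. reflexivity.
  - apply ccode_inj in H0. code_inj. reflexivity.
  - apply IH1 in H0. apply IH2 in H1. code_inj. reflexivity.
Qed.

Fixpoint fcode G (A : fm G) : nat :=
  match A with
  | feq t u => pr 0 (pr (tcode t) (tcode u))
  | flt t u => pr 1 (pr (tcode t) (tcode u))
  | fbot => pr 2 0
  | fimp A B => pr 3 (pr (fcode A) (fcode B))
  | fand A B => pr 4 (pr (fcode A) (fcode B))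
  | for_ A B => pr 5 (pr (fcode A) (fcode B))
  | fall a A => pr 6 (pr (tycode a) (fcode A))
  | fex a A => pr 7 (pr (tycode a) (fcode A))
  end.

Lemma fcode_inj G (A : fm G) : forall B, fcode A = fcode B -> A = B.
Proof.
  induction A; intros []; simpl; intro H; code_inj; try discriminate; auto;
    repeat match goal with
    | H : tcode _ = tcode _ |- _ => apply tcode_inj in H
    end; code_inj; f_equal; auto.
Qed.

(** * Maximal consistent sets of formulas *)

Definition derivable G (S : fm G -> Prop) (A : fm G) : Prop :=
  exists L, (forall B, In B L -> S B) /\ nd L A.
Definition consistent G (S : fm G -> Prop) : Prop := ~ derivable S fbot.
Definition complete G (S : fm G -> Prop) : Prop := forall A, S A \/ S (fneg A).
Definition adjoin G (A : fm G) (S : fm G -> Prop) : fm G -> Prop :=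
  fun B => S B \/ B = A.

Lemma derivable_mono G (S S' : fm G -> Prop) A :
  (forall B, S B -> S' B) -> derivable S A -> derivable S' A.
Proof. intros HS [L [HL HA]]. exists L. auto. Qed.

Lemma adjoin_list G A (S : fm G -> Prop) L :
  (forall B, In B L -> adjoin A S B) ->
  exists L', (forall B, In B L' -> S B) /\ incl L (A :: L').
Proof.
  induction L as [|B L IH]; intro H.
  - exists []. split; [easy|intros ? []].
  - destruct IH as [L' [H1 H2]]; [intros; apply H; now right|].
    destruct (H B (or_introl eq_refl)) as [HB| ->].
    + exists (B :: L'). split.
      * intros C [<-|]; auto.
      * intros C [<-|HC]; [now right; left|].
        destruct (H2 C HC); [now left|now right; right].
    + exists L'. split; auto. intros C [<-|HC]; [now left|auto].
Qed.

Lemma derivable_adjoin G A B (S : fm G -> Prop) :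
  derivable (adjoin A S) B -> derivable S (A ⊃ B).
Proof.
  intros [L [HL HB]]. destruct (adjoin_list HL) as [L' [H1 H2]].
  exists L'. split; auto. apply nd_impI. eapply nd_weaken; eauto.
Qed.

Lemma derivable_impE G A B (S : fm G -> Prop) :
  derivable S (A ⊃ B) -> derivable S A -> derivable S B.
Proof.
  intros [L [HL HA]] [L' [HL' HB]]. exists (L ++ L'). split.
  - intros C HC. apply in_app_or in HC as []; auto.
  - eapply nd_impE; eapply nd_weaken; eauto; intros C HC; apply in_or_app; auto.
Qed.

Section Lindenbaum.

Variables (G : ctx) (S0 : fm G -> Prop).
Hypothesis S0_consistent : consistent S0.

Fixpoint chain (n : nat) : fm G -> Prop :=
  match n with
  | 0 => S0
  | S n => fun A => chain n A \/ fcode A = n /\ consistent (adjoin A (chain n))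
  end.

Lemma chain_mono m n A : m <= n -> chain m A -> chain n A.
Proof. induction 1; simpl; auto. Qed.

Lemma chain_consistent n : consistent (chain n).
Proof.
  induction n as [|n IH]; simpl; auto. intro D.
  destruct (classic (exists A, fcode A = n /\ consistent (adjoin A (chain n))))
    as [[A [E C]]|N].
  - apply C. eapply derivable_mono; [|exact D].
    intros B [HB|[HB _]]; [now left|right]. apply fcode_inj; congruence.
  - apply IH. eapply derivable_mono; [|exact D].
    intros B [HB|HB]; auto. elim N; eauto.
Qed.

Lemma chain_list L : (forall A, In A L -> exists n, chain n A) ->
  exists n, forall A, In A L -> chain n A.
Proof.
  induction L as [|A L IH]; intro H.
  - exists 0. easy.
  - destruct IH as [n Hn]; [intros; apply H; now right|].
    destruct (H A (or_introl eq_refl)) as [m Hm].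
    exists (Nat.max m n).
    intros B [<-|HB]; [apply (chain_mono (m := m))|apply (chain_mono (m := n))];
      auto; lia.
Qed.

Lemma lindenbaum : exists S',
  (forall A, S0 A -> S' A) /\ consistent S' /\ complete S'.
Proof.
  exists (fun A => exists n, chain n A).
  assert (C : consistent (fun A => exists n, chain n A)).
  { intros [L [HL HA]]. destruct (chain_list HL) as [n Hn].
    apply (@chain_consistent n). exists L. auto. }
  split; [|split]; auto.
  - intros A HA. exists 0. exact HA.
  - intro A.
    destruct (classic (consistent (adjoin A (chain (fcode A))))) as [HA|HA].
    + left. exists (S (fcode A)). right. auto.
    + right. exists (S (fcode (fneg A))). right. split; auto.
      apply NNPP in HA. apply derivable_adjoin in HA.
      intro D. apply derivable_adjoin in D.
      apply C. eapply derivable_impE; eapply derivable_mono.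
      2: exact D. 3: exact HA. all: eauto.
Qed.

End Lindenbaum.

Lemma complete_closed G (S : fm G -> Prop) : consistent S -> complete S ->
  forall L A, (forall B, In B L -> S B) -> nd L A -> S A.
Proof.
  intros C M L A HL HA. destruct (M A) as [|N]; auto.
  elim C. exists (fneg A :: L). split.
  - intros B [<-|]; auto.
  - eapply nd_impE; [apply nd_hyp; now left|].
    eapply nd_weaken; eauto. now right.
Qed.

(** A closed term of each type shows that all sorts are inhabited, which [henkin_ex] needs. It is
    also the junk value of [evar]. *)
Fixpoint dflt (G : ctx) (s : ty) : tm G s :=
  match s with
  | ty0 => zero
  | Arr a b => tcst (cPi b a) · dflt G b
  end.

(* The fresh variable names a witness of the existential statement, if any. *)
Definition henkin G a (B : fm (a :: G)) : fm (a :: G) := fwk a (fex a B) ⊃ B.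

(** The drinker's principle: if nothing satisfied [henkin B], then [B] would have no witness, since
    a witness satisfies [henkin B]; but then [dflt] satisfies it vacuously. *)
Lemma henkin_ex G a (B : fm (a :: G)) H : nd H (fex a (henkin B)).
Proof.
  assert (N : nd (fneg (fex a (henkin B)) :: H) (fneg (fex a B))).
  { apply nd_impI. eapply nd_exE; [apply nd_hyp; now left|].
    eapply nd_impE with (A := fwk a (fex a (henkin B))).
    - apply nd_hyp. simpl. auto.
    - change (nd (B :: map (fwk a) (fex a B :: fneg (fex a (henkin B)) :: H))
        (fex a (fren (ren_lift (@ren_shift G a)) (henkin B)))).
      apply nd_exI with (t := v0). rewrite inst_lift_wk_v0.
      apply nd_impI, nd_hyp. simpl; auto. }
  apply nd_raa. eapply nd_impE; [apply nd_hyp; now left|].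
  apply nd_exI with (t := dflt G a).
  change (inst (henkin B) (dflt G a))
    with (inst (fwk a (fex a B)) (dflt G a) ⊃ inst B (dflt G a)).
  rewrite inst_fwk. apply nd_impI, nd_botE.
  eapply nd_impE; [|apply nd_hyp; now left].
  eapply nd_weaken; [exact N|]. now right.
Qed.

Lemma nd_not_all G a (B : fm (a :: G)) : nd [fneg (fall a B)] (fex a (fneg B)).
Proof.
  apply nd_raa. apply nd_impE with (A := fall a B); [apply nd_hyp; simpl; auto|].
  apply nd_allI, nd_raa. simpl map.
  apply nd_impE with (A := fwk a (fex a (fneg B))); [apply nd_hyp; simpl; auto|].
  change (nd [fneg B; fwk a (fneg (fex a (fneg B))); fwk a (fneg (fall a B))]
    (fex a (fren (ren_lift (@ren_shift G a)) (fneg B)))).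
  apply nd_exI with (t := v0). rewrite inst_lift_wk_v0. apply nd_hyp. now left.
Qed.

Lemma henkin_consistent G (S : fm G -> Prop) a (B : fm (a :: G)) :
  consistent S ->
  consistent (adjoin (henkin B) (fun F => exists A, S A /\ F = fwk a A)).
Proof.
  intros C [L [HL HA]]. destruct (adjoin_list HL) as [L' [H1 H2]].
  assert (E : exists L0, (forall A, In A L0 -> S A) /\ L' = map (fwk a) L0).
  { clear H2. induction L' as [|F L' IH].
    - exists []. split; easy.
    - destruct IH as [L0 [K1 K2]]; [intros; apply H1; now right|].
      destruct (H1 F (or_introl eq_refl)) as [A [HSA ->]].
      exists (A :: L0). split; [|now rewrite K2].
      intros D [<-|]; auto. }
  destruct E as [L0 [K1 ->]]. apply C. exists L0. split; auto.
  eapply nd_exE; [apply (henkin_ex B)|].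
  eapply nd_weaken; eauto.
Qed.

(** The first component of the index of a Henkin constant is its type. The second, decoded in [hen],
    is a stage and the code of the formula to be witnessed. *)
Definition typ (N : nat) : ty :=
  epsilon (inhabits ty0) (fun s => tycode s = fst (Cantor.of_nat N)).

Lemma typ_pr s n : typ (pr (tycode s) n) = s.
Proof.
  apply tycode_inj. unfold typ, pr. rewrite Cantor.cancel_of_to. simpl.
  apply (epsilon_spec (inhabits ty0) (fun t => tycode t = tycode s)). eauto.
Qed.

Fixpoint ctxs (N : nat) : ctx :=
  match N with 0 => [] | S n => typ n :: ctxs n end.

(* The terms of the Henkin model: the n-th Henkin constant [gvar n] becomes the
   innermost variable of the context [ctxs (S n)]. *)
Inductive gtm : ty -> Type :=
| gvar : forall n, gtm (typ n)
| gcst : forall s, cst s -> gtm s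
| gapp : forall s t, gtm (s ⇒ t) -> gtm s -> gtm t.

(** The [dflt] branch is reached only for a constant that does not belong to [ctxs N]; the bound
    [bound t <= N] excludes this. *)
Fixpoint evar (N n : nat) : tm (ctxs N) (typ n) :=
  match N with
  | 0 => dflt _ _
  | S m => match Nat.eq_dec m n with
           | left e => eq_rect m (fun k => tm (ctxs (S m)) (typ k)) v0 n e
           | right _ => twk (evar m n)
           end
  end.

Fixpoint emb (N : nat) s (t : gtm s) : tm (ctxs N) s :=
  match t with
  | gvar n => evar N n
  | gcst c => tcst c
  | gapp t u => emb N t · emb N u
  end.

Fixpoint bound s (t : gtm s) : nat :=
  match t with
  | gvar n => S n
  | gcst _ => 0
  | gapp t u => Nat.max (bound t) (bound u)
  end.

Lemma emb_S N s (t : gtm s) : bound t <= N -> emb (S N) t = twk (emb N t).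
Proof.
  induction t as [n|s c|s u t IHt v IHv]; intro H; cbn [emb bound] in *.
  - simpl evar. destruct (Nat.eq_dec N n); [lia|reflexivity].
  - reflexivity.
  - rewrite IHt, IHv by lia. reflexivity.
Qed.

Fixpoint lev (N : nat) : forall s, var (ctxs N) s -> gtm s :=
  match N with
  | 0 => fun s x => match x in var D _ return
           match D with [] => gtm s | _ => unit end with
         | vz _ _ => tt | vs _ _ => tt end
  | S n => var_case (P := gtm) (gvar n) (@lev n)
  end.

Lemma lev_bound N : forall s (x : var (ctxs N) s), bound (lev x) <= N.
Proof.
  induction N as [|N IH].
  - intros s x. apply (var_nil (fun s x => @bound s (@lev 0 s x) <= 0)).
  - vinv; simpl; auto.
Qed.

Lemma emb_lev N : forall s (x : var (ctxs N) s), emb N (lev x) = tvar x.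
Proof.
  induction N as [|N IH].
  - intros s x. apply (var_nil (fun s x => emb 0 (@lev 0 s x) = tvar x)).
  - vinv.
    + simpl. destruct (Nat.eq_dec N N) as [e|]; [|easy].
      rewrite (Eqdep_dec.UIP_refl_nat N e). reflexivity.
    + intros t x. change (lev (N := S N) (vs (typ N) x)) with (lev x).
      rewrite emb_S by apply lev_bound. rewrite IH. reflexivity.
Qed.

(** For M at most N the substitution by [emb N (lev x)] is the weakening from [ctxs M] to [ctxs N].
    Passing through [gtm] defines it for all M and N, without transport along proofs of
    inequalities. *)
Definition hen (N : nat) : fm (typ N :: ctxs N) :=
  let mc := Cantor.of_nat (snd (Cantor.of_nat N)) in
  fsub (sub_lift (fun s x => emb N (lev x)))
    (epsilon (inhabits fbot)
      (fun B : fm (typ N :: ctxs (fst mc)) => fcode B = snd mc)).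

Lemma le_pr_r a b : b <= pr a b.
Proof. pose proof (Cantor.to_nat_non_decreasing a b). unfold pr. lia. Qed.

Lemma le_pr_l a b : a <= pr a b.
Proof. pose proof (Cantor.to_nat_non_decreasing a b). unfold pr. lia. Qed.

Lemma hen_surj M a (B : fm (a :: ctxs M)) : exists N (e : typ N = a),
  M <= N /\ eq_rect (typ N) (fun s => fm (s :: ctxs N)) (hen N) a e =
    fsub (sub_lift (fun s x => emb N (lev x))) B.
Proof.
  (* Pairing dominates its components, so the N-th constant comes after stage M. *)
  set (N := pr (tycode a) (pr M (fcode B))).
  assert (e : typ N = a) by apply typ_pr.
  exists N, e. split.
  - unfold N. etransitivity; [|apply le_pr_r]. apply le_pr_l.
  - unfold hen.
    replace (Cantor.of_nat (snd (Cantor.of_nat N))) with (M, fcode B)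
      by (unfold N, pr; rewrite Cantor.cancel_of_to; cbn [snd];
          now rewrite Cantor.cancel_of_to).
    simpl fst. simpl snd. generalize dependent (typ N). intros b e.
    destruct e. simpl. f_equal. apply fcode_inj.
    apply (epsilon_spec (inhabits fbot) (fun B0 => fcode B0 = fcode B)). eauto.
Qed.

(** * The Henkin model and its truth lemma *)

Section Completeness.

Variable T : sentence -> Prop.
Hypothesis T_consistent : consistent T.

Definition lind G (S : fm G -> Prop) : fm G -> Prop :=
  epsilon (inhabits S) (fun S' =>
    (forall A, S A -> S' A) /\ consistent S' /\ complete S').

Lemma lind_spec G (S : fm G -> Prop) : consistent S ->
  (forall A, S A -> lind S A) /\ consistent (lind S) /\ complete (lind S).
Proof.
  intro C. apply (epsilon_spec (inhabits S) (fun S' =>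
    (forall A, S A -> S' A) /\ consistent S' /\ complete S')).
  now apply lindenbaum.
Qed.

Fixpoint stage (N : nat) : fm (ctxs N) -> Prop :=
  match N with
  | 0 => lind T
  | S n => lind (adjoin (henkin (hen n))
                   (fun F => exists A, @stage n A /\ F = fwk (typ n) A))
  end.

Lemma stage_ok N : consistent (@stage N) /\ complete (@stage N).
Proof.
  induction N as [|N [IH _]].
  - exact (proj2 (lind_spec T_consistent)).
  - exact (proj2 (lind_spec (henkin_consistent (B := hen N) IH))).
Qed.

Lemma stage_nd N L A : (forall B, In B L -> @stage N B) -> nd L A -> stage A.
Proof. apply complete_closed; apply stage_ok. Qed.

Lemma stage_neg N (A : fm (ctxs N)) : stage (fneg A) <-> ~ stage A.
Proof.
  destruct (stage_ok N) as [C M]. split.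
  - intros H K. apply C. exists [fneg A; A]. split.
    + intros B [<-|[<-|[]]]; auto.
    + apply nd_impE with (A := A); apply nd_hyp; simpl; auto.
  - intro H. destruct (M A); tauto.
Qed.

(** Conservativity is automatic: [stage] N is complete, so a formula it lacks has its negation
    there, and that negation persists. *)
Lemma stage_wk N (A : fm (ctxs N)) : @stage (S N) (fwk (typ N) A) <-> stage A.
Proof.
  assert (K : forall A : fm (ctxs N), stage A -> @stage (S N) (fwk (typ N) A)).
  { intros B HB. apply (lind_spec (henkin_consistent (B := hen N) (proj1 (stage_ok N)))).
    left. eauto. }
  split; auto. intro H. apply NNPP. intro H'. apply stage_neg in H'.
  apply K in H'. revert H. apply (stage_neg (N := S N)). exact H'.
Qed.

Lemma stage_hen N : @stage (S N) (henkin (hen N)).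
Proof.
  apply (lind_spec (henkin_consistent (B := hen N) (proj1 (stage_ok N)))). now right.
Qed.

(** Atomic truth is read off at the first stage that knows both terms; by [stage_instance] any later
    stage gives the same answer. *)
Definition henkin_model : model :=
  Model (dom := gtm) gapp gcst
    (fun t u => let N := Nat.max (bound t) (bound u) in
       @stage N (emb N t ≐ emb N u))
    (fun t u => let N := Nat.max (bound t) (bound u) in
       @stage N (emb N t ≺ emb N u)).

Definition ebound G (e : env henkin_model G) (N : nat) : Prop :=
  forall s (x : var G s), bound (e s x) <= N.

Definition instance G (e : env henkin_model G) N (A : fm G) : fm (ctxs N) :=
  fsub (fun s x => emb N (e s x)) A.

Lemma ebound_ex G (e : env henkin_model G) : exists N, ebound e N.
Proof.
  induction G as [|a G IH].
  - exists 0. intros s x.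
    apply (var_nil (fun t x => @bound t (e t x) <= 0)).
  - destruct (IH (fun s x => e s (vs a x))) as [N HN].
    exists (Nat.max N (@bound a (e a (vz G a)))).
    intros s x. revert s x. vinv; [lia|].
    intros t x. specialize (HN t x). lia.
Qed.

Lemma ebound_le G (e : env henkin_model G) M N : M <= N -> ebound e M -> ebound e N.
Proof. intros H K s x. specialize (K s x). lia. Qed.

Lemma ebound_nil N : ebound enil N.
Proof. intros s x. apply (var_nil (fun s x => @bound s (@enil henkin_model s x) <= N)). Qed.

Lemma ebound_cons G (e : env henkin_model G) a (x : gtm a) N :
  bound x <= N -> ebound e N -> ebound (econs (M := henkin_model) x e) N.
Proof. intros Hx He. unfold ebound. vinv; auto. Qed.

Lemma instance_S G (e : env henkin_model G) N A : ebound e N ->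
  instance e (S N) A = fwk (typ N) (instance e N A).
Proof.
  intro H. unfold instance, fwk. rewrite fren_fsub, fsub_fsub. f_equal.
  fext; fext. rewrite emb_S by apply H. unfold twk. now rewrite tren_tsub.
Qed.

Lemma stage_instance G (e : env henkin_model G) A M N : ebound e M -> M <= N ->
  stage (instance e N A) <-> stage (instance e M A).
Proof.
  intros H L. induction L as [|N L IH]; [tauto|].
  rewrite instance_S, stage_wk; auto. eapply ebound_le; eauto.
Qed.

Lemma teval_bound G (e : env henkin_model G) N s (t : tm G s) :
  ebound e N -> @bound s (teval e t) <= N.
Proof.
  intro H. induction t; simpl; [apply H|lia|].
  apply Nat.max_lub; auto.
Qed.

Lemma emb_teval G (e : env henkin_model G) N s (t : tm G s) :
  emb N (teval e t : gtm s) = tsub (fun s x => emb N (e s x)) t.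
Proof. induction t; simpl in *; congruence. Qed.

Lemma instance_cons G (e : env henkin_model G) N a (x : gtm a) (A : fm (a :: G)) :
  instance (econs (M := henkin_model) x e) N A =
  inst (fsub (sub_lift (fun s x => emb N (e s x))) A) (emb N x).
Proof.
  rewrite inst_lift. unfold instance. f_equal. varext; reflexivity.
Qed.

Lemma instance_lev G (e : env henkin_model G) M N A : ebound e M -> M <= N ->
  fsub (fun s x => emb N (lev x)) (instance e M A) = instance e N A.
Proof.
  intros H L. induction L as [|N L IH].
  - transitivity (fsub (sid (G := ctxs M)) (instance e M A)); [|apply fsub_id].
    f_equal. fext; fext. apply emb_lev.
  - rewrite instance_S by (eapply ebound_le; eauto). rewrite <- IH.
    unfold fwk. rewrite fren_fsub, fsub_fsub. f_equal. fext; fext.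
    rewrite emb_S by (etransitivity; [apply lev_bound|exact L]).
    unfold twk. now rewrite tren_tsub.
Qed.

(** Some index N above M lists this very formula, and the Henkin axiom added at stage N + 1 makes
    [gvar N] a witness. *)
Lemma instance_witness G (e : env henkin_model G) a (B : fm (a :: G)) M :
  ebound e M -> stage (instance e M (fex a B)) ->
  exists N (x : gtm a), M <= N /\ bound x <= N /\
    stage (instance (econs (M := henkin_model) x e) N B).
Proof.
  intros H K.
  destruct (hen_surj (fsub (sub_lift (fun s x => emb M (e s x))) B))
    as [N [E [L HB]]].
  assert (HS := stage_hen N).
  assert (KN : @stage (S N) (fwk (typ N) (instance e N (fex a B)))).
  { apply stage_wk. now apply (stage_instance (fex a B) H L). }
  rewrite <- (instance_lev (fex a B) H L) in KN. simpl in KN.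
  exists (S N). destruct E. simpl in HB. exists (gvar N).
  split; [lia|split; [simpl; lia|]].
  assert (KB : @stage (S N) (hen N)).
  { eapply stage_nd with (L := [henkin (hen N); fwk (typ N) (fex (typ N) (hen N))]).
    - intros C [<-|[<-|[]]]; auto. rewrite HB. exact KN.
    - apply nd_impE with (A := fwk (typ N) (fex (typ N) (hen N)));
        apply nd_hyp; simpl; auto. }
  rewrite HB in KB.
  replace (instance (econs (M := henkin_model) (gvar N) e) (S N) B)
    with (fsub (sub_lift (a := typ N) (fun s x => emb N (lev x)))
      (fsub (sub_lift (fun s x => emb M (e s x))) B)); auto.
  rewrite fsub_fsub, scomp_lift. unfold instance. f_equal. varext.
  - simpl. destruct (Nat.eq_dec N N) as [p|]; [|easy].
    rewrite (Eqdep_dec.UIP_refl_nat N p). reflexivity.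
  - intros t x.
    change (twk (a := typ N) (tsub (fun s x => emb N (lev x)) (emb M (e t x))) =
      emb (S N) (e t x)).
    rewrite emb_S by (etransitivity; [apply H|exact L]). f_equal.
    clear - H L. specialize (H t x). revert H.
    generalize (e t x). intros u Hu.
    induction L as [|N L IH].
    + transitivity (tsub (sid (G := ctxs M)) (emb M u)); [|apply tsub_id].
      f_equal. fext; fext. apply emb_lev.
    + rewrite emb_S by lia. rewrite <- IH. unfold twk.
      rewrite tren_tsub, tsub_tsub. f_equal. fext; fext.
      rewrite emb_S by (etransitivity; [apply lev_bound|exact L]).
      unfold twk. now rewrite tren_tsub.
Qed.

Ltac fromstage Hs :=
  refine (@stage_nd _ Hs _ _ _);
  [let K := fresh in
   intros ? K; simpl in K; repeat destruct K as [<-|K]; auto; contradiction|].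

Lemma truth G (A : fm G) : forall (e : env henkin_model G) N, ebound e N ->
  (sat A e <-> stage (instance e N A)).
Proof.
  induction A; intros e N He.
  - simpl sat. unfold instance; simpl. rewrite <- !emb_teval.
    set (x := teval e t). set (y := teval e t0).
    pose (f := econs (M := henkin_model) x (econs (M := henkin_model) y enil)).
    symmetry. apply (@stage_instance _ f (v0 ≐ v1)).
    + unfold f. apply ebound_cons; [lia|apply ebound_cons; [lia|apply ebound_nil]].
    + apply Nat.max_lub; now apply teval_bound.
  - simpl sat. unfold instance; simpl. rewrite <- !emb_teval.
    set (x := teval e t). set (y := teval e t0).
    pose (f := econs (M := henkin_model) x (econs (M := henkin_model) y enil)).
    symmetry. apply (@stage_instance _ f (v0 ≺ v1)).
    + unfold f. apply ebound_cons; [lia|apply ebound_cons; [lia|apply ebound_nil]].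
    + apply Nat.max_lub; now apply teval_bound.
  - simpl. split; [easy|]. intro K. apply (proj1 (stage_ok N)).
    exists [fbot]. split; [|apply nd_hyp; now left]. intros B [<-|[]]; auto.
  - simpl sat. rewrite (IHA1 e N He), (IHA2 e N He).
    change (instance e N (A1 ⊃ A2)) with (instance e N A1 ⊃ instance e N A2).
    generalize (instance e N A1) (instance e N A2). intros B C. split.
    + intro H. destruct (classic (stage B)) as [K|K].
      * apply H in K. fromstage [C]. apply nd_impI, nd_hyp; simpl; auto.
      * apply stage_neg in K. fromstage [fneg B].
        apply nd_impI, nd_botE.
        apply nd_impE with (A := B); apply nd_hyp; simpl; auto.
    + intros H K. fromstage [B ⊃ C; B].
      apply nd_impE with (A := B); apply nd_hyp; simpl; auto.
  - simpl sat. rewrite (IHA1 e N He), (IHA2 e N He).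
    change (instance e N (A1 ∧' A2)) with (instance e N A1 ∧' instance e N A2).
    generalize (instance e N A1) (instance e N A2). intros B C. split.
    + intros [H K]. fromstage [B; C]. apply nd_andI; apply nd_hyp; simpl; auto.
    + intro H. split; fromstage [B ∧' C].
      * eapply nd_andE1, nd_hyp; simpl; auto.
      * eapply nd_andE2, nd_hyp; simpl; auto.
  - simpl sat. rewrite (IHA1 e N He), (IHA2 e N He).
    change (instance e N (A1 ∨' A2)) with (instance e N A1 ∨' instance e N A2).
    generalize (instance e N A1) (instance e N A2). intros B C. split.
    + intros [H|H]; [fromstage [B]; apply nd_orI1|fromstage [C]; apply nd_orI2];
        apply nd_hyp; simpl; auto.
    + intro H. apply NNPP. intro K. apply not_or_and in K as [K1 K2].
      apply stage_neg in K1, K2. apply (proj1 (stage_ok N)).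
      exists [B ∨' C; fneg B; fneg C]. split.
      * intros D [<-|[<-|[<-|[]]]]; auto.
      * eapply nd_orE; [apply nd_hyp; simpl; auto|..];
          (eapply nd_impE; [|apply nd_hyp; now left]); apply nd_hyp; simpl; auto.
  - simpl sat. split.
    + intro H. apply NNPP. intro K. apply stage_neg in K.
      (* A universal statement that is not in the stage has a named counterexample there, against
         [H]. *)
      assert (KE : stage (instance e N (fex s (fneg A)))).
      { fromstage [fneg (instance e N (fall s A))].
        exact (nd_not_all (fsub (sub_lift (fun s x => emb N (e s x))) A)). }
      destruct (instance_witness He KE) as [N' [x [L [Hx KX]]]].
      apply stage_neg in KX. apply KX. apply (IHA _ N'); [|apply H].
      apply ebound_cons; auto. exact (ebound_le L He).
    + intros H x. set (N' := Nat.max N (bound x)).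
      assert (He' : ebound e N') by (eapply ebound_le; [|exact He]; lia).
      apply (IHA _ N'); [apply ebound_cons; auto; lia|].
      apply (stage_instance (fall s A) He (N := N')) in H; [|lia].
      rewrite instance_cons. fromstage [instance e N' (fall s A)].
      apply nd_allE. apply nd_hyp. now left.
  - simpl sat. split.
    + intros [x H]. set (N' := Nat.max N (bound x)).
      assert (He' : ebound e N') by (eapply ebound_le; [|exact He]; lia).
      apply (IHA _ N') in H; [|apply ebound_cons; auto; lia].
      apply (stage_instance (fex s A) He (N := N')); [lia|].
      rewrite instance_cons in H.
      match type of H with stage ?F => fromstage [F] end.
      apply nd_exI with (t := emb N' x). apply nd_hyp. now left.
    + intro H. destruct (instance_witness He H) as [N' [x [L [Hx KX]]]].
      exists x. apply (IHA _ N'); [|exact KX].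
      apply ebound_cons; auto. exact (ebound_le L He).
Qed.

Lemma henkin_eq_ok : eq_ok henkin_model.
Proof.
  split.
  - intro x. simpl. fromstage (@nil (fm (ctxs (Nat.max (bound x) (bound x))))).
    apply nd_refl.
  - intros G A e x y H K. destruct (ebound_ex e) as [N0 HN].
    set (N := Nat.max N0 (Nat.max (bound x) (bound y))).
    assert (He : ebound e N) by (eapply ebound_le; [|exact HN]; lia).
    apply (truth A (N := N)) in K; [|apply ebound_cons; auto; lia].
    apply (truth A (N := N)); [apply ebound_cons; auto; lia|].
    rewrite instance_cons in *.
    assert (E : stage (emb N x ≐ emb N y)).
    { pose (f := econs (M := henkin_model) x (econs (M := henkin_model) y enil)).
      apply (@truth _ (v0 ≐ v1) f N); auto.
      unfold f. apply ebound_cons; [lia|apply ebound_cons; [lia|apply ebound_nil]]. }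
    match type of K with stage ?F => fromstage [emb N x ≐ emb N y; F] end.
    eapply nd_subst; apply nd_hyp; simpl; eauto.
Qed.

Lemma henkin_models A : T A -> models henkin_model A.
Proof.
  intro H. unfold models. apply (truth A (N := 0)).
  - apply ebound_nil.
  - unfold instance.
    replace (fsub (fun s (x : var [] s) => emb 0 (@enil henkin_model s x)) A)
      with A.
    + now apply (lind_spec T_consistent).
    + transitivity (fsub (sid (G := [])) A); [symmetry; apply fsub_id|].
      f_equal. fext; fext. apply (var_nil (fun s x => tvar x = emb 0 (@enil henkin_model s x))).
Qed.

End Completeness.

Lemma completeness (T : theory) (A : sentence) :
  (forall M : model, eq_ok M -> (forall B, T B -> models M B) -> models M A) ->
  proves T A.
Proof.
  intro H. apply NNPP. intro N.
  assert (C : consistent (adjoin (fneg A) T)).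
  { intro D. destruct D as [L [HL HA]].
    destruct (adjoin_list HL) as [L' [H1 H2]].
    apply N. exists L'. split; auto. apply nd_raa. eapply nd_weaken; eauto. }
  assert (K : models (henkin_model (adjoin (fneg A) T)) (fneg A)).
  { apply henkin_models; auto. now right. }
  apply K. apply H; [now apply henkin_eq_ok|].
  intros B HB. apply henkin_models; auto. now left.
Qed.

(** * The positive half *)

Definition three {G : ctx} : tm G ty0 := two ⊕ one.
Definition four {G : ctx} : tm G ty0 := two ⊕ two.
Definition predt {G : ctx} (t : tm G ty0) : tm G ty0 :=
  tcst (cR ty0) · lam (lam v1) · zero · t.
Definition monus {G : ctx} : tm G (ty0 ⇒ ty1) :=
  tcst (cR ty0) · lam (lam (predt v0)).
Definition sgt {G : ctx} (t : tm G ty0) : tm G ty0 :=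
  tcst (cR ty0) · lam (lam one) · zero · t.
Definition cosgt {G : ctx} (t : tm G ty0) : tm G ty0 :=
  tcst (cR ty0) · lam (lam zero) · one · t.
Definition trif {G : ctx} : tm G ty1 :=
  tcst (cR ty0) · lam (lam (v0 ⊕ (v1 ⊕ one))) · zero.
Definition powf {G : ctx} : tm G ty1 :=
  tcst (cR ty0) · lam (lam (v0 ⊕ v0)) · one.
Definition denf {G : ctx} : tm G ty1 :=
  tcst (cR ty0) · lam (lam (four ⊗ v0 ⊕ three)) · zero.
Definition numf {G : ctx} (h : tm G ty1) : tm G ty1 :=
  tcst (cR ty0) · lam (lam (four ⊗ v0 ⊕ sgt (twk (twk h) · v1))) · zero.

(* The n-th approximation of the base 4 expansion with digits sg (h 0),
   sg (h 1), ..., whose denominator 4^n is stored as 4^n - 1. *)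
Definition expansion : tm [] (ty1 ⇒ ty1) :=
  lam (lam (rat (numf v1 · v0) zero (denf · v0))).

Section Equality.

Variable M : model.
Hypothesis HE : eq_ok M.

Fixpoint eqv (s : ty) : dom M s -> dom M s -> Prop :=
  match s with
  | ty0 => eq0
  | Arr a b => fun f g => forall x : dom M a, eqv (app f x) (app g x)
  end.

Lemma sat_eq_at s : forall G (t u : tm G s) (e : env M G),
  sat (eq_at t u) e <-> eqv (teval e t) (teval e u).
Proof.
  induction s as [|a _ b IH]; intros G t u e; [simpl; tauto|].
  simpl. split; intros H x; specialize (H x); [apply IH in H|apply IH];
    simpl in *; rewrite !teval_wk in *; exact H.
Qed.

Lemma eq0_refl (x : dom M ty0) : eq0 x x.
Proof. apply HE. Qed.

Lemma eq0_sym (x y : dom M ty0) : eq0 x y -> eq0 y x.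
Proof.
  intro H. apply (proj2 HE [ty0] (v0 ≐ v1) (econs x enil) x y H).
  simpl. apply eq0_refl.
Qed.

Lemma eq0_trans (x y z : dom M ty0) : eq0 x y -> eq0 y z -> eq0 x z.
Proof.
  intros H K. apply (proj2 HE [ty0] (v1 ≐ v0) (econs x enil) y z K). exact H.
Qed.

Lemma lt0_eq0 (x x' y y' : dom M ty0) :
  eq0 x x' -> eq0 y y' -> lt0 x y -> lt0 x' y'.
Proof.
  intros Hx Hy H.
  apply (proj2 HE [ty0] (v1 ≺ v0) (econs x' enil) y y' Hy).
  apply (proj2 HE [ty0] (v0 ≺ v1) (econs y enil) x x' Hx). exact H.
Qed.

Lemma eqv_refl s : forall x : dom M s, eqv x x.
Proof. induction s; simpl; auto using eq0_refl. Qed.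

Lemma eqv_trans s : forall x y z : dom M s, eqv x y -> eqv y z -> eqv x z.
Proof. induction s; simpl; eauto using eq0_trans. Qed.

End Equality.

(** * Arithmetic inside an arbitrary model of [RCA0_omega] *)

Section Arithmetic.

Variable M : model.
Hypothesis HE : eq_ok M.
Hypothesis HR : forall B, RCA0_omega B -> models M B.

Lemma ax_semiring B : semiring_axiom B -> models M B.
Proof. intro. apply HR. now left. Qed.

Lemma app_ext s t (f f' : dom M (s ⇒ t)) (x x' : dom M s) :
  eqv f f' -> eqv x x' -> eqv (app f x) (app f' x').
Proof.
  intros Hf Hx. apply eqv_trans with (app f x'); [exact HE| |apply Hf].
  assert (K : models M (closure (G := [s; s; s ⇒ t])
    (eq_at v1 v0 ⊃ eq_at (v2 · v1) (v2 · v0)))).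
  { apply HR. right; right; right; left. constructor. }
  rewrite models_closure in K.
  specialize (K (econs x' (econs x (econs f enil)))). simpl in K.
  rewrite !sat_eq_at in K. apply K. exact Hx.
Qed.

Lemma Pi_eqv s t (x : dom M s) (y : dom M t) : eqv (app (app (ci (cPi s t)) x) y) x.
Proof.
  assert (K : models M (closure (G := [t; s])
    (eq_at (tcst (cPi s t) · v1 · v0) v1))).
  { apply HR. right; left. constructor. }
  rewrite models_closure in K. specialize (K (econs y (econs x enil))).
  rewrite sat_eq_at in K. exact K.
Qed.

Lemma Sigma_eqv r s t (x : dom M (r ⇒ s ⇒ t)) (y : dom M (r ⇒ s)) (z : dom M r) :
  eqv (app (app (app (ci (cSigma r s t)) x) y) z) (app (app x z) (app y z)).
Proof.
  assert (K : models M (closure (G := [r; r ⇒ s; r ⇒ s ⇒ t])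
    (eq_at (tcst (cSigma r s t) · v2 · v1 · v0) (v2 · v0 · (v1 · v0))))).
  { apply HR. right; left. constructor. }
  rewrite models_closure in K.
  specialize (K (econs z (econs y (econs x enil)))).
  rewrite sat_eq_at in K. exact K.
Qed.

Lemma beta G a s (t : tm (a :: G) s) (e : env M G) (x : dom M a) :
  eqv (app (teval e (lam t)) x) (teval (econs x e) t).
Proof.
  induction t as [s y|s c|s s' t IHt u IHu].
  - revert s y. vinv.
    + simpl. eapply eqv_trans; [exact HE|apply Sigma_eqv|apply Pi_eqv].
    + intros s y. simpl. apply Pi_eqv.
  - simpl. apply Pi_eqv.
  - simpl. eapply eqv_trans; [exact HE|apply Sigma_eqv|apply app_ext; auto].
Qed.

Lemma beta2 G a b s (t : tm (b :: a :: G) s) (e : env M G) x y :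
  eqv (app (app (teval e (lam (lam t))) x) y) (teval (econs y (econs x e)) t).
Proof.
  eapply eqv_trans; [exact HE| |apply beta].
  apply (@beta _ _ _ (lam t) e x).
Qed.

Local Notation D := (dom M ty0).
Local Notation "x == y" := (@eq0 M x y) (at level 70).
Lemma beta_rec G (t : tm (ty0 :: ty0 :: G) ty0) (e : env M G) (i r : D) :
  app (app (teval e (lam (lam t))) i) r == teval (econs r (econs i e)) t.
Proof. exact (beta2 t e i r). Qed.

Local Notation "x << y" := (@lt0 M x y) (at level 70).

Definition dom0 : D := ci c0.
Definition dom1 : D := ci c1.
Local Notation O := dom0.
Local Notation I := dom1.
Definition plus (x y : D) : D := app (app (ci cadd) x) y.
Definition times (x y : D) : D := app (app (ci cmul) x) y.

Declare Scope dom_scope.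
Delimit Scope dom_scope with dom.
Local Notation "x + y" := (plus x y) : dom_scope.
Local Notation "x * y" := (times x y) : dom_scope.
Local Notation "f @ x" := (app f x) (at level 25, left associativity) : dom_scope.
Local Open Scope dom_scope.

#[local] Instance eq0_equiv : Equivalence (@eq0 M).
Proof.
  split; [exact (eq0_refl HE)|exact (eq0_sym HE)|exact (eq0_trans HE)].
Qed.

#[local] Instance app_proper (f : dom M ty1) : Proper (@eq0 M ==> @eq0 M) (app f).
Proof. intros x y H. apply (app_ext (f := f) (f' := f)); auto. apply eqv_refl; auto. Qed.

#[local] Instance app2_proper (f : dom M (ty0 ⇒ ty1)) :
  Proper (@eq0 M ==> @eq0 M ==> @eq0 M) (fun x y => app (app f x) y).
Proof.
  intros x x' H y y' K. apply (@app_ext ty0 ty0 (app f x) (app f x') y y'); auto.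
  apply (@app_ext ty0 ty1 f f x x'); auto. apply eqv_refl; auto.
Qed.

#[local] Instance plus_proper : Proper (@eq0 M ==> @eq0 M ==> @eq0 M) plus.
Proof. exact (app2_proper (ci cadd)). Qed.

#[local] Instance times_proper : Proper (@eq0 M ==> @eq0 M ==> @eq0 M) times.
Proof. exact (app2_proper (ci cmul)). Qed.

#[local] Instance lt0_proper : Proper (@eq0 M ==> @eq0 M ==> iff) (@lt0 M).
Proof.
  intros x x' H y y' K. split; apply lt0_eq0; auto; now symmetry.
Qed.

Ltac ax3 c x y z :=
  let K := fresh in
  pose proof (ax_semiring c) as K; rewrite models_closure in K;
  exact (K (econs x (econs y (econs z enil)))).

Lemma addA x y z : (x + y) + z == x + (y + z).
Proof. ax3 sr_addA x y z. Qed.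
Lemma mulA x y z : (x * y) * z == x * (y * z).
Proof. ax3 sr_mulA x y z. Qed.
Lemma mulD x y z : x * (y + z) == x * y + x * z.
Proof. ax3 sr_mulD x y z. Qed.
Lemma addC x y : x + y == y + x.
Proof.
  pose proof (ax_semiring sr_addC) as K. rewrite models_closure in K.
  exact (K (econs x (econs y enil))).
Qed.
Lemma mulC x y : x * y == y * x.
Proof.
  pose proof (ax_semiring sr_mulC) as K. rewrite models_closure in K.
  exact (K (econs x (econs y enil))).
Qed.
Lemma add0 x : x + O == x.
Proof.
  pose proof (ax_semiring sr_add0) as K. rewrite models_closure in K.
  exact (K (econs x enil)).
Qed.
Lemma mul1 x : x * I == x.
Proof.
  pose proof (ax_semiring sr_mul1) as K. rewrite models_closure in K.
  exact (K (econs x enil)).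
Qed.
Lemma mul0 x : x * O == O.
Proof.
  pose proof (ax_semiring sr_mul0) as K. rewrite models_closure in K.
  exact (K (econs x enil)).
Qed.

Lemma dom_semiring : semi_ring_theory O I plus times (@eq0 M).
Proof.
  split; intros.
  - now rewrite addC, add0.
  - apply addC.
  - symmetry. apply addA.
  - now rewrite mulC, mul1.
  - now rewrite mulC, mul0.
  - apply mulC.
  - symmetry. apply mulA.
  - rewrite mulC, mulD, (mulC p), (mulC p). reflexivity.
Qed.

Lemma dom_ext : sring_eq_ext plus times (@eq0 M).
Proof. split; [exact plus_proper|exact times_proper]. Qed.

Add Ring dom_ring : dom_semiring (setoid eq0_equiv dom_ext).

Lemma dlt_irrefl x : ~ x << x.
Proof.
  pose proof (ax_semiring sr_lt_irrefl) as K. rewrite models_closure in K.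
  exact (K (econs x enil)).
Qed.
Lemma dlt_trans x y z : x << y -> y << z -> x << z.
Proof. ax3 sr_lt_trans x y z. Qed.
Lemma dlt_total x y : x << y \/ x == y \/ y << x.
Proof.
  pose proof (ax_semiring sr_lt_total) as K. rewrite models_closure in K.
  exact (K (econs x (econs y enil))).
Qed.
Lemma dlt_add x y z : x << y -> x + z << y + z.
Proof. ax3 sr_lt_add x y z. Qed.
Lemma dlt_01 : O << I.
Proof. exact (ax_semiring sr_lt01). Qed.

(** To keep the later induction formulas quantifier-free, functions such as [tri'] enter through the
    environment and the existential [dle] is replaced by a disjunction. *)
Lemma qf_ind G (A : fm (ty0 :: G)) (HA : qf A) (e : env M G) :
  sat A (econs O e) ->
  (forall n, sat A (econs n e) -> sat A (econs (n + I) e)) ->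
  forall n, sat A (econs n e).
Proof.
  intros H0 HS.
  assert (K := HR (or_intror (or_intror (or_intror (or_intror (or_introl (ax_ind HA))))))).
  rewrite models_closure in K. apply (K e). split.
  - apply sat_inst. exact H0.
  - intros n Hn. apply sat_induction. exact (HS n Hn).
Qed.

Lemma qf_ac s t : (forall B, QF_AC s t B -> models M B) ->
  forall G (A : fm (t :: s :: G)) (HA : qf A) (e : env M G),
  (forall x, exists y, sat A (econs y (econs x e))) ->
  exists Y : dom M (s ⇒ t), forall x, sat A (econs (app Y x) (econs x e)).
Proof.
  intros HT G A HA e H.
  assert (K := HT _ (ax_ac HA)). rewrite models_closure in K.
  destruct (K e H) as [Y HY]. exists Y. intro x.
  exact (proj1 (sat_choice A e x Y) (HY x)).
Qed.

Lemma rec_0 (F : dom M (ty0 ⇒ ty0 ⇒ ty0)) (m : D) : ci (cR ty0) @ F @ m @ O == m.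
Proof.
  assert (K := HR (or_intror (or_intror (or_introl ax_R0)))).
  rewrite models_closure in K. exact (K (econs m (econs F enil))).
Qed.

Lemma rec_S (F : dom M (ty0 ⇒ ty0 ⇒ ty0)) (m n : D) :
  ci (cR ty0) @ F @ m @ (n + I) == F @ n @ (ci (cR ty0) @ F @ m @ n).
Proof.
  assert (K := HR (or_intror (or_intror (or_introl ax_RS)))).
  rewrite models_closure in K. exact (K (econs n (econs m (econs F enil)))).
Qed.

Definition closed_val s (t : tm [] s) : dom M s := teval enil t.

Lemma pred_S n : teval (econs (n + I) enil) (predt v0) == n.
Proof. etransitivity; [apply rec_S|apply (@beta_rec [] v1 enil)]. Qed.

Definition dsub (x y : D) : D := closed_val monus @ x @ y.

Lemma dsub_0 x : dsub x O == x.
Proof. apply rec_0. Qed.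

Lemma dsub_S x y : dsub x (y + I) == teval (econs (dsub x y) enil) (predt v0).
Proof. etransitivity; [apply rec_S|apply (@beta_rec [] (predt v0) enil)]. Qed.

Lemma zero_or_S n : n == O \/ exists m, n == m + I.
Proof.
  (* The predecessor term replaces the existential witness, which induction for quantifier-free
     formulas could not handle. *)
  assert (K : n == O \/ n == teval (econs n enil) (predt v0) + I).
  { refine (@qf_ind [] (v0 ≐ zero ∨' v0 ≐ predt v0 ⊕ one) _ enil _ _ n).
    - simpl; auto.
    - left. apply (eq0_refl HE).
    - intros m _. right. change (m + I == teval (econs (m + I) enil) (predt v0) + I).
      now rewrite pred_S. }
  destruct K; eauto.
Qed.

Lemma dlt_S x : x << x + I.
Proof.
  assert (H := dlt_add x dlt_01).
  now rewrite (addC O), add0, (addC I) in H.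
Qed.

Lemma O_or_pos n : n == O \/ O << n.
Proof.
  refine (@qf_ind [] (v0 ≐ zero ∨' zero ≺ v0) _ enil _ _ n).
  - simpl; auto.
  - left. apply (eq0_refl HE).
  - intros m [H|H]; right; change (O << m + I).
    + change (m == O) in H. rewrite H, addC, add0. apply dlt_01.
    + exact (dlt_trans H (dlt_S m)).
Qed.

#[local] Instance pred_proper :
  Proper (@eq0 M ==> @eq0 M) (fun n => teval (econs n enil) (predt v0)).
Proof. exact (app_proper (closed_val (tcst (cR ty0) · lam (lam v1) · zero))). Qed.

(* Truncated subtraction provides a quantifier-free induction formula from which
   the existential characterization of the order follows. *)
Lemma dadd_dsub x y : x << y -> y == x + dsub y x.
Proof.
  refine (@qf_ind [ty0] (v0 ≺ v1 ⊃ v1 ≐ v0 ⊕ monus · v1 · v0) _ (econs y enil) _ _ x).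
  - simpl; auto.
  - intros _. change (y == O + dsub y O). rewrite dsub_0. ring.
  - intros n IH H. change (n + I << y) in H.
    change (n << y -> y == n + dsub y n) in IH.
    change (y == n + I + dsub y (n + I)).
    assert (L : n << y) by exact (dlt_trans (dlt_S n) H).
    assert (E := IH L).
    destruct (zero_or_S (dsub y n)) as [K|[m K]].
    + rewrite K, add0 in E. rewrite E in L. now apply dlt_irrefl in L.
    + assert (P : dsub y (n + I) == m).
      { rewrite dsub_S. etransitivity; [apply (pred_proper K)|apply pred_S]. }
      rewrite P. rewrite E at 1. rewrite K. ring.
Qed.

(** Turns strict inequalities into equations that [ring] can check in a semiring without
    subtraction. The explicit witnesses below are thus differences minus one. *)
Lemma dlt_iff x y : x << y <-> exists z, y == x + z + I.
Proof.
  split.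
  - intro H. assert (E := dadd_dsub H). destruct (zero_or_S (dsub y x)) as [K|[m K]].
    + rewrite K, add0 in E. rewrite E in H. now apply dlt_irrefl in H.
    + exists m. rewrite E at 1. rewrite K. ring.
  - intros [z E]. rewrite E.
    assert (P : O << z + I).
    { destruct (O_or_pos z) as [H|H].
      - rewrite H, addC, add0. apply dlt_01.
      - exact (dlt_trans H (dlt_S z)). }
    apply (dlt_add x) in P.
    rewrite (addC O), add0 in P.
    assert (pow4 : z + I + x == x + z + I) by ring. now rewrite <- pow4.
Qed.

Definition dle (x y : D) : Prop := exists z, y == x + z.

Lemma dle_iff x y : dle x y <-> x << y \/ x == y.
Proof.
  split.
  - intros [z E]. destruct (zero_or_S z) as [K|[m K]].
    + right. rewrite E, K. ring.
    + left. apply dlt_iff. exists m. rewrite E, K. ring.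
  - intros [H|H].
    + apply dlt_iff in H as [z E]. exists (z + I). rewrite E. ring.
    + exists O. rewrite H. ring.
Qed.

Lemma no_gap x z : ~ x == x + z + I.
Proof.
  intro H. apply (@dlt_irrefl x). apply dlt_iff. eauto.
Qed.

Lemma add_cancel x y z : x + y == x + z -> y == z.
Proof.
  intro H. destruct (dlt_total y z) as [K|[K|K]]; auto;
    apply dlt_iff in K as [w K]; exfalso.
  - apply (@no_gap (x + y) w). rewrite H at 1. rewrite K. ring.
  - apply (@no_gap (x + z) w). rewrite <- H at 1. rewrite K. ring.
Qed.

Definition tri' := closed_val trif.
Definition pow' := closed_val powf.
Definition den' := closed_val denf.
Definition pair' (x y : D) : D := tri' @ (x + y) + y.
Definition rat' (x y z : D) : D := pair' x (pair' y z).
Definition num' (h : dom M ty1) : dom M ty1 := teval (econs h enil) (numf v0).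
Definition sg' (x : D) : D := teval (econs x enil) (sgt v0).
Definition cosg' (x : D) : D := teval (econs x enil) (cosgt v0).

Lemma tri_S n : tri' @ (n + I) == tri' @ n + (n + I).
Proof.
  etransitivity; [apply rec_S|apply (@beta_rec [] (v0 ⊕ (v1 ⊕ one)) enil)].
Qed.
Lemma pow_0 : pow' @ O == I.
Proof. apply rec_0. Qed.
Lemma pow_S n : pow' @ (n + I) == pow' @ n + pow' @ n.
Proof. etransitivity; [apply rec_S|apply (@beta_rec [] (v0 ⊕ v0) enil)]. Qed.
Lemma den_0 : den' @ O == O.
Proof. apply rec_0. Qed.
Lemma den_S n : den' @ (n + I) == (I + I + (I + I)) * den' @ n + (I + I + I).
Proof.
  etransitivity; [apply rec_S|apply (@beta_rec [] (four ⊗ v0 ⊕ three) enil)].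
Qed.
Lemma num_0 h : num' h @ O == O.
Proof. apply rec_0. Qed.
Lemma num_S h n : num' h @ (n + I) == (I + I + (I + I)) * num' h @ n + sg' (h @ n).
Proof.
  etransitivity; [apply rec_S|].
  apply (@beta_rec [ty1] (four ⊗ v0 ⊕ sgt (v2 · v1)) (econs h enil)).
Qed.
Lemma sg_0 : sg' O == O.
Proof. apply rec_0. Qed.
Lemma sg_S n : sg' (n + I) == I.
Proof. etransitivity; [apply rec_S|apply (@beta_rec [] one enil)]. Qed.
Lemma cosg_0 : cosg' O == I.
Proof. apply rec_0. Qed.
Lemma cosg_S n : cosg' (n + I) == O.
Proof. etransitivity; [apply rec_S|apply (@beta_rec [] zero enil)]. Qed.

#[local] Instance sg_proper : Proper (@eq0 M ==> @eq0 M) sg'.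
Proof. exact (app_proper (closed_val (tcst (cR ty0) · lam (lam one) · zero))). Qed.
#[local] Instance cosg_proper : Proper (@eq0 M ==> @eq0 M) cosg'.
Proof. exact (app_proper (closed_val (tcst (cR ty0) · lam (lam zero) · one))). Qed.

Lemma sg_cases n : sg' n == O \/ sg' n == I.
Proof.
  destruct (zero_or_S n) as [H|[m H]]; rewrite H; auto using sg_0, sg_S.
Qed.

Lemma sg_cosg n : ~ sg' (cosg' n) == sg' n.
Proof.
  assert (N : ~ O == I) by (intro H; apply (@no_gap O O); rewrite H at 1; ring).
  assert (E : I == O + I) by ring.
  destruct (zero_or_S n) as [H|[m H]]; rewrite H.
  - rewrite cosg_0, sg_0, E, sg_S. intro K. now symmetry in K.
  - rewrite cosg_S, sg_0, sg_S. exact N.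
Qed.

Lemma tri_mono n z : dle (tri' @ n) (tri' @ (n + z)).
Proof.
  apply dle_iff.
  refine (@qf_ind [ty0; ty1] (v2 · v1 ≺ v2 · (v1 ⊕ v0) ∨' v2 · v1 ≐ v2 · (v1 ⊕ v0))
    _ (econs n (econs tri' enil)) _ _ z); [simpl; auto|..].
  - right. change (tri' @ n == tri' @ (n + O)). now rewrite add0.
  - intros m H. apply (@dle_iff (tri' @ n) (tri' @ (n + m))) in H.
    apply (@dle_iff (tri' @ n) (tri' @ (n + (m + I)))).
    destruct H as [w H]. exists (w + (n + m + I)).
    rewrite <- (addA n), tri_S, H. ring.
Qed.

(** A later diagonal starts at [tri' @ (x + y + I)] or above, which exceeds [tri' @ (x + y)] by x +
    y + 1, hence by more than y. *)
Lemma pair_lt x y x' y' : x + y << x' + y' -> ~ pair' x y == pair' x' y'.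
Proof.
  intros L H. apply dlt_iff in L as [z L]. unfold pair' in H.
  destruct (tri_mono (x + y + I) z) as [w K].
  assert (E : tri' @ (x' + y') == tri' @ (x + y) + (x + y + I) + w).
  { rewrite <- tri_S, <- K, L. apply app_proper. ring. }
  rewrite E in H. apply (@no_gap (tri' @ (x + y) + y) (x + w + y')).
  rewrite H at 1. ring.
Qed.

Lemma pair_inj x y x' y' : pair' x y == pair' x' y' -> x == x' /\ y == y'.
Proof.
  intro H. destruct (dlt_total (x + y) (x' + y')) as [K|[K|K]].
  - now apply pair_lt in K.
  - assert (Hy : y == y').
    { apply (add_cancel (x := tri' @ (x + y))). unfold pair' in H.
      rewrite H, K. reflexivity. }
    split; auto. apply (add_cancel (x := y)). rewrite (addC y x), K, Hy. ring.
  - apply pair_lt in K. now symmetry in H.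
Qed.

Lemma rat_inj a b d a' b' d' : rat' a b d == rat' a' b' d' ->
  a == a' /\ b == b' /\ d == d'.
Proof.
  intro H. apply pair_inj in H as [Ha H]. apply pair_inj in H as [Hb Hd]. auto.
Qed.

#[local] Instance pair_proper : Proper (@eq0 M ==> @eq0 M ==> @eq0 M) pair'.
Proof. intros x x' H y y' K. unfold pair'. now rewrite H, K. Qed.
#[local] Instance rat_proper : Proper (@eq0 M ==> @eq0 M ==> @eq0 M ==> @eq0 M) rat'.
Proof. intros x x' H y y' K z z' L. unfold rat'. now rewrite H, K, L. Qed.

Definition cmp (rel : D -> D -> Prop) (p q c n : D) : Prop :=
  forall a b d a' b' d', p == rat' a b d -> q == rat' a' b' d' ->
  rel (pow' @ n * (a * (d' + I) + b' * (d + I)))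
      (pow' @ n * (a' * (d + I) + b * (d' + I)) + c * ((d + I) * (d' + I))).

(** Codes of rationals are unique, so the quantification over all decodings amounts to any single
    one. *)
Lemma cmp_rat (rel : D -> D -> Prop) p q c n a b d a' b' d' :
  Proper (@eq0 M ==> @eq0 M ==> iff) rel ->
  p == rat' a b d -> q == rat' a' b' d' ->
  (cmp rel p q c n <->
   rel (pow' @ n * (a * (d' + I) + b' * (d + I)))
      (pow' @ n * (a' * (d + I) + b * (d' + I)) + c * ((d + I) * (d' + I)))).
Proof.
  intros HP Hp Hq. split; [intro H; now apply H|].
  intros H x y z x' y' z' Kp Kq. rewrite Hp in Kp. rewrite Hq in Kq.
  apply rat_inj in Kp as [E1 [E2 E3]]. apply rat_inj in Kq as [E4 [E5 E6]].
  now rewrite <- E1, <- E2, <- E3, <- E4, <- E5, <- E6.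
Qed.

Definition is_real' (x : dom M ty1) : Prop := forall n i,
  cmp (@lt0 M) (x @ n) (x @ (n + i)) I n /\ cmp (@lt0 M) (x @ (n + i)) (x @ n) I n.
Definition dleb (x y : D) : Prop := x << y \/ x == y.
Definition real_eq' (x y : dom M ty1) : Prop := forall n,
  cmp dleb (x @ n) (y @ n) (I + I) n /\ cmp dleb (y @ n) (x @ n) (I + I) n.
Definition in_unit' (x : dom M ty1) : Prop :=
  is_real' x /\
  (forall n, cmp dleb (closed_val real0 @ n) (x @ n) (I + I) n) /\
  (forall n, cmp dleb (x @ n) (closed_val real1 @ n) (I + I) n).

Definition pow4 (n : D) : D := den' @ n + I.

Lemma pow4_0 : pow4 O == I.
Proof. unfold pow4. rewrite den_0. ring. Qed.
Lemma pow4_S n : pow4 (n + I) == (I + I + (I + I)) * pow4 n.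
Proof. unfold pow4. rewrite den_S. ring. Qed.
#[local] Instance pow4_proper : Proper (@eq0 M ==> @eq0 M) pow4.
Proof. intros x y H. unfold pow4. now rewrite H. Qed.

Lemma pow4_add m n : pow4 (m + n) == pow4 m * pow4 n.
Proof.
  refine (@qf_ind [ty0; ty1] (v2 · (v1 ⊕ v0) ⊕ one ≐ (v2 · v1 ⊕ one) ⊗ (v2 · v0 ⊕ one))
    _ (econs m (econs den' enil)) _ _ n); [simpl; auto|..].
  - change (pow4 (m + O) == pow4 m * pow4 O). rewrite pow4_0, add0. ring.
  - intros k H. change (pow4 (m + k) == pow4 m * pow4 k) in H.
    change (pow4 (m + (k + I)) == pow4 m * pow4 (k + I)).
    rewrite <- addA, !pow4_S, H. ring.
Qed.

Lemma pow_add m n : pow' @ (m + n) == pow' @ m * pow' @ n.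
Proof.
  refine (@qf_ind [ty0; ty1] (v2 · (v1 ⊕ v0) ≐ v2 · v1 ⊗ (v2 · v0))
    _ (econs m (econs pow' enil)) _ _ n); [simpl; auto|..].
  - change (pow' @ (m + O) == pow' @ m * pow' @ O). rewrite pow_0, add0. ring.
  - intros k H. change (pow' @ (m + k) == pow' @ m * pow' @ k) in H.
    change (pow' @ (m + (k + I)) == pow' @ m * pow' @ (k + I)).
    rewrite <- addA, !pow_S, H. ring.
Qed.

Lemma pow_sqr n : pow4 n == pow' @ n * pow' @ n.
Proof.
  refine (@qf_ind [ty1; ty1] (v2 · v0 ⊕ one ≐ v1 · v0 ⊗ (v1 · v0))
    _ (econs pow' (econs den' enil)) _ _ n); [simpl; auto|..].
  - change (pow4 O == pow' @ O * pow' @ O). rewrite pow_0, pow4_0. ring.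
  - intros k H. change (pow4 k == pow' @ k * pow' @ k) in H.
    change (pow4 (k + I) == pow' @ (k + I) * pow' @ (k + I)).
    rewrite pow4_S, pow_S, H. ring.
Qed.

(** If 2^n were 0, its square 4^n would be 0, but [pow4] is a successor by definition. *)
Lemma pow_pos n : exists p, pow' @ n == p + I.
Proof.
  destruct (zero_or_S (pow' @ n)) as [H|H]; auto. exfalso.
  assert (K := pow_sqr n). rewrite H in K. unfold pow4 in K.
  apply (@no_gap O (den' @ n)). transitivity (O * O); [ring|]. rewrite <- K. ring.
Qed.

(** * Reals in the unit interval from base 4 digits 0 and 1 *)

Section Expansion.

Variables (h : dom M ty1) (x : dom M ty1).
Hypothesis Hx : forall n, x @ n == rat' (num' h @ n) O (den' @ n).

Lemma num_lower n i : dle (num' h @ n * pow4 i) (num' h @ (n + i)).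
Proof.
  apply dle_iff.
  refine (@qf_ind [ty0; ty1; ty1]
    (v3 · v1 ⊗ (v2 · v0 ⊕ one) ≺ v3 · (v1 ⊕ v0) ∨'
     v3 · v1 ⊗ (v2 · v0 ⊕ one) ≐ v3 · (v1 ⊕ v0))
    _ (econs n (econs den' (econs (num' h) enil))) _ _ i); [simpl; auto|..].
  - right. change (num' h @ n * pow4 O == num' h @ (n + O)).
    rewrite pow4_0, add0. ring.
  - intros k H. apply (@dle_iff (num' h @ n * pow4 k) (num' h @ (n + k))) in H.
    apply (@dle_iff (num' h @ n * pow4 (k + I)) (num' h @ (n + (k + I)))).
    destruct H as [w H].
    exists ((I + I + (I + I)) * w + sg' (h @ (n + k))).
    rewrite <- (addA n), num_S, H, pow4_S. ring.
Qed.

(** In base 4 the digits 0 and 1 never carry, so a tail stays below one unit of position n. With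
    [num_lower] this encloses all later approximations in an interval of length 4^(-n). *)
Lemma num_upper n i : num' h @ (n + i) << (num' h @ n + I) * pow4 i.
Proof.
  refine (@qf_ind [ty0; ty1; ty1] (v3 · (v1 ⊕ v0) ≺ (v3 · v1 ⊕ one) ⊗ (v2 · v0 ⊕ one))
    _ (econs n (econs den' (econs (num' h) enil))) _ _ i); [simpl; auto|..].
  - change (num' h @ (n + O) << (num' h @ n + I) * pow4 O).
    apply dlt_iff. exists O. rewrite pow4_0, !add0. ring.
  - intros k H. change (num' h @ (n + k) << (num' h @ n + I) * pow4 k) in H.
    change (num' h @ (n + (k + I)) << (num' h @ n + I) * pow4 (k + I)).
    apply dlt_iff in H as [w H].
    rewrite <- (addA n), num_S, pow4_S.
    assert (E : (num' h @ n + I) * ((I + I + (I + I)) * pow4 k) ==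
      (I + I + (I + I)) * (num' h @ (n + k) + w + I)).
    { rewrite <- H. ring. }
    destruct (sg_cases (h @ (n + k))) as [K|K]; rewrite K; apply dlt_iff.
    + exists ((I + I + (I + I)) * w + (I + I + I)). rewrite E. ring.
    + exists ((I + I + (I + I)) * w + (I + I)). rewrite E. ring.
Qed.

Lemma expansion_real : is_real' x.
Proof.
  intros n i. split.
  - apply (cmp_rat I n lt0_proper (Hx n) (Hx (n + i))).
    fold (pow4 n). fold (pow4 (n + i)). rewrite pow4_add.
    destruct (num_lower n i) as [w H]. rewrite H. apply dlt_iff.
    exists (pow' @ n * (w * pow4 n) +
      (den' @ n * pow4 i * pow4 n + den' @ i * pow4 n + den' @ n)).
    assert (E : pow4 n * (pow4 n * pow4 i) ==
      den' @ n * pow4 i * pow4 n + den' @ i * pow4 n + den' @ n + I) by (unfold pow4; ring).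
    transitivity (pow' @ n * ((num' h @ n * pow4 i + w) * pow4 n) + pow4 n * (pow4 n * pow4 i));
      [ring|]. rewrite E. ring.
  - apply (cmp_rat I n lt0_proper (Hx (n + i)) (Hx n)).
    fold (pow4 n). fold (pow4 (n + i)). rewrite pow4_add. apply dlt_iff.
    assert (K := num_upper n i). apply dlt_iff in K as [w K].
    destruct (pow_pos n) as [p Hp].
    assert (L : num' h @ (n + i) * pow4 n + (w + I) * pow4 n ==
      num' h @ n * (pow4 n * pow4 i) + pow4 i * pow4 n).
    { transitivity ((num' h @ (n + i) + w + I) * pow4 n); [ring|].
      rewrite <- K. ring. }
    (* The bounds give the distance 4^(-n). Since 2^n = p + 1, the number 4^n is 2^n plus a
       remainder, which weakens this to the required 2^(-n). *)
    assert (E4 : pow4 n == pow' @ n + p * pow' @ n)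
      by (rewrite (pow_sqr n), Hp; ring).
    assert (W : pow' @ n * pow4 n == p * pow4 n + den' @ n + I)
      by (rewrite Hp; unfold pow4; ring).
    exists (pow' @ n * w * pow4 n + p * pow4 n + den' @ n + pow4 i * pow4 n * (p * pow' @ n)).
    assert (S2 : pow4 i * pow4 n * pow4 n == pow4 i * pow4 n * (pow' @ n + p * pow' @ n))
      by now rewrite <- E4.
    transitivity (pow' @ n * (num' h @ n * (pow4 n * pow4 i)) + pow4 i * pow4 n * pow4 n); [ring|].
    rewrite S2.
    transitivity (pow' @ n * (num' h @ n * (pow4 n * pow4 i) + pow4 i * pow4 n)
      + pow4 i * pow4 n * (p * pow' @ n)); [ring|]. rewrite <- L.
    transitivity (pow' @ n * (num' h @ (n + i) * pow4 n) + pow' @ n * w * pow4 n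
      + pow' @ n * pow4 n + pow4 i * pow4 n * (p * pow' @ n)); [ring|].
    rewrite W. ring.
Qed.

#[local] Instance dleb_proper : Proper (@eq0 M ==> @eq0 M ==> iff) dleb.
Proof. intros a a' H b b' K. unfold dleb. now rewrite H, K. Qed.

Lemma real0_at n : closed_val real0 @ n == rat' O O O.
Proof. exact (beta (rat zero zero zero) enil n). Qed.
Lemma real1_at n : closed_val real1 @ n == rat' I O O.
Proof. exact (beta (rat one zero zero) enil n). Qed.

Lemma expansion_unit : in_unit' x.
Proof.
  split; [exact expansion_real|split]; intro n.
  - apply (cmp_rat (I + I) n dleb_proper (real0_at n) (Hx n)). apply dle_iff.
    eexists. transitivity (O + (pow' @ n * (num' h @ n * (O + I) + O * (den' @ n + I))
      + (I + I) * ((O + I) * (den' @ n + I)))); [ring|].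
    apply plus_proper; [ring|reflexivity].
  - apply (cmp_rat (I + I) n dleb_proper (Hx n) (real1_at n)). apply dle_iff.
    fold (pow4 n). assert (K := num_upper O n). apply dlt_iff in K as [w K].
    assert (E : num' h @ (O + n) == num' h @ n) by (apply app_proper; ring).
    rewrite E, num_0 in K.
    assert (L : pow4 n == num' h @ n + w + I) by (rewrite <- K; ring).
    exists (pow' @ n * (w + I) + (I + I) * pow4 n).
    transitivity (pow' @ n * pow4 n + (I + I) * pow4 n); [ring|].
    rewrite L at 1. ring.
Qed.

End Expansion.

(* A difference in the digit before position [m] is too large to be compensated
   by the later digits. *)
Lemma num_separation h h' m j : num' h @ m << num' h' @ m ->
  (I + I + I) * num' h @ (m + j) + (I + I) * pow4 j << (I + I + I) * num' h' @ (m + j).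
Proof.
  intro H0.
  (* After j more digits, a lead of 1 has become 4^j, while the smaller number has caught up by at
     most (4^j - 1)/3. So the gap exceeds (2/3) 4^j; the factor 3 clears the denominator. *)
  refine (@qf_ind [ty0; ty1; ty1; ty1]
    (three ⊗ (v4 · (v1 ⊕ v0)) ⊕ two ⊗ (v2 · v0 ⊕ one) ≺ three ⊗ (v3 · (v1 ⊕ v0)))
    _ (econs m (econs den' (econs (num' h') (econs (num' h) enil)))) _ _ j);
    [simpl; auto|..].
  - change ((I + I + I) * num' h @ (m + O) + (I + I) * pow4 O <<
      (I + I + I) * num' h' @ (m + O)).
    apply dlt_iff in H0 as [w H]. apply dlt_iff. exists ((I + I + I) * w).
    rewrite !add0, pow4_0, H. ring.
  - intros k H.
    change ((I + I + I) * num' h @ (m + k) + (I + I) * pow4 k <<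
      (I + I + I) * num' h' @ (m + k)) in H.
    change ((I + I + I) * num' h @ (m + (k + I)) + (I + I) * pow4 (k + I) <<
      (I + I + I) * num' h' @ (m + (k + I))).
    rewrite <- (addA m), !num_S, pow4_S.
    apply dlt_iff in H as [w H]. apply dlt_iff.
    assert (E : (I + I + I) * ((I + I + (I + I)) * num' h' @ (m + k)) ==
      (I + I + (I + I)) * ((I + I + I) * num' h @ (m + k) + (I + I) * pow4 k + w + I)).
    { rewrite <- H. ring. }
    assert (E' : forall s, (I + I + I) * ((I + I + (I + I)) * num' h' @ (m + k) + s) ==
      (I + I + (I + I)) * ((I + I + I) * num' h @ (m + k) + (I + I) * pow4 k + w + I)
      + (I + I + I) * s).
    { intro s. rewrite <- E. ring. }
    set (s := sg' (h' @ (m + k))).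
    destruct (sg_cases (h @ (m + k))) as [K|K].
    + exists ((I + I + (I + I)) * w + (I + I + I) + (I + I + I) * s).
      rewrite E', K. ring.
    + exists ((I + I + (I + I)) * w + (I + I + I) * s).
      rewrite E', K. ring.
Qed.

Lemma digit_separation h h' x x' m :
  (forall n, x @ n == rat' (num' h @ n) O (den' @ n)) ->
  (forall n, x' @ n == rat' (num' h' @ n) O (den' @ n)) ->
  num' h @ m << num' h' @ m ->
  ~ (forall n, cmp dleb (x' @ n) (x @ n) (I + I) n).
Proof.
  intros Hx Hx' H K.
  (* At the index n = m + j the tolerance 2 / 2^n is below the guaranteed
     difference, as 2^n = 4 * 4^m. *)
  set (j := m + (I + I)). set (n := m + j).
  specialize (K n). apply (proj1 (cmp_rat (I + I) n dleb_proper (Hx' n) (Hx n))) in K.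
  apply dle_iff in K as [w K]. fold (pow4 n) in K.
  assert (E4 := num_separation j H). apply dlt_iff in E4 as [z E4]. fold n in E4.
  set (N := num' h @ n) in *. set (N' := num' h' @ n) in *.
  set (q := pow' @ m).
  assert (EP : pow' @ n == (I + I + (I + I)) * (q * q)).
  { unfold n, j. rewrite !pow_add.
    assert (E : pow' @ I == I + I).
    { transitivity (pow' @ (O + I)); [apply app_proper; ring|].
      rewrite pow_S, pow_0. reflexivity. }
    rewrite E. unfold q. ring. }
  assert (EQ : pow4 n == q * q * pow4 j) by (unfold n; rewrite pow4_add, pow_sqr; reflexivity).
  destruct (pow_pos m) as [p Hp]. fold q in Hp.
  assert (B : (I + I + I) * (pow' @ n * (N * pow4 n) + (I + I) * (pow4 n * pow4 n)) ==
    pow' @ n * pow4 n * ((I + I + I) * N') + (I + I + I) * w).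
  { transitivity ((I + I + I) * (pow' @ n * (N * pow4 n + O * pow4 n)
      + (I + I) * (pow4 n * pow4 n))); [ring|]. rewrite K. ring. }
  rewrite E4 in B.
  assert (C : (I + I + I) * ((I + I) * (pow4 n * pow4 n)) ==
    pow' @ n * pow4 n * ((I + I) * pow4 j + z + I) + (I + I + I) * w).
  { apply (add_cancel (x := (I + I + I) * (pow' @ n * (N * pow4 n)))).
    transitivity ((I + I + I) * (pow' @ n * (N * pow4 n) + (I + I) * (pow4 n * pow4 n)));
      [ring|]. rewrite B. ring. }
  (* Against the 6 squares of 4^n on the left of [C], the right side contains 8. This is the
     comparison of the tolerance (1/2) 4^(-m) with the gap (2/3) 4^(-m). *)
  assert (D1 : pow' @ n * pow4 n * ((I + I) * pow4 j) ==
    (I + I + I) * ((I + I) * (pow4 n * pow4 n)) + (I + I) * (pow4 n * pow4 n)).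
  { transitivity ((I + I + (I + I)) * (I + I) * (pow4 n * (q * q * pow4 j))).
    - rewrite EP. ring.
    - rewrite <- EQ. ring. }
  assert (D2 : exists t, pow' @ n * pow4 n == t + I).
  { exists (pow' @ n * den' @ n + (I + I + (I + I)) * (p * q) +
      (I + I + (I + I)) * p + (I + I + I)).
    unfold pow4. transitivity (pow' @ n * den' @ n + pow' @ n); [ring|].
    rewrite EP. rewrite Hp. ring. }
  destruct D2 as [t Ht].
  apply (@no_gap ((I + I + I) * ((I + I) * (pow4 n * pow4 n)))
    ((I + I) * (pow4 n * pow4 n) + pow' @ n * pow4 n * z + t + (I + I + I) * w)).
  rewrite C at 1.
  transitivity (pow' @ n * pow4 n * ((I + I) * pow4 j) + pow' @ n * pow4 n * z + pow' @ n * pow4 n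
    + (I + I + I) * w); [ring|].
  rewrite D1.
  transitivity ((I + I + I) * ((I + I) * (pow4 n * pow4 n)) + (I + I) * (pow4 n * pow4 n)
    + pow' @ n * pow4 n * z + (t + I) + (I + I + I) * w); [|ring]. rewrite <- Ht. reflexivity.
Qed.

Lemma times4_lt N N' s s' : s == O \/ s == I -> N << N' ->
  ~ (I + I + (I + I)) * N + s == (I + I + (I + I)) * N' + s'.
Proof.
  intros Hs L E. apply dlt_iff in L as [z L]. rewrite L in E.
  destruct Hs as [Hs|Hs]; rewrite Hs in E.
  - apply (@no_gap ((I + I + (I + I)) * N + O)
      ((I + I + (I + I)) * z + (I + I + I) + s')).
    rewrite E at 1. ring.
  - apply (@no_gap ((I + I + (I + I)) * N + I)
      ((I + I + (I + I)) * z + (I + I) + s')).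
    rewrite E at 1. ring.
Qed.

Lemma times4_cancel N N' s s' : s == O \/ s == I -> s' == O \/ s' == I ->
  (I + I + (I + I)) * N + s == (I + I + (I + I)) * N' + s' -> s == s'.
Proof.
  intros Hs Hs' E. destruct (dlt_total N N') as [L|[L|L]].
  - now apply (times4_lt (s := s) (s' := s')) in L.
  - rewrite L in E. now apply add_cancel in E.
  - symmetry in E. now apply (times4_lt (s := s') (s' := s)) in L.
Qed.

(** No least differing digit has to be found. If the numerators at k + 1 differ either way,
    [digit_separation] applies; if they agree, so do their last digits, which are remainders modulo
    4. *)
Lemma expansion_inj h h' x x' k :
  (forall n, x @ n == rat' (num' h @ n) O (den' @ n)) ->
  (forall n, x' @ n == rat' (num' h' @ n) O (den' @ n)) ->
  ~ sg' (h @ k) == sg' (h' @ k) -> ~ real_eq' x x'.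
Proof.
  intros Hx Hx' Hk E.
  destruct (dlt_total (num' h @ (k + I)) (num' h' @ (k + I))) as [L|[L|L]].
  - apply (digit_separation Hx Hx' L). intro n. apply E.
  - apply Hk. rewrite !num_S in L. apply times4_cancel in L; auto using sg_cases.
  - apply (digit_separation Hx' Hx L). intro n. apply E.
Qed.

Lemma expansion_at h n : closed_val expansion @ h @ n == rat' (num' h @ n) O (den' @ n).
Proof.
  exact (beta2 (rat (numf v1 · v0) zero (denf · v0)) enil h n).
Qed.

(** * The diagonal argument from (∃^3) and QF-AC^{0,1} *)

Section Diagonal.

Hypothesis HA : forall B, QF_AC ty0 ty1 B -> models M B.
Hypothesis H3 : models M exists3_sentence.

(** The functional of (∃^3) accepts only type 2 objects. Equality of two numbers is packed into one
    function argument so that QF-AC^{1,0} can supply its characteristic functional. *)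
Lemma equality_tester : exists Z : dom M ty2, forall f : dom M ty1,
  Z @ f == O <-> f @ O == f @ I.
Proof.
  assert (HB : forall B, QF_AC ty1 ty0 B -> models M B).
  { intros B HB. apply HR. right; right; right; right; right. exact HB. }
  destruct (qf_ac HB (G := []) (A := (v1 · zero ≐ v1 · one ∧' v0 ≐ zero) ∨'
    (fneg (v1 · zero ≐ v1 · one) ∧' v0 ≐ one)) ltac:(simpl; auto) (e := enil))
    as [Z HZ].
  - intro f. destruct (classic (f @ O == f @ I)) as [H|H].
    + exists O. left. split; [exact H|apply (eq0_refl HE)].
    + exists I. right. split; [exact H|apply (eq0_refl HE)].
  - exists Z. intro f. destruct (HZ f) as [[H K]|[H K]].
    + change (f @ O == f @ I) in H. change (Z @ f == O) in K. tauto.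
    + change (~ f @ O == f @ I) in H. change (Z @ f == I) in K.
      split; [|tauto]. intro L. exfalso. rewrite K in L.
      apply (@no_gap O O). rewrite <- L at 1. ring.
Qed.

Lemma nin_holds : models M NIN.
Proof.
  intros Y _.
  set (X := closed_val expansion).
  destruct equality_tester as [Z HZ].
  destruct H3 as [E HE3].
  pose (G := [ty1; ty0; ty3; ty2; ty2; ty1 ⇒ ty1]).
  (* Recursion from n with the constant step [b] is a function with value n at 0 and Y(x_h') at 1.
     [Z] applied to it tests whether n = Y(x_h'). *)
  pose (b := twk (twk (twk v4)) · (twk (twk (twk v5)) · v2) :
    tm (ty0 :: ty0 :: ty1 :: G) ty0).
  pose (B := twk v3 · (tcst (cR ty0) · lam (lam b) · twk v1) : tm (ty1 :: G) ty0).
  pose (W := lam B).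
  pose (e := econs E (econs Z (econs Y (econs X enil))) :
    env M [ty3; ty2; ty2; ty1 ⇒ ty1]).
  assert (HW : forall (h : dom M ty1) (n : D) (h' : dom M ty1),
    teval (econs h (econs n e)) W @ h' == O <->
    n == Y @ (X @ h')).
  { intros h n h'.
    pose (F := teval (econs h' (econs h (econs n e))) (lam (lam b))).
    assert (K : teval (econs h (econs n e)) W @ h' == Z @ (ci (cR ty0) @ F @ n)).
    { exact (beta B (econs h (econs n e)) h'). }
    rewrite K, HZ, rec_0.
    assert (K1 : ci (cR ty0) @ F @ n @ I == Y @ (X @ h')).
    { transitivity (ci (cR ty0) @ F @ n @ (O + I)); [apply (app_proper (ci (cR ty0) @ F @ n)); ring|].
      rewrite rec_S.
      exact (beta_rec b (econs h' (econs h (econs n e))) O _). }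
    now rewrite K1. }
  assert (HEW : forall (h : dom M ty1) (n : D), E @ teval (econs h (econs n e)) W == O <->
    exists h', n == Y @ (X @ h')).
  { intros h n. destruct (HE3 (teval (econs h (econs n e)) W)) as [_ [K1 K2]].
    split.
    - intro H. destruct (K2 H) as [h' Hh]. exists h'. now apply (HW h n h').
    - intros [h' Hh]. apply K1. exists h'. now apply (HW h n h'). }
  (* [E] applied to [W] states without quantifiers that n is a value of Y on expansions. For other n
     any function will do. *)
  destruct (qf_ac HA (A := (v2 · W ≐ zero) ⊃ (v4 · (v5 · v0) ≐ v1))
    ltac:(simpl; auto) (e := e)) as [H HH].
  { intro n. destruct (classic (exists h', n == Y @ (X @ h'))) as [[h' Hh]|K].
    - exists h'. intros _. now apply eq0_sym.
    - exists (closed_val real0). intro L. apply (HEW (closed_val real0) n) in L. contradiction. }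
  pose (d := teval (econs H enil) (lam (cosgt (v1 · v0 · v0)))).
  assert (Hd : forall n, d @ n == cosg' (H @ n @ n)).
  { intro n. exact (beta (cosgt (v1 · v0 · v0)) (econs H enil) n). }
  pose (n := Y @ (X @ d)).
  (* Since [d] itself witnesses that n is a value, the choice function returns a preimage of n. *)
  assert (K : Y @ (X @ (H @ n)) == n).
  { apply (HH n). apply (HEW (H @ n) n). exists d. reflexivity. }
  exists (X @ d), (X @ (H @ n)). split; [|split; [|split]].
  - exact (expansion_unit (expansion_at d)).
  - exact (expansion_unit (expansion_at (H @ n))).
  - refine (expansion_inj (k := n) (expansion_at d) (expansion_at (H @ n)) _).
    rewrite Hd. apply sg_cosg.
  - exact (eq0_sym HE K).
Qed.

End Diagonal.
End Arithmetic.

(** * A generic injection of the reals of a countable hull *)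

Definition real : Type := nat -> nat.
Definition push (n : nat) (a : real) : real :=
  fun i => match i with 0 => n | S i => a i end.
Definition pop (a : real) : real := fun i => a (S i).
Definition row (d : real) (n : nat) : real := fun k => d (pr n k).

Definition graph : Type := real -> nat -> Prop.

(* [gr] is the part of the generic injection decided so far; [fb] contains its
   range and is the set of values that may no longer be used. *)
Record cond : Type := Cond { gr : graph; fb : nat -> Prop }.

Definition functional (p : graph) : Prop := forall a m n, p a m -> p a n -> m = n.
Definition subgraph (p q : graph) : Prop := forall a m, p a m -> q a m.

Record good (p : cond) : Prop := Good {
  good_functional : functional (gr p);
  good_inj : forall a b m, gr p a m -> gr p b m -> a = b;
  good_range : forall a m, gr p a m -> fb p m;
  good_free : forall N, exists m, N <= m /\ ~ fb p m }.

Record ext (p q : cond) : Prop := Ext {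
  ext_gr : subgraph (gr p) (gr q);
  ext_fb : forall m, fb p m -> fb q m;
  ext_new : forall a m, gr q a m -> gr p a m \/ ~ fb p m }.

Lemma ext_refl p : ext p p.
Proof. split; unfold subgraph; auto. Qed.

Lemma ext_trans p q r : ext p q -> ext q r -> ext p r.
Proof.
  intros [H1 H2 H3] [K1 K2 K3]. split; unfold subgraph in *; auto.
  intros a m H. destruct (K3 a m H) as [K|K]; auto.
Qed.

(** * Fusion of conditions *)

Section Fusion.

Variable Q : nat -> graph -> Prop.
Hypothesis Q_mono : forall n g g', subgraph g g' -> Q n g -> Q n g'.

(* The values listed in [l] stay free for ever, so that infinitely many values
   are still free in the limit. *)
Lemma fusion_step p q l n : good q -> ext p q -> (forall m, In m l -> ~ fb q m) ->
  (forall q, good q -> ext p q -> exists r, good r /\ ext q r /\ Q n (gr r)) ->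
  exists r t, good r /\ ext q r /\ (forall m, In m (t :: l) -> ~ fb r m) /\
    Q n (gr r) /\ n <= t.
Proof.
  intros Hq Hpq Hl H.
  (* The values in [l] are forbidden while [r] is chosen and released afterwards; by then [r] has
     used none of them. *)
  set (q' := Cond (gr q) (fun m => fb q m \/ In m l)).
  assert (Hq' : good q').
  { destruct Hq as [G1 G2 G3 G4]. split; simpl; eauto.
    intro N. destruct (G4 (Nat.max N (S (list_max l)))) as [m [Hm Fm]].
    exists m. split; [lia|]. intros [K|K]; auto.
    assert (L := proj1 (list_max_le l (list_max l)) (le_n _)).
    rewrite Forall_forall in L. specialize (L m K). lia. }
  assert (Hqq' : ext q q') by (split; unfold subgraph; simpl; auto).
  destruct (H q' Hq' (ext_trans Hpq Hqq')) as [r [Hr [Er Qr]]].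
  destruct (good_free Hr n) as [t [Ht Ft]].
  exists (Cond (gr r) (fun m => fb r m /\ ~ In m l)), t.
  assert (N : forall a m, gr r a m -> ~ In m l).
  { intros a m K L. destruct (ext_new Er K) as [K'|K'].
    - apply (Hl m L). exact (good_range Hq K').
    - apply K'. now right. }
  split; [|split; [|split; [|split]]]; auto.
  - destruct Hr as [G1 G2 G3 G4]. split; simpl; eauto.
    intro k. destruct (G4 k) as [m [Hm Fm]]. exists m. tauto.
  - split; simpl.
    + intros a m K. exact (ext_gr Er K).
    + intros m K. split; [apply (ext_fb Er); now left|].
      intro L. exact (Hl m L K).
    + intros a m K. destruct (ext_new Er K) as [K'|K']; auto.
      right. intro L. apply K'. now left.
  - simpl. intros m [<-|K]; tauto.
Qed.

(** The union of an arbitrary increasing chain may forbid every number. Here step n reserves one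
    more free value, of size at least n, and never gives it up. *)
Lemma fusion p : good p ->
  (forall q, good q -> ext p q -> forall n, exists r, good r /\ ext q r /\ Q n (gr r)) ->
  exists r, good r /\ ext p r /\ forall n, Q n (gr r).
Proof.
  intros Hp H.
  pose (inv := fun s : cond * list nat =>
    good (fst s) /\ ext p (fst s) /\ forall m, In m (snd s) -> ~ fb (fst s) m).
  pose (R := fun n (s s' : cond * list nat) => ext (fst s) (fst s') /\
    Q n (gr (fst s')) /\ incl (snd s) (snd s') /\ exists t, n <= t /\ In t (snd s')).
  assert (step : forall n (s : {s | inv s}), exists s' : {s | inv s},
    R n (proj1_sig s) (proj1_sig s')).
  { intros n [[q l] [Hq [Epq Hl]]]. simpl in *.
    destruct (fusion_step (n := n) Hq Epq Hl) as [r [t [Hr [Er [Hl' [Qr Ht]]]]]].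
    { intros; auto. }
    assert (K : inv (r, t :: l)).
    { split; [|split]; auto. exact (ext_trans Epq Er). }
    exists (exist _ _ K). split; [|split; [|split]]; simpl; auto.
    - intros x Hx. now right.
    - exists t. auto. }
  assert (K0 : inv (p, [])).
  { split; [|split]; simpl; auto using ext_refl. }
  pose (nxt := fun n s => proj1_sig (constructive_indefinite_description _ (step n s))).
  pose (sq := nat_rect (fun _ => {s | inv s}) (exist _ _ K0) nxt).
  pose (q := fun n => fst (proj1_sig (sq n))).
  pose (l := fun n => snd (proj1_sig (sq n))).
  assert (HR : forall n, R n (q n, l n) (q (S n), l (S n))).
  { intro n. unfold q, l. rewrite <- !surjective_pairing.
    exact (proj2_sig (constructive_indefinite_description _ (step n (sq n)))). }
  assert (Hinv : forall n, inv (q n, l n)).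
  { intro n. unfold q, l. rewrite <- surjective_pairing. apply proj2_sig. }
  assert (Eq : forall m n, m <= n -> ext (q m) (q n)).
  { induction 1; [apply ext_refl|eapply ext_trans; [exact IHle|apply HR]]. }
  assert (El : forall m n, m <= n -> incl (l m) (l n)).
  { induction 1; [apply incl_refl|eapply incl_tran; [exact IHle|apply HR]]. }
  exists (Cond (fun a m => exists n, gr (q n) a m) (fun m => exists n, fb (q n) m)).
  assert (E : forall n, ext (q n)
    (Cond (fun a m => exists n, gr (q n) a m) (fun m => exists n, fb (q n) m))).
  { intro n. split; simpl; [intros a m K; exists n; auto|eauto|].
    intros a m [k K]. destruct (le_ge_dec k n) as [L|L].
    - left. exact (ext_gr (Eq k n L) K).
    - exact (ext_new (Eq n k L) K). }
  split; [|split].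
  - split; simpl.
    + intros a m m' [i K] [j L].
      apply (good_functional (proj1 (Hinv (Nat.max i j)))) with (a := a);
        [apply (ext_gr (Eq i (Nat.max i j) ltac:(lia)) K)|
         apply (ext_gr (Eq j (Nat.max i j) ltac:(lia)) L)].
    + intros a b m [i K] [j L].
      apply (good_inj (proj1 (Hinv (Nat.max i j)))) with (m := m);
        [apply (ext_gr (Eq i (Nat.max i j) ltac:(lia)) K)|
         apply (ext_gr (Eq j (Nat.max i j) ltac:(lia)) L)].
    + intros a m [i K]. exists i. exact (good_range (proj1 (Hinv i)) K).
    + intro N. destruct (HR N) as [_ [_ [_ [t [Ht Kt]]]]].
      exists t. split; auto. intros [i K].
      set (j := Nat.max i (S N)).
      apply (proj2 (proj2 (Hinv j)) t).
      * apply (El (S N) j ltac:(lia)). exact Kt.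
      * exact (ext_fb (Eq i j ltac:(lia)) K).
  - exact (E 0).
  - intro n. apply Q_mono with (g := gr (q (S n))); [apply E|apply HR].
Qed.

End Fusion.

(* A name reads off a value from finitely or infinitely many decided values of the
   generic injection. *)
Definition name : Type := graph -> real -> nat -> Prop.

Record valid (F : name) : Prop := Valid {
  valid_mono : forall p q a v, subgraph p q -> F p a v -> F q a v;
  valid_fun : forall p a v w, functional p -> F p a v -> F p a w -> v = w }.

(* Truth values are coded with 0 for true. *)
Definition bit (P : Prop) : nat := if excluded_middle_informative P then 0 else 1.

Lemma bit_0 P : bit P = 0 <-> P.
Proof. unfold bit. destruct (excluded_middle_informative P); split; easy. Qed.

(** Exactly what terms and quantifier-free formulas require: arithmetic, pairing for [row], atomic
    formulas, and connectives on truth values. *)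
Definition hop (j x y : nat) : nat :=
  match j with
  | 0 => x + y
  | 1 => x * y
  | 2 => pr x y
  | 3 => bit (x = y)
  | 4 => bit (x < y)
  | 5 => bit (x = 0 -> y = 0)
  | 6 => bit (x = 0 /\ y = 0)
  | _ => bit (x = 0 \/ y = 0)
  end.

Inductive obj : Type :=
| Reals (l : list real)
| Name (F : name)
| Condition (p : cond)
| Dense (D : cond -> Prop).

(** One Skolem function per closure property. Being data, their compositions can be numbered, which
    makes the hull countable and lists its dense sets. *)
Inductive opcode : Type :=
| op_const | op_append | op_push | op_row | op_skolem | op_value | op_choice
| op_start | op_meet
| op_dense_total | op_dense_choice | op_dense_generic
| op_nconst | op_neval | op_nhop | op_nreal | op_ncomp | op_nsub | op_nmu | op_nrec
| op_nfix | op_ngeneric.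

Definition opcode_code (o : opcode) : nat :=
  match o with
  | op_const => 0 | op_append => 1 | op_push => 2 | op_row => 3
  | op_skolem => 4 | op_value => 5 | op_choice => 6 | op_start => 7
  | op_meet => 8 | op_dense_total => 9 | op_dense_choice => 10 | op_dense_generic => 11
  | op_nconst => 12 | op_neval => 13 | op_nhop => 14 | op_nreal => 15
  | op_ncomp => 16 | op_nsub => 17 | op_nmu => 18 | op_nrec => 19
  | op_nfix => 20 | op_ngeneric => 21
  end.

Lemma opcode_inj o o' : opcode_code o = opcode_code o' -> o = o'.
Proof. destruct o, o'; simpl; intro H; easy. Qed.

Inductive tree : Type :=
| leaf : tree
| node : opcode -> nat -> tree -> tree -> tree -> tree.

Fixpoint treecode (t : tree) : nat :=
  match t with
  | leaf => 0
  | node o j x y z => S (pr (opcode_code o)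
      (pr j (pr (treecode x) (pr (treecode y) (treecode z)))))
  end.

Lemma treecode_inj t : forall u, treecode t = treecode u -> t = u.
Proof.
  induction t; intros []; simpl; intro H; try easy.
  injection H as H. code_inj. f_equal; auto using opcode_inj.
Qed.

(** * The countable hull and a sequence of conditions generic over it *)

Section Generic.

(* Functions under which the ground reals have to be closed, and functionals that
   have to be computable. *)
Variable skolem : nat -> list real -> real.
Variable fixed : nat -> real -> nat.

(** A fixed choice makes extending into [D] an operation of the hull. Thus each [gen n] is itself in
    the hull, and so are the reals it decides. If no good extension is in [D], any good extension is
    returned. *)
Definition meet (D : cond -> Prop) (q : cond) : cond :=
  epsilon (inhabits q) (fun r => good r /\ ext q r /\
    ((exists r, good r /\ ext q r /\ D r) -> D r)).

Lemma meet_spec D q : good q -> good (meet D q) /\ ext q (meet D q) /\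
  ((exists r, good r /\ ext q r /\ D r) -> D (meet D q)).
Proof.
  intro Hq. apply (epsilon_spec (inhabits q) (fun r => good r /\ ext q r /\
    ((exists r, good r /\ ext q r /\ D r) -> D r))).
  destruct (classic (exists r, good r /\ ext q r /\ D r)) as [[r [H [K L]]]|N].
  - exists r. auto.
  - exists q. split; [auto|split; [apply ext_refl|tauto]].
Qed.

(* Either everything is decided, or it is decided that something stays undefined;
   the latter is impossible for the name of a total functional. *)
Definition total_dense (F : name) (a : real) (q : cond) : Prop :=
  (forall n, exists v, F (gr q) (push n a) v) \/
  exists n, forall r, good r -> ext q r -> ~ exists v, F (gr r) (push n a) v.

(** All witnesses are packed into the rows of one real, so that this real can be named in the
    hull. *)
Definition choice_dense (F : name) (q : cond) : Prop :=
  (exists d, forall n, F (gr q) (push n (row d n)) 0) \/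
  exists n, forall r, good r -> ext q r -> ~ exists f, F (gr r) (push n f) 0.

Definition nconst (k : nat) : name := fun _ _ v => v = k.
Definition neval (F : name) : name := fun p a v => exists x, F p a x /\ v = a x.
Definition nhop (j : nat) (F G : name) : name :=
  fun p a v => exists x y, F p a x /\ G p a y /\ v = hop j x y.
Definition nreal (f : real) (F : name) : name :=
  fun p a v => exists x, F p a x /\ v = f x.
(** The single graph [p] has to decide the whole real [b]; [denotes_decided] provides such a
    graph. *)
Definition ncomp (F G : name) : name :=
  fun p a v => exists b : real, (forall n, G p (push n a) (b n)) /\ F p b v.
Definition nsub (F X G : name) : name :=
  fun p a v => exists x (b : real),
    X p a x /\ (forall n, G p (push n a) (b n)) /\ F p (push x b) v.
Definition nmu (F : name) : name :=
  fun p a v => F p (push v a) 0 /\ forall m, m < v -> exists k, F p (push m a) (S k).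
Definition nrec (F M X : name) : name :=
  fun p a v => exists x (s : real), X p a x /\ M p a (s 0) /\
    (forall k, k < x -> F p (push k (push (s k) a)) (s (S k))) /\ v = s x.

Definition zero_real : real := fun _ => 0.

Definition operate (o : opcode) (j : nat) (x y z : obj) : obj :=
  match o, x, y, z with
  | op_const, _, _, _ => Reals [fun _ => j]
  | op_append, Reals l, Reals l', _ => Reals (l ++ l')
  | op_push, Reals [a], _, _ => Reals [push j a]
  | op_row, Reals [a], _, _ => Reals [row a j]
  | op_skolem, Reals l, _, _ => Reals [skolem j l]
  | op_value, Name F, Reals [a], Condition q =>
      Reals [epsilon (inhabits zero_real) (fun b => forall n, F (gr q) (push n a) (b n))]
  | op_choice, Name F, Condition q, _ =>
      Reals [epsilon (inhabits zero_real)
               (fun d => forall n, F (gr q) (push n (row d n)) 0)]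
  | op_start, _, _, _ => Condition (Cond (fun _ _ => False) (fun _ => False))
  | op_meet, Dense D, Condition q, _ => Condition (meet D q)
  | op_dense_total, Name F, Reals [a], _ => Dense (total_dense F a)
  | op_dense_choice, Name F, _, _ => Dense (choice_dense F)
  | op_dense_generic, Reals [a], _, _ => Dense (fun q => exists m, gr q a m)
  | op_nconst, _, _, _ => Name (nconst j)
  | op_neval, Name F, _, _ => Name (neval F)
  | op_nhop, Name F, Name G, _ => Name (nhop j F G)
  | op_nreal, Reals [f], Name F, _ => Name (nreal f F)
  | op_ncomp, Name F, Name G, _ => Name (ncomp F G)
  | op_nsub, Name F, Name X, Name G => Name (nsub F X G)
  | op_nmu, Name F, _, _ => Name (nmu F)
  | op_nrec, Name F, Name M, Name X => Name (nrec F M X)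
  | op_nfix, _, _, _ => Name (fun _ a v => v = fixed j a)
  | op_ngeneric, _, _, _ => Name (fun p a v => p a v)
  | _, _, _, _ => Reals []
  end.

Fixpoint ev (t : tree) : obj :=
  match t with
  | leaf => Reals []
  | node o j x y z => operate o j (ev x) (ev y) (ev z)
  end.

Definition hull (u : obj) : Prop := exists t, ev t = u.

Lemma hull_op o j x y z : hull x -> hull y -> hull z -> hull (operate o j x y z).
Proof.
  intros [t <-] [t' <-] [t'' <-]. exists (node o j t t' t''). reflexivity.
Qed.

Lemma hull_0 o j : hull (operate o j (Reals []) (Reals []) (Reals [])).
Proof. apply hull_op; exists leaf; reflexivity. Qed.
Lemma hull_1 o j x : hull x -> hull (operate o j x (Reals []) (Reals [])).
Proof. intro. apply hull_op; auto; exists leaf; reflexivity. Qed.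
Lemma hull_2 o j x y : hull x -> hull y -> hull (operate o j x y (Reals [])).
Proof. intros. apply hull_op; auto; exists leaf; reflexivity. Qed.

Definition tree_of (n : nat) : tree := epsilon (inhabits leaf) (fun t => treecode t = n).

Lemma tree_of_code t : tree_of (treecode t) = t.
Proof.
  apply treecode_inj.
  apply (epsilon_spec (inhabits leaf) (fun u => treecode u = treecode t)). eauto.
Qed.

Fixpoint gen (n : nat) : cond :=
  match n with
  | 0 => Cond (fun _ _ => False) (fun _ => False)
  | S n => match ev (tree_of n) with Dense D => meet D (gen n) | _ => gen n end
  end.

Lemma gen_good n : good (gen n).
Proof.
  induction n; simpl.
  - split; simpl; try easy. intro N. exists N. auto.
  - destruct (ev (tree_of n)); auto. now apply meet_spec.
Qed.

Lemma gen_ext m n : m <= n -> ext (gen m) (gen n).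
Proof.
  induction 1; [apply ext_refl|]. eapply ext_trans; [exact IHle|]. simpl.
  destruct (ev (tree_of m0)); try apply ext_refl. apply meet_spec, gen_good.
Qed.

Lemma gen_hull n : hull (Condition (gen n)).
Proof.
  induction n; simpl; [exact (hull_0 op_start 0)|].
  destruct (ev (tree_of n)) as [| | |D] eqn:E; auto.
  apply (hull_2 op_meet 0 (x := Dense D) (y := Condition (gen n))); [eexists; exact E|exact IHn].
Qed.

Lemma gen_meets D : hull (Dense D) ->
  (forall q, good q -> exists r, good r /\ ext q r /\ D r) -> exists n, D (gen n).
Proof.
  intros [t Ht] H. exists (S (treecode t)). simpl. rewrite tree_of_code, Ht.
  apply meet_spec, H; apply gen_good.
Qed.

Definition gg (n : nat) : graph := gr (gen n).

Lemma gg_mono m n : m <= n -> subgraph (gg m) (gg n).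
Proof. intro. now apply gen_ext. Qed.

Lemma gg_fun n : functional (gg n).
Proof. apply good_functional, gen_good. Qed.

Definition ground (a : real) : Prop := hull (Reals [a]).

Definition denotes (F : name) (f : real -> nat) : Prop :=
  hull (Name F) /\ valid F /\ forall a, ground a -> exists n, F (gg n) a (f a).
Definition computable (f : real -> nat) : Prop := exists F, denotes F f.

Lemma valid_gg F m n a v w : valid F -> F (gg m) a v -> F (gg n) a w -> v = w.
Proof.
  intros V H K. apply (valid_fun V) with (p := gg (Nat.max m n)) (a := a).
  - apply gg_fun.
  - apply (valid_mono V) with (p := gg m); auto. apply gg_mono; lia.
  - apply (valid_mono V) with (p := gg n); auto. apply gg_mono; lia.
Qed.

Lemma valid_up F m n a v : valid F -> m <= n -> F (gg m) a v -> F (gg n) a v.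
Proof. intros V L H. apply (valid_mono V) with (p := gg m); auto. now apply gg_mono. Qed.

Lemma ground_push n a : ground a -> ground (push n a).
Proof. exact (hull_1 op_push n (x := Reals [a])). Qed.
Lemma ground_row n a : ground a -> ground (row a n).
Proof. exact (hull_1 op_row n (x := Reals [a])). Qed.
Lemma ground_const n : ground (fun _ => n).
Proof. exact (hull_0 op_const n). Qed.

Lemma hull_list l : l <> [] -> Forall ground l -> hull (Reals l).
Proof.
  intros N H. induction H as [|a l Ha Hl IH]; [easy|].
  destruct l as [|b l]; auto.
  apply (hull_2 op_append 0 (x := Reals [a]) (y := Reals (b :: l))); auto.
  apply IH. easy.
Qed.

Lemma ground_skolem j l : l <> [] -> Forall ground l -> ground (skolem j l).
Proof. intros N H. apply (hull_1 op_skolem j (x := Reals l)). now apply hull_list. Qed.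

(** If no extension forces some value to stay undecided, every value can be decided below every
    extension, and fusion decides all of them at once. *)
Lemma total_dense_spec F a : valid F -> forall q, good q ->
  exists r, good r /\ ext q r /\ total_dense F a r.
Proof.
  intros V q Hq.
  destruct (classic (exists r, good r /\ ext q r /\ exists n,
    forall r', good r' -> ext r r' -> ~ exists v, F (gr r') (push n a) v))
    as [[r [H [K L]]]|N].
  - exists r. split; [|split]; auto. now right.
  - destruct (@fusion (fun n g => exists v, F g (push n a) v)) with (p := q)
      as [r [H [K L]]]; auto.
    + intros n g g' S [v Hv]. exists v. now apply (valid_mono V) with (p := g).
    + intros r Hr Er n. apply NNPP. intro N'. apply N.
      exists r. split; [|split]; auto. exists n. intros r' H K L. apply N'. eauto.
    + exists r. split; [|split]; auto. left. exact L.
Qed.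

(** The other alternative of [total_dense] fails by genericity: it would keep undecided a value that
    a later condition of the sequence decides, since [push n a] is ground. *)
Lemma denotes_decided F f a : denotes F f -> ground a ->
  exists N, forall n, F (gg N) (push n a) (f (push n a)).
Proof.
  intros [HF [V D]] Ha.
  destruct (@gen_meets (total_dense F a)) as [N [H|[n H]]].
  - exact (hull_2 op_dense_total 0 HF Ha).
  - now apply total_dense_spec.
  - exists N. intro n. destruct (H n) as [v Hv].
    destruct (D (push n a)) as [m Hm]; [now apply ground_push|].
    now rewrite <- (valid_gg V Hv Hm).
  - exfalso. destruct (D (push n a)) as [m Hm]; [now apply ground_push|].
    apply (H (gen (Nat.max N m))); [apply gen_good|apply gen_ext; lia|].
    exists (f (push n a)). apply (valid_up (m := m) V); auto. lia.
Qed.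

(** The generic object adds no new reals: the sequence is determined by a name, a ground real and a
    condition, all in the hull. *)
Lemma ground_value f a : computable f -> ground a -> ground (fun n => f (push n a)).
Proof.
  intros [F HF] Ha. destruct (denotes_decided HF Ha) as [N HN].
  pose (P := fun b : real => forall n, F (gr (gen N)) (push n a) (b n)).
  assert (K : P (epsilon (inhabits zero_real) P)).
  { apply epsilon_spec. eexists. exact HN. }
  replace (fun n => f (push n a)) with (epsilon (inhabits zero_real) P).
  - apply (hull_op op_value 0 (x := Name F) (y := Reals [a]) (z := Condition (gen N)));
      [apply HF|exact Ha|apply gen_hull].
  - apply functional_extensionality. intro n.
    apply (valid_gg (m := N) (n := N) (proj1 (proj2 HF)) (K n) (HN n)).
Qed.

(** * Closure properties of the computable functionals *)

Lemma computable_ext f g : (forall a, ground a -> f a = g a) ->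
  computable f -> computable g.
Proof.
  intros E [F [H [V D]]]. exists F. split; [|split]; auto.
  intros a Ha. rewrite <- E; auto.
Qed.

Lemma computable_const k : computable (fun _ => k).
Proof.
  exists (nconst k). split; [exact (hull_0 op_nconst k)|split].
  - split; unfold nconst; intros; congruence.
  - intros. exists 0. reflexivity.
Qed.

Lemma computable_eval f : computable f -> computable (fun a => a (f a)).
Proof.
  intros [F [H [V D]]]. exists (neval F). split; [exact (hull_1 op_neval 0 H)|split].
  - split.
    + intros p q a v S [x [Hx ->]]. exists x. split; auto. now apply (valid_mono V S).
    + intros p a v w Hp [x [Hx ->]] [y [Hy ->]].
      now rewrite (valid_fun V Hp Hx Hy).
  - intros a Ha. destruct (D a Ha) as [n Hn]. exists n. exists (f a). auto.
Qed.

Lemma computable_real h f : ground h -> computable f -> computable (fun a => h (f a)).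
Proof.
  intros Hh [F [H [V D]]]. exists (nreal h F).
  split; [exact (hull_2 op_nreal 0 Hh H)|split].
  - split.
    + intros p q a v S [x [Hx ->]]. exists x. split; auto. now apply (valid_mono V S).
    + intros p a v w Hp [x [Hx ->]] [y [Hy ->]].
      now rewrite (valid_fun V Hp Hx Hy).
  - intros a Ha. destruct (D a Ha) as [n Hn]. exists n. exists (f a). auto.
Qed.

Lemma computable_hop j f g : computable f -> computable g ->
  computable (fun a => hop j (f a) (g a)).
Proof.
  intros [F [H [V D]]] [G [H' [V' D']]]. exists (nhop j F G).
  split; [exact (hull_2 op_nhop j H H')|split].
  - split.
    + intros p q a v S [x [y [Hx [Hy ->]]]]. exists x, y.
      split; [now apply (valid_mono V S)|split; [now apply (valid_mono V' S)|easy]].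
    + intros p a v w Hp [x [y [Hx [Hy ->]]]] [x' [y' [Hx' [Hy' ->]]]].
      now rewrite (valid_fun V Hp Hx Hx'), (valid_fun V' Hp Hy Hy').
  - intros a Ha. destruct (D a Ha) as [n Hn], (D' a Ha) as [m Hm].
    exists (Nat.max n m), (f a), (g a).
    split; [apply (valid_up (m := n) V); auto; lia|].
    split; [apply (valid_up (m := m) V'); auto; lia|easy].
Qed.

Lemma computable_fixed j : computable (fixed j).
Proof.
  eexists. split; [exact (hull_0 op_nfix j)|split].
  - split; simpl; intros; congruence.
  - intros. exists 0. reflexivity.
Qed.

Lemma computable_comp f g : computable f -> computable g ->
  computable (fun a => f (fun n => g (push n a))).
Proof.
  intros [F [H [V D]]] [G HG]. pose proof HG as [H' [V' D']].
  exists (ncomp F G). split; [exact (hull_2 op_ncomp 0 H H')|split].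
  - split.
    + intros p q a v S [b [Hb Hv]]. exists b. split; [|now apply (valid_mono V S)].
      intro n. apply (valid_mono V' S), Hb.
    + intros p a v w Hp [b [Hb Hv]] [b' [Hb' Hw]].
      assert (b = b').
      { apply functional_extensionality. intro n.
        exact (valid_fun V' Hp (Hb n) (Hb' n)). }
      subst. exact (valid_fun V Hp Hv Hw).
  - intros a Ha. destruct (denotes_decided HG Ha) as [N HN].
    destruct (D (fun n => g (push n a))) as [m Hm].
    { apply ground_value; auto. now exists G. }
    exists (Nat.max N m). exists (fun n => g (push n a)). split.
    + intro n. apply (valid_up (m := N) V'); auto. lia.
    + apply (valid_up (m := m) V); auto. lia.
Qed.

Lemma computable_sub f x g : computable f -> computable x -> computable g ->
  computable (fun a => f (push (x a) (fun n => g (push n a)))).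
Proof.
  intros [F [H [V D]]] [X [HX [VX DX]]] [G HG].
  pose proof HG as [H' [V' D']].
  exists (nsub F X G). split; [exact (hull_op op_nsub 0 H HX H')|split].
  - split.
    + intros p q a v S [y [b [Hy [Hb Hv]]]]. exists y, b.
      split; [now apply (valid_mono VX S)|split; [|now apply (valid_mono V S)]].
      intro n. apply (valid_mono V' S), Hb.
    + intros p a v w Hp [y [b [Hy [Hb Hv]]]] [y' [b' [Hy' [Hb' Hw]]]].
      assert (b = b').
      { apply functional_extensionality. intro n.
        exact (valid_fun V' Hp (Hb n) (Hb' n)). }
      assert (y = y') by exact (valid_fun VX Hp Hy Hy').
      subst. exact (valid_fun V Hp Hv Hw).
  - intros a Ha. destruct (denotes_decided HG Ha) as [N HN].
    destruct (DX a Ha) as [k Hk].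
    destruct (D (push (x a) (fun n => g (push n a)))) as [m Hm].
    { apply ground_push, ground_value; auto. now exists G. }
    exists (N + m + k). exists (x a), (fun n => g (push n a)).
    split; [apply (valid_up (m := k) VX); auto; lia|split].
    + intro n. apply (valid_up (m := N) V'); auto. lia.
    + apply (valid_up (m := m) V); auto. lia.
Qed.

Lemma computable_mu f : computable f ->
  (forall a, ground a -> exists n, f (push n a) = 0) ->
  exists g, computable g /\ forall a, ground a -> f (push (g a) a) = 0.
Proof.
  intros [F HF] T. pose proof HF as [H [V D]].
  pose (least := fun a n => f (push n a) = 0 /\ forall m, m < n -> f (push m a) <> 0).
  assert (L : forall a, ground a -> exists n, least a n).
  { intros a Ha. destruct (T a Ha) as [n Hn]. revert Hn.
    induction n as [n IH] using (well_founded_induction lt_wf). intro Hn.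
    destruct (classic (exists m, m < n /\ f (push m a) = 0)) as [[m [Hm Km]]|N].
    - exact (IH m Hm Km).
    - exists n. split; auto. intros m Hm Km. apply N. eauto. }
  pose (g := fun a => epsilon (inhabits 0) (least a)).
  assert (Hg : forall a, ground a -> least a (g a)).
  { intros a Ha. apply epsilon_spec. auto. }
  exists g. split; [|intros; now apply Hg].
  exists (nmu F). split; [exact (hull_1 op_nmu 0 H)|split].
  - split.
    + intros p q a v S [K1 K2]. split; [now apply (valid_mono V S)|].
      intros m Hm. destruct (K2 m Hm) as [k Hk]. exists k.
      now apply (valid_mono V S).
    + intros p a v w Hp [K1 K2] [K1' K2'].
      destruct (lt_eq_lt_dec v w) as [[Hl| ->]|Hl]; auto; exfalso.
      * destruct (K2' v Hl) as [k Hk]. now pose proof (valid_fun V Hp K1 Hk).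
      * destruct (K2 w Hl) as [k Hk]. now pose proof (valid_fun V Hp K1' Hk).
  - intros a Ha. destruct (denotes_decided HF Ha) as [N HN]. exists N.
    destruct (Hg a Ha) as [K1 K2]. split.
    + rewrite <- K1. apply HN.
    + intros m Hm. exists (Nat.pred (f (push m a))).
      specialize (K2 m Hm). specialize (HN m).
      destruct (f (push m a)); [easy|exact HN].
Qed.

Lemma computable_rec f m x : computable f -> computable m -> computable x ->
  computable (fun a =>
    nat_rect (fun _ => nat) (m a) (fun k r => f (push k (push r a))) (x a)).
Proof.
  intros [F [H [V D]]] [M [HM [VM DM]]] [X [HX [VX DX]]].
  exists (nrec F M X). split; [exact (hull_op op_nrec 0 H HM HX)|split].
  - split.
    + intros p q a v S [y [s [Hy [H0 [HS ->]]]]]. exists y, s.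
      split; [now apply (valid_mono VX S)|split; [now apply (valid_mono VM S)|]].
      split; auto. intros k Hk. now apply (valid_mono V S), HS.
    + intros p a v w Hp [y [s [Hy [H0 [HS ->]]]]] [y' [s' [Hy' [H0' [HS' ->]]]]].
      assert (y = y') by exact (valid_fun VX Hp Hy Hy'). subst y'.
      assert (K : forall k, k <= y -> s k = s' k).
      { induction k as [|k IH]; intro L; [exact (valid_fun VM Hp H0 H0')|].
        assert (K1 := HS k L). assert (K2 := HS' k L).
        rewrite <- IH in K2 by lia. exact (valid_fun V Hp K1 K2). }
      apply K. lia.
  - intros a Ha. destruct (DM a Ha) as [i Hi], (DX a Ha) as [j Hj].
    pose (s := nat_rect (fun _ => nat) (m a) (fun k r => f (push k (push r a)))).
    assert (K : forall y, exists N, forall k, k < y ->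
      F (gg N) (push k (push (s k) a)) (s (S k))).
    { induction y as [|y [N IH]]; [exists 0; lia|].
      destruct (D (push y (push (s y) a))) as [l Hl]; [now repeat apply ground_push|].
      exists (Nat.max N l). intros k Hk.
      destruct (Nat.eq_dec k y) as [->|].
      - apply (valid_up (m := l) V); [lia|exact Hl].
      - apply (valid_up (m := N) V); [lia|apply IH; lia]. }
    destruct (K (x a)) as [N HN]. exists (N + i + j). exists (x a), s.
    split; [apply (valid_up (m := j) VX); auto; lia|].
    split; [apply (valid_up (m := i) VM); auto; lia|].
    split; auto. intros k Hk. apply (valid_up (m := N) V); [lia|auto].
Qed.

Lemma choice_dense_spec F : valid F -> forall q, good q ->
  exists r, good r /\ ext q r /\ choice_dense F r.
Proof.
  intros V q Hq.
  destruct (classic (exists r, good r /\ ext q r /\ exists n,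
    forall r', good r' -> ext r r' -> ~ exists f, F (gr r') (push n f) 0))
    as [[r [H [K L]]]|N].
  - exists r. split; [|split]; auto. now right.
  - destruct (@fusion (fun n g => exists f, F g (push n f) 0)) with (p := q)
      as [r [H [K L]]]; auto.
    + intros n g g' S [v Hv]. exists v. now apply (valid_mono V) with (p := g).
    + intros r Hr Er n. apply NNPP. intro N'. apply N.
      exists r. split; [|split]; auto. exists n. intros r' H K L. apply N'. eauto.
    + exists r. split; [|split]; auto. left.
      pose (c := fun n => epsilon (inhabits zero_real) (fun f => F (gr r) (push n f) 0)).
      exists (fun m => c (fst (Cantor.of_nat m)) (snd (Cantor.of_nat m))).
      intro n. unfold row, pr.
      replace (fun k => c (fst (Cantor.of_nat (Cantor.to_nat (n, k))))
        (snd (Cantor.of_nat (Cantor.to_nat (n, k))))) with (c n).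
      * exact (epsilon_spec (inhabits zero_real) _ (L n)).
      * apply functional_extensionality. intro k. now rewrite Cantor.cancel_of_to.
Qed.

(** The dense set ranges over arbitrary reals, but the choice made for a condition of the hull is
    ground. Its rows then have values of [f], which must agree with the decided value 0. *)
Lemma computable_choice f : computable f ->
  (forall n, exists a, ground a /\ f (push n a) = 0) ->
  exists d, ground d /\ forall n, f (push n (row d n)) = 0.
Proof.
  intros [F [H [V D]]] T.
  destruct (@gen_meets (choice_dense F)) as [N [K|[n K]]].
  - exact (hull_1 op_dense_choice 0 H).
  - now apply choice_dense_spec.
  - pose (P := fun d : real => forall n, F (gr (gen N)) (push n (row d n)) 0).
    assert (HP : P (epsilon (inhabits zero_real) P)) by now apply epsilon_spec.
    exists (epsilon (inhabits zero_real) P).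
    assert (G : ground (epsilon (inhabits zero_real) P)).
    { exact (hull_2 op_choice 0 H (gen_hull N)). }
    split; auto. intro n.
    destruct (D (push n (row (epsilon (inhabits zero_real) P) n))) as [m Hm].
    { now apply ground_push, ground_row. }
    exact (valid_gg (m := m) (n := N) V Hm (HP n)).
  - exfalso. destruct (T n) as [a [Ha Fa]].
    destruct (D (push n a)) as [m Hm]; [now apply ground_push|]. rewrite Fa in Hm.
    apply (K (gen (Nat.max N m))); [apply gen_good|apply gen_ext; lia|].
    exists a. apply (valid_up (m := m) V); auto. lia.
Qed.

Lemma generic_injection : exists Y, computable Y /\
  forall a b, ground a -> ground b -> Y a = Y b -> a = b.
Proof.
  assert (T : forall a, ground a -> exists m n, gg n a m).
  { intros a Ha. destruct (@gen_meets (fun q => exists m, gr q a m)) as [n [m H]].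
    - exact (hull_1 op_dense_generic 0 Ha).
    - intros q Hq. destruct (classic (exists m, gr q a m)) as [K|K].
      + exists q. auto using ext_refl.
      + destruct (good_free Hq 0) as [m [_ Hm]].
        (* A value that is not forbidden is also outside the range of [q], so injectivity
           survives. *)
        exists (Cond (fun b k => gr q b k \/ b = a /\ k = m)
                     (fun k => fb q k \/ k = m)).
        split; [|split; [|exists m; simpl; auto]].
        * destruct Hq as [G1 G2 G3 G4]. split; simpl.
          -- intros b k k' [H1|[-> ->]] [H2|[H2 ->]]; subst; eauto;
               try (exfalso; eauto; fail).
          -- intros b b' k [H1|[-> ->]] [H2|[-> H2]]; subst; eauto;
               exfalso; eauto.
          -- intros b k [H1|[_ ->]]; eauto.
          -- intro N. destruct (G4 (Nat.max N (S m))) as [k [L Hk]].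
             exists k. split; [lia|]. intros [H| ->]; [auto|lia].
        * split; simpl; [intros b k; auto|auto|].
          intros b k [H|[-> ->]]; auto.
    - exists m, n. exact H. }
  pose (Y := fun a => epsilon (inhabits 0) (fun m => exists n, gg n a m)).
  assert (HY : forall a, ground a -> exists n, gg n a (Y a)).
  { intros a Ha. exact (epsilon_spec (inhabits 0) (fun m => exists n, gg n a m) (T a Ha)). }
  exists Y. split.
  - eexists. split; [exact (hull_0 op_ngeneric 0)|split; [|exact HY]].
    split; auto. intros p a v w Hp. apply Hp.
  - intros a b Ha Hb E. destruct (HY a Ha) as [n Hn], (HY b Hb) as [m Hm].
    rewrite E in Hn. apply (good_inj (gen_good (Nat.max n m))) with (m := Y b).
    + apply (gg_mono (m := n)); [lia|exact Hn].
    + apply (gg_mono (m := m)); [lia|exact Hm].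
Qed.

End Generic.

(** * The full type structure *)

Fixpoint carrier (s : ty) : Type :=
  match s with ty0 => nat | Arr a b => carrier a -> carrier b end.

(* The recursors of higher type have no axioms, so any value will do. *)
Definition recursor (s : ty) :
    (nat -> carrier s -> carrier s) -> carrier s -> nat -> carrier s :=
  match s with
  | ty0 => fun f m n => nat_rect (fun _ => nat) m f n
  | Arr _ _ => fun _ m _ => m
  end.

Definition cinterp (s : ty) (c : cst s) : carrier s :=
  match c with
  | c0 => 0
  | c1 => 1
  | cadd => Nat.add
  | cmul => Nat.mul
  | cPi s t => fun (x : carrier s) (_ : carrier t) => x
  | cSigma r s t => fun (f : carrier (r ⇒ s ⇒ t)) (g : carrier (r ⇒ s)) x => f x (g x)
  | cR s => recursor (s := s)
  end.

(** The objects of the forcing model will be certain objects of this one, with the same application;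
    terms therefore have the same values in both. *)
Definition full : model :=
  Model (dom := carrier) (fun _ _ f x => f x) cinterp (@eq nat) lt.

Lemma full_beta G a s (t : tm (a :: G) s) (e : env full G) (x : carrier a) :
  (teval e (lam t) : carrier (a ⇒ s)) x = teval (econs (M := full) x e) t.
Proof.
  induction t as [s y|s c|s s' t IHt u IHu].
  - revert s y. vinv; reflexivity.
  - reflexivity.
  - simpl in *. rewrite IHt, IHu. reflexivity.
Qed.

Lemma full_lam2 G a b s (t : tm (b :: a :: G) s) (e : env full G) :
  (teval e (lam (lam t)) : carrier (a ⇒ b ⇒ s)) =
  fun x y => teval (econs (M := full) y (econs (M := full) x e)) t.
Proof.
  apply functional_extensionality. intro x. apply functional_extensionality. intro y.
  rewrite full_beta. apply full_beta.
Qed.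

Lemma full_tri G (e : env full G) (t : tm G ty0) :
  teval e (tri t) = nat_rect (fun _ => nat) 0 (fun i r => r + (i + 1)) (teval e t).
Proof.
  unfold tri. cbn [teval app full ci cinterp recursor]. rewrite full_lam2. reflexivity.
Qed.

Lemma to_nat_tri x y : pr x y =
  nat_rect (fun _ => nat) 0 (fun i r => r + (i + 1)) (x + y) + y.
Proof.
  unfold pr, Cantor.to_nat. rewrite (Nat.add_comm y x), Nat.add_comm. f_equal.
  induction (x + y); simpl in *; lia.
Qed.

Lemma full_pair G (e : env full G) (t u : tm G ty0) :
  teval e (cpair t u) = pr (teval e t) (teval e u).
Proof.
  rewrite to_nat_tri. unfold cpair, add. cbn [teval app full ci cinterp].
  rewrite full_tri. reflexivity.
Qed.

Lemma rec_double n : nat_rect (fun _ => nat) 1 (fun _ r => r + r) n = 2 ^ n.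
Proof. induction n as [|n IH]; simpl; [|rewrite IH]; lia. Qed.

Lemma full_pow2 G (e : env full G) (t : tm G ty0) :
  teval e (pow2 t) = 2 ^ (teval e t : nat).
Proof.
  unfold pow2. cbn [teval app full ci cinterp recursor]. rewrite full_lam2.
  exact (rec_double (teval e t)).
Qed.

Definition initv (g : nat -> nat) (n : nat) : nat :=
  nat_rect (fun _ => nat) 0 (fun i r => pr r (g i) + 1) n.

Lemma full_initseg G (e : env full G) (g : tm G ty1) (n : tm G ty0) :
  teval e (initseg g n) = initv (teval e g) (teval e n).
Proof.
  unfold initseg. cbn [teval app full ci cinterp recursor]. rewrite full_lam2.
  unfold initv. f_equal. fext; fext. unfold add.
  cbn [teval app full ci cinterp]. rewrite full_pair. cbn [teval app full].
  rewrite !teval_wk. reflexivity.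
Qed.

Fixpoint initvs (gs : list (nat -> nat)) (n : nat) : nat :=
  match gs with
  | [] => 0
  | [g] => initv g n
  | g :: gs' => pr (initv g n) (initvs gs' n)
  end.

Lemma full_initseg_tuple G (e : env full G) (gs : list (tm G ty1)) (n : tm G ty0) :
  teval e (initseg_tuple gs n) = initvs (map (fun g : tm G ty1 => (teval e g : carrier ty1)) gs) (teval e n).
Proof.
  induction gs as [|g [|g' gs] IH]; [reflexivity|apply full_initseg|].
  change (initseg_tuple (g :: g' :: gs) n)
    with (cpair (initseg g n) (initseg_tuple (g' :: gs) n)).
  rewrite full_pair, full_initseg, IH. reflexivity.
Qed.

Definition ratv (a b d : nat) : nat := pr a (pr b d).

Definition cmpv (rel : nat -> nat -> Prop) (p q c n : nat) : Prop :=
  forall a b d a' b' d', p = ratv a b d -> q = ratv a' b' d' ->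
  rel (2 ^ n * (a * (d' + 1) + b' * (d + 1)))
      (2 ^ n * (a' * (d + 1) + b * (d' + 1)) + c * ((d + 1) * (d' + 1))).

Definition leqv (x y : nat) : Prop := x < y \/ x = y.

Lemma full_cmp (r : forall G, tm G ty0 -> tm G ty0 -> fm G) (rv : nat -> nat -> Prop)
    G (e : env full G) (p q c n : tm G ty0) :
  (forall G (e : env full G) t u, sat (r G t u) e <-> rv (teval e t) (teval e u)) ->
  sat (rat_cmp r p q c n) e <-> cmpv rv (teval e p) (teval e q) (teval e c) (teval e n).
Proof.
  intro Hr. unfold rat_cmp. cbn [sat].
  assert (H : forall a b d a' b' d' : nat, forall s (t : tm G s),
    teval (econs (M := full) (a := ty0) d' (econs (M := full) (a := ty0) b'
      (econs (M := full) (a := ty0) a' (econs (M := full) (a := ty0) d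
      (econs (M := full) (a := ty0) b (econs (M := full) (a := ty0) a e))))))
      (twk (twk (twk (twk (twk (twk t)))))) = teval e t).
  { intros. now rewrite !teval_wk. }
  unfold cmpv, ratv, rat.
  split; intros K a b d a' b' d'; specialize (K a b d a' b' d');
    rewrite Hr in *; unfold add, mul in *; cbn [teval app full ci cinterp] in *;
    rewrite ?full_pow2, ?full_pair, ?H in *; exact K.
Qed.

Lemma full_flt G (e : env full G) t u : sat (flt t u) e <-> teval e t < teval e u.
Proof. reflexivity. Qed.
Lemma full_fle G (e : env full G) t u : sat (fle t u) e <-> leqv (teval e t) (teval e u).
Proof. reflexivity. Qed.

Definition is_realv (x : nat -> nat) : Prop :=
  sat (M := full) (is_real v0) (econs (M := full) (a := ty1) x enil).

Definition real_eqv (x y : nat -> nat) : Prop :=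
  sat (M := full) (real_eq v1 v0)
    (econs (M := full) (a := ty1) y (econs (M := full) (a := ty1) x enil)).

Lemma is_realv_cmp x : is_realv x <-> forall n i,
  cmpv lt (x n) (x (n + i)) 1 n /\ cmpv lt (x (n + i)) (x n) 1 n.
Proof.
  unfold is_realv, is_real. cbn [sat].
  split; intros H n i; specialize (H n i);
    rewrite !(full_cmp (rv := lt)) in * by apply full_flt; exact H.
Qed.

Lemma real_eqv_cmp x y : real_eqv x y <-> forall n,
  cmpv leqv (x n) (y n) 2 n /\ cmpv leqv (y n) (x n) 2 n.
Proof.
  unfold real_eqv, real_eq. cbn [sat].
  split; intros H n; specialize (H n);
    rewrite !(full_cmp (rv := leqv)) in * by apply full_fle; exact H.
Qed.

(** * Equality of coded reals, compared with the real line *)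

Section RealEquality.

Local Open Scope R_scope.

Definition ratR (p : nat) : R :=
  let (a, q) := Cantor.of_nat p in let (b, d) := Cantor.of_nat q in
  (INR a - INR b) / INR (d + 1).

Lemma ratR_ratv a b d : ratR (ratv a b d) = (INR a - INR b) / INR (d + 1).
Proof. unfold ratR, ratv, pr. now rewrite !Cantor.cancel_of_to. Qed.

Lemma ratv_surj p : exists a b d, p = ratv a b d.
Proof.
  unfold ratv, pr. destruct (Cantor.of_nat p) as [a q] eqn:E.
  destruct (Cantor.of_nat q) as [b d] eqn:E'. exists a, b, d.
  now rewrite <- E', Cantor.cancel_to_of, <- E, Cantor.cancel_to_of.
Qed.

Lemma cross_multiply X X' D D' P n c t : 0 < D -> 0 < D' -> 0 < P ->
  X * D = n -> X' * D' = c ->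
  (P * (c * D) + t * (D * D')) - P * (n * D') = P * D * D' * (X' + t / P - X).
Proof. intros HD HD' HP <- <-. field. lra. Qed.

Lemma sign_mult k x : 0 < k -> (0 <= k * x <-> 0 <= x) /\ (0 < k * x <-> 0 < x).
Proof. intro Hk. split; split; intro; nra. Qed.

Lemma cmpv_R p q c n :
  (cmpv lt p q c n <-> ratR p < ratR q + INR c / 2 ^ n) /\
  (cmpv leqv p q c n <-> ratR p <= ratR q + INR c / 2 ^ n).
Proof.
  destruct (ratv_surj p) as [a [b [d ->]]], (ratv_surj q) as [a' [b' [d' ->]]].
  assert (HD : 0 < INR (d + 1)) by (apply lt_0_INR; lia).
  assert (HD' : 0 < INR (d' + 1)) by (apply lt_0_INR; lia).
  assert (HP : 0 < 2 ^ n) by (apply pow_lt; lra).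
  assert (E := @cross_multiply (ratR (ratv a b d)) (ratR (ratv a' b' d'))
    (INR (d + 1)) (INR (d' + 1)) (2 ^ n) (INR a - INR b) (INR a' - INR b') (INR c)
    HD HD' HP).
  rewrite !ratR_ratv in *.
  specialize (E ltac:(field; lra) ltac:(field; lra)).
  set (L := (2 ^ n * (a * (d' + 1) + b' * (d + 1)))%nat).
  set (U := (2 ^ n * (a' * (d + 1) + b * (d' + 1)) + c * ((d + 1) * (d' + 1)))%nat).
  (* [U] and [L] arise from the inequality of rationals by clearing positive denominators, so their
     difference has the same sign. *)
  assert (EL : INR U - INR L = 2 ^ n * INR (d + 1) * INR (d' + 1) *
    ((INR a' - INR b') / INR (d' + 1) + INR c / 2 ^ n - (INR a - INR b) / INR (d + 1))).
  { rewrite <- E. unfold U, L.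
    rewrite !plus_INR, !mult_INR, pow_INR, !plus_INR, !mult_INR, !plus_INR.
    change (INR 2) with (1 + 1). replace (1 + 1) with 2 by lra. simpl (INR 1). ring. }
  assert (HK : 0 < 2 ^ n * INR (d + 1) * INR (d' + 1))
    by (repeat apply Rmult_lt_0_compat; auto).
  destruct (sign_mult ((INR a' - INR b') / INR (d' + 1) + INR c / 2 ^ n
    - (INR a - INR b) / INR (d + 1)) HK) as [S1 S2].
  rewrite <- EL in S1, S2.
  assert (C : forall rel, cmpv rel (ratv a b d) (ratv a' b' d') c n <-> rel L U).
  { intro rel. split; [intro H; now apply H|].
    intros H x y z x' y' z' Ep Eq. unfold ratv in Ep, Eq.
    apply pr_inj in Ep as [<- Ep]. apply pr_inj in Ep as [<- <-].
    apply pr_inj in Eq as [<- Eq]. apply pr_inj in Eq as [<- <-]. exact H. }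
  rewrite !C. split.
  - split; intro H.
    + apply lt_INR in H. lra.
    + apply INR_lt. lra.
  - unfold leqv. split; intro H.
    + assert (H' : (L <= U)%nat) by lia. apply le_INR in H'. lra.
    + assert (H' : (L <= U)%nat) by (apply INR_le; lra). lia.
Qed.

Lemma Rabs_le_inv x y : Rabs x <= y -> - y <= x <= y.
Proof. unfold Rabs. destruct (Rcase_abs x); lra. Qed.

Lemma is_realv_R x : is_realv x <-> forall n i,
  Rabs (ratR (x n) - ratR (x (n + i)%nat)) < 1 / 2 ^ n.
Proof.
  rewrite is_realv_cmp. split; intros H n i; specialize (H n i).
  - rewrite !(proj1 (cmpv_R _ _ _ _)) in H. simpl in H. apply Rabs_def1; lra.
  - apply Rabs_def2 in H. rewrite !(proj1 (cmpv_R _ _ _ _)). simpl. lra.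
Qed.

Lemma real_eqv_R x y : real_eqv x y <-> forall n,
  Rabs (ratR (x n) - ratR (y n)) <= 2 / 2 ^ n.
Proof.
  rewrite real_eqv_cmp. split; intros H n; specialize (H n).
  - rewrite !(proj2 (cmpv_R _ _ _ _)) in H. simpl in H. apply Rabs_le. lra.
  - apply Rabs_le_inv in H. rewrite !(proj2 (cmpv_R _ _ _ _)); simpl; lra.
Qed.

Lemma real_eqv_sym x y : real_eqv x y -> real_eqv y x.
Proof. rewrite !real_eqv_R. intros H n. rewrite Rabs_minus_sym. apply H. Qed.

Lemma real_eqv_refl x : real_eqv x x.
Proof.
  rewrite real_eqv_R. intro n. rewrite Rminus_diag, Rabs_R0.
  apply Rlt_le, Rdiv_lt_0_compat; [lra|apply pow_lt; lra].
Qed.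

Lemma real_eqv_trans x y z : is_realv x -> is_realv z ->
  real_eqv x y -> real_eqv y z -> real_eqv x z.
Proof.
  rewrite !is_realv_R, !real_eqv_R. intros Hx Hz Hxy Hyz n.
  apply le_epsilon. intros eps He.
  (* Going through index n + N costs 1/2^n at each end and 2/2^(n + N) for each of the two
     equalities. The former is the allowed tolerance, the latter stays below eps. *)
  destruct (@pow_lt_1_zero (1 / 2) ltac:(rewrite Rabs_pos_eq; lra) (eps / 4)
    ltac:(lra)) as [N HN].
  specialize (HN (n + N)%nat ltac:(lia)).
  assert (E : (1 / 2) ^ (n + N) = 1 / 2 ^ (n + N)).
  { unfold Rdiv. now rewrite Rpow_mult_distr, pow1, pow_inv. }
  rewrite E, Rabs_pos_eq in HN
    by (apply Rlt_le, Rdiv_lt_0_compat; [lra|apply pow_lt; lra]).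
  specialize (Hx n N). specialize (Hz n N).
  specialize (Hxy (n + N)%nat). specialize (Hyz (n + N)%nat).
  assert (2 / 2 ^ n = 1 / 2 ^ n + 1 / 2 ^ n) by lra.
  assert (2 / 2 ^ (n + N) = 1 / 2 ^ (n + N) + 1 / 2 ^ (n + N)) by lra.
  replace (ratR (x n) - ratR (z n)) with
    ((ratR (x n) - ratR (x (n + N)%nat)) + (ratR (x (n + N)%nat) - ratR (y (n + N)%nat))
     + (ratR (y (n + N)%nat) - ratR (z (n + N)%nat)) - (ratR (z n) - ratR (z (n + N)%nat)))
    by ring.
  apply Rabs_def2 in Hx, Hz. apply Rabs_le_inv in Hxy, Hyz. apply Rabs_le. lra.
Qed.

(** A real and any equal real define the same predicate, so choice returns the same
    representative. *)
Definition canon (x : nat -> nat) : nat -> nat :=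
  epsilon (inhabits x) (fun z => is_realv z /\ real_eqv x z).

Lemma canon_eq x y : is_realv x -> is_realv y -> (canon x = canon y <-> real_eqv x y).
Proof.
  intros Hx Hy.
  assert (S : forall x, is_realv x -> is_realv (canon x) /\ real_eqv x (canon x)).
  { intros u Hu. apply (epsilon_spec (inhabits u) (fun z => is_realv z /\ real_eqv u z)).
    exists u. auto using real_eqv_refl. }
  split; intro E.
  - destruct (S x Hx) as [K1 K2], (S y Hy) as [K3 K4]. rewrite <- E in K4.
    apply (real_eqv_trans Hx Hy K2), real_eqv_sym, K4.
  - unfold canon. rewrite (epsilon_inh_irrelevance (inhabits x) (inhabits y)).
    + f_equal. apply functional_extensionality. intro z. apply propositional_extensionality.
      split; intros [Hz K]; split; auto.
      * apply (real_eqv_trans Hy Hz (real_eqv_sym E) K).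
      * apply (real_eqv_trans Hx Hz E K).
    + exists x. auto using real_eqv_refl.
Qed.

End RealEquality.

(** * The forcing model *)

Section TypeStructure.

Variable skolem : nat -> list real -> real.
Variable fixed : nat -> real -> nat.

Local Notation ground := (ground skolem fixed).
Local Notation computable := (computable skolem fixed).

(* A map of reals is computed in uncurried form, its number argument being the first
   entry of [b]. *)
Definition reparam (c : real -> real) : Prop := computable (fun b => c (pop b) (b 0)).

Lemma computable_at k : computable (fun b => b k).
Proof. exact (computable_eval (computable_const skolem fixed k)). Qed.

Lemma computable_reparam f c : computable f -> reparam c -> computable (fun a => f (c a)).
Proof. intros Hf Hc. exact (computable_comp Hf Hc). Qed.

Lemma computable_push f x c : computable f -> computable x -> reparam c ->
  computable (fun a => f (push (x a) (c a))).
Proof. intros Hf Hx Hc. exact (computable_sub Hf Hx Hc). Qed.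

Lemma ground_reparam c a : reparam c -> ground a -> ground (c a).
Proof. intros Hc Ha. exact (ground_value Hc Ha). Qed.

(** In uncurried form, entry [b 0] of [pop b] is entry [b 0 + 1] of [b]. *)
Lemma reparam_id : reparam (fun a => a).
Proof.
  apply (computable_ext (f := fun b => b (b 0 + 1))).
  - intros b _. unfold pop. now rewrite Nat.add_comm.
  - exact (computable_eval (computable_hop 0 (computable_at 0)
      (computable_const skolem fixed 1))).
Qed.

Lemma reparam_pop : reparam pop.
Proof.
  apply (computable_ext (f := fun b => b (b 0 + 2))).
  - intros b _. unfold pop. now rewrite Nat.add_comm.
  - exact (computable_eval (computable_hop 0 (computable_at 0)
      (computable_const skolem fixed 2))).
Qed.

Lemma reparam_pop2 : reparam (fun a => pop (pop a)).
Proof.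
  apply (computable_ext (f := fun b => b (b 0 + 3))).
  - intros b _. unfold pop. now rewrite Nat.add_comm.
  - exact (computable_eval (computable_hop 0 (computable_at 0)
      (computable_const skolem fixed 3))).
Qed.

Lemma reparam_const f : ground f -> reparam (fun _ => f).
Proof. intro H. exact (computable_real H (computable_at 0)). Qed.

Lemma reparam_comp c c' : reparam c -> reparam c' -> reparam (fun a => c (c' a)).
Proof.
  intros Hc Hc'.
  assert (K : reparam (fun b => c' (pop b))).
  { exact (computable_push Hc' (computable_at 0) reparam_pop2). }
  exact (computable_push Hc (computable_at 0) K).
Qed.

(* Equality of families of type s objects indexed by the ground reals.  The model
   consists of the objects whose constant family is related to itself. *)
Fixpoint rel (s : ty) : (real -> carrier s) -> (real -> carrier s) -> Prop :=
  match s with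
  | ty0 => fun x y => computable x /\ forall a, ground a -> x a = y a
  | Arr s t => fun f g => forall c, reparam c -> forall x y, @rel s x y ->
      @rel t (fun a => f (c a) (x a)) (fun a => g (c a) (y a))
  end.
Arguments rel : clear implicits.

(** The Kripke-style quantification over [c] in the arrow case of [rel] is there to secure this
    stability. *)
Lemma rel_reparam s : forall x y c, reparam c -> rel s x y ->
  rel s (fun a => x (c a)) (fun a => y (c a)).
Proof.
  induction s as [|s _ t IH]; simpl; intros x y c Hc H.
  - destruct H as [H1 H2]. split; [exact (computable_reparam H1 Hc)|].
    intros a Ha. apply H2. now apply ground_reparam.
  - intros c' Hc' u v Huv.
    exact (H (fun a => c (c' a)) (reparam_comp Hc Hc') u v Huv).
Qed.

Lemma rel_sym s : forall x y, rel s x y -> rel s y x.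
Proof.
  induction s as [|s IHs t IHt]; simpl; intros x y H.
  - destruct H as [H1 H2]. split; [exact (computable_ext H2 H1)|].
    intros a Ha. now rewrite H2.
  - intros c Hc u v Huv. apply IHt, H; auto.
Qed.

Lemma rel_trans s : forall x y z, rel s x y -> rel s y z -> rel s x z.
Proof.
  induction s as [|s IHs t IHt]; simpl; intros x y z H K.
  - destruct H as [H1 H2], K as [_ K2]. split; auto.
    intros a Ha. now rewrite H2, K2.
  - intros c Hc u v Huv. apply (IHt _ (fun a => y (c a) (v a))); [now apply H|].
    apply K; auto. apply (IHs _ u); auto. now apply rel_sym.
Qed.

(** Computability is already contained in the two self-relations, so agreement can be checked at one
    ground index at a time. Extensionality of the model rests on this. *)
Lemma rel_pointwise s : forall u v, rel s u u -> rel s v v ->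
  (forall a, ground a -> rel s (fun _ => u a) (fun _ => v a)) -> rel s u v.
Proof.
  induction s as [|s IHs t IHt]; simpl; intros u v Hu Hv H.
  - split; [apply Hu|]. intros a Ha. exact (proj2 (H a Ha) a Ha).
  - intros c Hc x y Hxy. apply IHt.
    + apply Hu; auto. apply rel_trans with y; auto. now apply rel_sym.
    + apply Hv; auto. apply rel_trans with x; auto. now apply rel_sym.
    + intros a Ha.
      apply (H (c a) (ground_reparam Hc Ha) (fun b => b) reparam_id
        (fun _ => x a) (fun _ => y a)).
      exact (rel_reparam (reparam_const Ha) Hxy).
Qed.

Lemma rel_hop j x y x' y' : rel ty0 x x' -> rel ty0 y y' ->
  rel ty0 (fun a => hop j (x a) (y a)) (fun a => hop j (x' a) (y' a)).
Proof.
  intros [H1 H2] [K1 K2]. split; [now apply computable_hop|].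
  intros a Ha. now rewrite H2, K2.
Qed.

Lemma rel_const n : rel ty0 (fun _ => n) (fun _ => n).
Proof. split; [apply computable_const|auto]. Qed.

Lemma rel_recursor s : rel ((ty0 ⇒ s ⇒ s) ⇒ s ⇒ ty0 ⇒ s)
  (fun _ => recursor (s := s)) (fun _ => recursor (s := s)).
Proof.
  destruct s as [|s t].
  - simpl. intros c Hc f g Hf c' Hc' m m' [Hm Em] c'' Hc'' x x' [Hx Ex].
    set (d := fun a => c' (c'' a)).
    assert (Hd : reparam d) by exact (reparam_comp Hc' Hc'').
    assert (E : forall a, ground a -> forall k r, f a k r = g a k r).
    { intros a Ha k r. destruct (Hf _ reparam_id _ _ (rel_const k) _ reparam_id
        _ _ (rel_const r)) as [_ K]. exact (K a Ha). }
    split.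
    (* The step is made a functional of one real that carries the counter in entry 0, the previous
       value in entry 1, and the index behind them, as [computable_rec] expects. *)
    + destruct (Hf _ (reparam_comp Hd reparam_pop2)
        _ _ (conj (computable_at 0) (fun _ _ => eq_refl))
        _ reparam_id _ _ (conj (computable_at 1) (fun _ _ => eq_refl))) as [K _].
      exact (computable_rec (m := fun a => m (c'' a)) K (computable_reparam Hm Hc'') Hx).
    + intros a Ha. rewrite (Ex a Ha), (Em (c'' a) (ground_reparam Hc'' Ha)).
      change (f (c' (c'' a))) with (f (d a)). change (g (c' (c'' a))) with (g (d a)).
      induction (x' a) as [|k IH]; [reflexivity|]. simpl in *. rewrite IH.
      apply E. now apply ground_reparam.
  - intros c Hc f g Hf c' Hc' m m' Hm c'' Hc'' x x' Hx.
    exact (rel_reparam Hc'' Hm).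
Qed.

Lemma rel_cinterp s (c : cst s) : rel s (fun _ => cinterp c) (fun _ => cinterp c).
Proof.
  destruct c.
  - apply rel_const.
  - apply rel_const.
  - intros c Hc x x' Hx c' Hc' y y' Hy. exact (rel_hop 0 (rel_reparam Hc' Hx) Hy).
  - intros c Hc x x' Hx c' Hc' y y' Hy. exact (rel_hop 1 (rel_reparam Hc' Hx) Hy).
  - intros c Hc x x' Hx c' Hc' y y' Hy. exact (rel_reparam Hc' Hx).
  - intros c Hc f f' Hf c' Hc' g g' Hg c'' Hc'' x x' Hx.
    exact (Hf _ (reparam_comp Hc' Hc'') _ _ Hx _ reparam_id _ _ (Hg _ Hc'' _ _ Hx)).
  - apply rel_recursor.
Qed.

Definition fdom (s : ty) : Type := {x : carrier s | rel s (fun _ => x) (fun _ => x)}.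
Definition val s (x : fdom s) : carrier s := proj1_sig x.

Lemma rel_app s t (f : fdom (s ⇒ t)) (x : fdom s) :
  rel t (fun _ => val f (val x)) (fun _ => val f (val x)).
Proof. exact (proj2_sig f _ reparam_id _ _ (proj2_sig x)). Qed.

Definition forcing_model : model :=
  Model (dom := fdom)
    (fun s t f x => exist _ (val f (val x)) (rel_app f x))
    (fun s c => exist _ (cinterp c) (rel_cinterp c))
    (fun x y => val (s := ty0) x = val y)
    (fun x y => (val (s := ty0) x < val y)%nat).

Lemma val_inj s (x y : fdom s) : val x = val y -> x = y.
Proof. destruct x, y; simpl. apply subset_eq_compat. Qed.

Lemma forcing_eq_ok : eq_ok forcing_model.
Proof.
  split; [reflexivity|]. intros G A e x y H. apply (@val_inj ty0) in H. now subst.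
Qed.

Definition venv G (e : env forcing_model G) : env full G :=
  fun s x => val (s := s) (e s x).

Lemma venv_econs G s (x : fdom s) (e : env forcing_model G) :
  venv (econs (M := forcing_model) x e) = econs (M := full) (val x) (venv e).
Proof. varext; reflexivity. Qed.

Lemma val_teval G (e : env forcing_model G) s (t : tm G s) :
  val (teval e t : fdom s) = teval (venv e) t.
Proof. induction t; simpl in *; try reflexivity. now rewrite IHt1, IHt2. Qed.

Definition nat_dom (n : nat) : fdom ty0 := exist _ n (rel_const n).

(** These formulas are absolute between the forcing model and [full], both having all numbers.
    Quantifier-free formulas and the relations between reals are among them. *)
Fixpoint arithmetical (G : ctx) (A : fm G) : Prop :=
  match A with
  | feq _ _ | flt _ _ | fbot => True
  | fimp A B | fand A B | for_ A B => arithmetical A /\ arithmetical B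
  | fall a A | fex a A => a = ty0 /\ arithmetical A
  end.

Lemma qf_arithmetical G (A : fm G) : qf A -> arithmetical A.
Proof. induction A; simpl; tauto. Qed.

Lemma sat_full G (A : fm G) : arithmetical A ->
  forall e : env forcing_model G, sat A e <-> sat A (venv e).
Proof.
  induction A; simpl; intros HA e.
  - rewrite !val_teval. tauto.
  - rewrite !val_teval. tauto.
  - tauto.
  - now rewrite IHA1, IHA2.
  - now rewrite IHA1, IHA2.
  - now rewrite IHA1, IHA2.
  - destruct HA as [-> HA]. split; intros H x.
    + specialize (H (nat_dom x)). rewrite IHA, venv_econs in H; auto.
    + rewrite IHA, venv_econs; auto.
  - destruct HA as [-> HA]. split; intros [x H].
    + exists (val x). rewrite IHA, venv_econs in H; auto.
    + exists (nat_dom x). rewrite IHA, venv_econs; auto.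
Qed.

(** The fundamental lemma of the logical relation: terms send computable families of environments to
    computable families of values. *)
Lemma rel_teval G (e : forall a, env full G)
    (He : forall s (x : var G s), rel s (fun a => e a s x) (fun a => e a s x))
    s (t : tm G s) :
  rel s (fun a => teval (e a) t) (fun a => teval (e a) t).
Proof.
  induction t; simpl.
  - apply He.
  - apply rel_cinterp.
  - exact (IHt1 _ reparam_id _ _ IHt2).
Qed.

Lemma bit_ext (P Q : Prop) : (P <-> Q) -> bit P = bit Q.
Proof. intro H. f_equal. now apply propositional_extensionality. Qed.

Lemma computable_qf G (A : fm G) (HA : qf A) (e : real -> env full G)
    (He : forall s (x : var G s), rel s (fun a => e a s x) (fun a => e a s x)) :
  computable (fun a => bit (sat A (e a))).
Proof.
  induction A; simpl in *; try easy.
  - exact (computable_hop 3 (proj1 (rel_teval He t)) (proj1 (rel_teval He t0))).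
  - exact (computable_hop 4 (proj1 (rel_teval He t)) (proj1 (rel_teval He t0))).
  - apply (computable_ext (f := fun _ => 1)); [|apply computable_const].
    intros _ _. unfold bit. now destruct (excluded_middle_informative False).
  - eapply computable_ext; [|exact (computable_hop 5
      (IHA1 (proj1 HA) e He) (IHA2 (proj2 HA) e He))].
    intros a _. apply bit_ext. now rewrite !bit_0.
  - eapply computable_ext; [|exact (computable_hop 6
      (IHA1 (proj1 HA) e He) (IHA2 (proj2 HA) e He))].
    intros a _. apply bit_ext. now rewrite !bit_0.
  - eapply computable_ext; [|exact (computable_hop 7
      (IHA1 (proj1 HA) e He) (IHA2 (proj2 HA) e He))].
    intros a _. apply bit_ext. now rewrite !bit_0.
Qed.

(** Applied to constant families, this makes the type 1 objects of the model exactly the ground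
    reals. *)
Lemma rel_ty1 f g : rel ty1 f g <-> reparam f /\ forall a, ground a -> f a = g a.
Proof.
  split.
  - intro H. split.
    + apply (H pop reparam_pop _ _ (conj (computable_at 0) (fun _ _ => eq_refl))).
    + intros a Ha. apply functional_extensionality. intro n.
      exact (proj2 (H _ reparam_id _ _ (rel_const n)) a Ha).
  - intros [Hf E] c Hc x y [Hx Exy]. split.
    + exact (computable_push Hf Hx Hc).
    + intros a Ha. rewrite (E (c a)) by now apply ground_reparam.
      now rewrite Exy.
Qed.

Lemma real_dom_ground (f : fdom ty1) : ground (val f).
Proof.
  exact (ground_reparam (proj1 (proj1 (rel_ty1 _ _) (proj2_sig f))) (ground_const skolem fixed 0)).
Qed.

Lemma rel_ground f : ground f -> rel ty1 (fun _ => f) (fun _ => f).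
Proof. intro H. apply rel_ty1. split; auto. now apply reparam_const. Qed.

Definition real_dom f (H : ground f) : fdom ty1 := exist _ f (rel_ground H).

Lemma rel_computable F : computable F -> rel ty2 (fun _ => F) (fun _ => F).
Proof.
  intros H c Hc f g Hfg. apply (proj1 (rel_ty1 _ _)) in Hfg as [K E]. split.
  - exact (computable_reparam H K).
  - intros a Ha. now rewrite E.
Qed.

Definition functional_dom F (H : computable F) : fdom ty2 := exist _ F (rel_computable H).

(** * The axioms in the forcing model *)

Lemma forcing_semiring B : semiring_axiom B -> models forcing_model B.
Proof.
  intros []; try (apply models_closure; intro e); simpl; try lia.
  - exact Nat.lt_0_1.
  - intros H K. apply Nat.mul_lt_mono_pos_r; auto.
Qed.

Lemma forcing_eqv s : forall x y : fdom s,
  eqv (M := forcing_model) x y <-> rel s (fun _ => val x) (fun _ => val y).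
Proof.
  induction s as [|s _ t IH]; intros x y.
  - simpl. split.
    + intro H. split; [apply computable_const|auto].
    + intros [_ H]. exact (H _ (ground_const skolem fixed 0)).
  - split.
    + intro H. apply rel_pointwise; [apply (proj2_sig x)|apply (proj2_sig y)|].
      intros a Ha c Hc u v Huv. apply rel_pointwise.
      * apply (proj2_sig x c Hc u u). apply rel_trans with v; auto. now apply rel_sym.
      * apply (proj2_sig y c Hc v v). apply rel_trans with u; auto. now apply rel_sym.
      * intros b Hb.
        (* Equality in the model only tests constant families; freezing the index at a ground [b]
           turns a family of arguments into an element of the model. *)
        assert (Ku : rel s (fun _ => u b) (fun _ => v b))
          by exact (rel_reparam (reparam_const Hb) Huv).
        assert (Kuu : rel s (fun _ => u b) (fun _ => u b))
          by (eapply rel_trans; [exact Ku|now apply rel_sym]).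
        specialize (H (exist _ (u b) Kuu)). apply IH in H. simpl in H.
        apply (rel_trans H).
        exact (proj2_sig y _ reparam_id _ _ Ku).
    + intros H z. simpl. apply IH. exact (H _ reparam_id _ _ (proj2_sig z)).
Qed.

Lemma forcing_combinators B : combinator_axiom B -> models forcing_model B.
Proof.
  intros []; apply models_closure; intro e; apply (sat_eq_at (M := forcing_model));
    apply forcing_eqv.
  - exact (proj2_sig (teval e v1)).
  - exact (proj2_sig (teval e (v2 · v0 · (v1 · v0)))).
Qed.

Lemma forcing_recursor B : recursor_axiom B -> models forcing_model B.
Proof.
  intros []; apply models_closure; intro e; simpl; [reflexivity|].
  now rewrite Nat.add_1_r.
Qed.

Lemma forcing_extensionality B : extensionality_axiom B -> models forcing_model B.
Proof.
  intros [s t]. apply models_closure. intros e H.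
  apply (sat_eq_at (M := forcing_model)), forcing_eqv in H.
  apply (sat_eq_at (M := forcing_model)), forcing_eqv.
  exact (proj2_sig (e _ (vs s (vs s (vz [] (s ⇒ t))))) _ reparam_id _ _ H).
Qed.

Lemma forcing_induction B : qf_induction B -> models forcing_model B.
Proof.
  intros [G A HA]. apply models_closure. intros e [H0 HS] [n Hn].
  apply sat_inst in H0.
  assert (K : forall n, sat A (econs (M := forcing_model) (nat_dom n) e)).
  { clear n Hn. induction n as [|n IH].
    - replace (nat_dom 0) with (teval e zero : fdom ty0) by now apply val_inj.
      exact H0.
    - specialize (HS (nat_dom n) IH). apply sat_induction in HS.
      replace (nat_dom (S n)) with
        (teval (econs (M := forcing_model) (nat_dom n) e) (v0 ⊕ one) : fdom ty0); auto.
      apply val_inj. simpl. lia. }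
  replace (exist _ n Hn : fdom ty0) with (nat_dom n) by now apply val_inj.
  apply K.
Qed.

(** Unbounded search on the truth value of the formula. The candidate number is the head of [b] and
    the function argument its tail; parameters are constant families. *)
Lemma forcing_choice10 B : QF_AC ty1 ty0 B -> models forcing_model B.
Proof.
  intros [G A HA]. apply models_closure. intros e H.
  pose (E := fun b : real => econs (M := full) (a := ty0) (b 0)
    (econs (M := full) (a := ty1) (pop b) (venv e))).
  assert (HE : forall s (x : var (ty0 :: ty1 :: G) s),
    rel s (fun a => E a s x) (fun a => E a s x)).
  { vinv; [exact (conj (computable_at 0) (fun _ _ => eq_refl))|].
    vinv; [apply rel_ty1; split; [exact reparam_pop|auto]|].
    intros s x. exact (proj2_sig (e s x)). }
  destruct (computable_mu (computable_qf HA HE)) as [g [Hg K]].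
  { intros a Ha. destruct (H (real_dom Ha)) as [n Hn]. exists (val n).
    apply bit_0. apply (sat_full (qf_arithmetical HA)) in Hn.
    rewrite !venv_econs in Hn. exact Hn. }
  exists (functional_dom Hg). intro f.
  apply sat_choice. apply (sat_full (qf_arithmetical HA)). rewrite !venv_econs.
  apply bit_0. exact (K (val f) (real_dom_ground f)).
Qed.

Lemma rel_rows d : ground d -> rel (ty0 ⇒ ty1) (fun _ => row d) (fun _ => row d).
Proof.
  intros Hd c Hc x x' Hx c' Hc' y y' Hy.
  destruct (rel_hop 2 (rel_reparam Hc' Hx) Hy) as [K1 K2]. split.
  - exact (computable_real Hd K1).
  - intros a Ha. exact (f_equal d (K2 a Ha)).
Qed.

Lemma forcing_choice01 B : QF_AC ty0 ty1 B -> models forcing_model B.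
Proof.
  intros [G A HA]. apply models_closure. intros e H.
  pose (E := fun b : real => econs (M := full) (a := ty1) (pop b)
    (econs (M := full) (a := ty0) (b 0) (venv e))).
  assert (HE : forall s (x : var (ty1 :: ty0 :: G) s),
    rel s (fun a => E a s x) (fun a => E a s x)).
  { vinv; [apply rel_ty1; split; [exact reparam_pop|auto]|].
    vinv; [exact (conj (computable_at 0) (fun _ _ => eq_refl))|].
    intros s x. exact (proj2_sig (e s x)). }
  destruct (computable_choice (computable_qf HA HE)) as [d [Hd K]].
  { intro n. destruct (H (nat_dom n)) as [f Hf]. exists (val f).
    split; [apply real_dom_ground|].
    apply bit_0. apply (sat_full (qf_arithmetical HA)) in Hf.
    rewrite !venv_econs in Hf. exact Hf. }
  exists (exist _ (row d) (rel_rows Hd)). intro n.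
  apply sat_choice. apply (sat_full (qf_arithmetical HA)). rewrite !venv_econs.
  apply bit_0. exact (K (val n)).
Qed.

Lemma forcing_RCA0 B : RCA0_omega B -> models forcing_model B.
Proof.
  intros [H|[H|[H|[H|[H|H]]]]].
  - now apply forcing_semiring.
  - now apply forcing_combinators.
  - now apply forcing_recursor.
  - now apply forcing_extensionality.
  - now apply forcing_induction.
  - now apply forcing_choice10.
Qed.

End TypeStructure.

(* [normal_form] with its function quantifiers restricted to [R]. *)
Fixpoint nf (R : real -> Prop) (k : nat) (ex : bool) (f : real) (gs : list real) : Prop :=
  match k with
  | 0 => if ex then exists n, f (initvs gs n) = 0 else forall n, f (initvs gs n) = 0
  | S k => if ex then exists g, R g /\ nf R k (negb ex) f (gs ++ [g])
           else forall g, R g -> nf R k (negb ex) f (gs ++ [g])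
  end.

Definition everywhere : real -> Prop := fun _ => True.

(** The index codes the number of remaining quantifiers, the kind of the next one, and whether a
    witness (c = 0) or a counterexample is wanted. Truth is that of the full Baire space. *)
Definition nf_skolem (j : nat) (l : list real) : real :=
  let (k, r) := Cantor.of_nat j in let (i, c) := Cantor.of_nat r in
  match l with
  | [] => zero_real
  | f :: gs => epsilon (inhabits zero_real) (fun g =>
      let P := nf everywhere k (Nat.eqb i 0) f (gs ++ [g]) in
      if Nat.eqb c 0 then P else ~ P)
  end.

(** Index 0 is the choice of representatives in uncurried form; index k + 1 is the functional for
    S_k. *)
Definition nf_fixed (j : nat) (a : real) : nat :=
  match j with
  | 0 => canon (pop a) (a 0)
  | S k => bit (nf everywhere k true a [])
  end.

(** * Elementarity of the ground reals, and failure of NIN *)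

Local Notation gnd := (ground nf_skolem nf_fixed).
Local Notation FM := (forcing_model nf_skolem nf_fixed).

Lemma nf_witness k ex f gs (c : bool) : gnd f -> Forall gnd gs ->
  (exists g, if c then nf everywhere k ex f (gs ++ [g])
             else ~ nf everywhere k ex f (gs ++ [g])) ->
  exists g, gnd g /\ if c then nf everywhere k ex f (gs ++ [g])
             else ~ nf everywhere k ex f (gs ++ [g]).
Proof.
  intros Hf Hgs H.
  exists (nf_skolem (pr k (pr (if ex then 0 else 1) (if c then 0 else 1))) (f :: gs)).
  split; [apply ground_skolem; [easy|now constructor]|].
  unfold nf_skolem, pr. rewrite !Cantor.cancel_of_to.
  destruct ex, c; simpl Nat.eqb; cbv iota;
    match goal with |- context [epsilon ?i ?P] => exact (epsilon_spec i P H) end.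
Qed.

(** The Tarski-Vaught test: closure under [nf_skolem] supplies ground witnesses and ground
    counterexamples. *)
Lemma nf_ground k : forall ex f gs, gnd f -> Forall gnd gs ->
  (nf gnd k ex f gs <-> nf everywhere k ex f gs).
Proof.
  induction k as [|k IH]; intros ex f gs Hf Hgs; [reflexivity|].
  assert (IH' : forall g, gnd g ->
    (nf gnd k (negb ex) f (gs ++ [g]) <-> nf everywhere k (negb ex) f (gs ++ [g]))).
  { intros g Hg. apply IH; auto. apply Forall_app; auto. }
  destruct ex; cbn [nf].
  - split.
    + intros [g [Hg H]]. exists g. split; [exact I|]. now apply IH'.
    + intros [g [_ H]].
      destruct (nf_witness (c := true) Hf Hgs (ex_intro _ g H)) as [g' [Hg' H']].
      exists g'. split; auto. now apply IH'.
  - split.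
    + intros H g _. apply NNPP. intro N.
      destruct (nf_witness (c := false) Hf Hgs (ex_intro _ g N)) as [g' [Hg' N']].
      apply N', IH'; auto.
    + intros H g Hg. apply IH'; auto. now apply H.
Qed.

Lemma sat_normal_form k : forall ex G (f : tm G ty1) (gs : list (tm G ty1)) (e : env FM G),
  sat (normal_form k ex f gs) e <->
  nf gnd k ex (teval (venv e) f) (map (fun g : tm G ty1 => (teval (venv e) g : real)) gs).
Proof.
  induction k as [|k IH]; intros ex G f gs e.
  - assert (E : forall n : fdom nf_skolem nf_fixed ty0,
      sat (twk f · initseg_tuple (map twk gs) v0 ≐ zero) (econs (M := FM) n e) <->
      (teval (venv e) f : real)
        (initvs (map (fun g : tm G ty1 => (teval (venv e) g : real)) gs) (val n)) = 0).
    { intro n. cbn [sat eq0 forcing_model]. rewrite !val_teval, venv_econs.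
      cbn [teval app full]. rewrite full_initseg_tuple, teval_wk, map_map.
      erewrite (map_ext _ (fun g : tm G ty1 => (teval (venv e) g : real)));
        [reflexivity|]. intro g. exact (@teval_wk full G ty0 (venv e) (val n) ty1 g). }
    destruct ex; cbn [normal_form quant nf sat].
    + split; intros [n H].
      * exists (val n). now apply E.
      * exists (nat_dom nf_skolem nf_fixed n). now apply E.
    + split; intros H n.
      * apply (E (nat_dom nf_skolem nf_fixed n)), H.
      * apply E, H.
  - assert (E : forall g : fdom nf_skolem nf_fixed ty1,
      sat (normal_form k (negb ex) (twk f) (map twk gs ++ [v0])) (econs (M := FM) g e) <->
      nf gnd k (negb ex) (teval (venv e) f)
        (map (fun g : tm G ty1 => (teval (venv e) g : real)) gs ++ [val g])).
    { intro g. rewrite IH, venv_econs, teval_wk, map_app, map_map.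
      erewrite (map_ext _ (fun g : tm G ty1 => (teval (venv e) g : real)));
        [reflexivity|]. intro h. exact (@teval_wk full G ty1 (venv e) (val g) ty1 h). }
    destruct ex; cbn [normal_form quant nf sat].
    + split; intros [g H].
      * exists (val g). split; [apply real_dom_ground|]. now apply E.
      * destruct H as [Hg H]. exists (real_dom Hg). now apply E.
    + split; intros H g.
      * intro Hg. apply (E (real_dom Hg)), H.
      * apply E, H. apply real_dom_ground.
Qed.

Lemma forcing_S B : S_axioms B -> models FM B.
Proof.
  intros [k _].
  exists (functional_dom (computable_fixed nf_skolem nf_fixed (S k))). intro f.
  assert (E : sat (Sigma1 k v0) (econs (M := FM) f (econs (M := FM)
    (functional_dom (computable_fixed nf_skolem nf_fixed (S k)) : fdom _ _ ty2) enil)) <->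
    nf_fixed (S k) (val f) = 0).
  { unfold Sigma1. rewrite sat_normal_form, nf_ground.
    - symmetry. apply bit_0.
    - apply real_dom_ground.
    - constructor. }
  split.
  - simpl. unfold bit. destruct (excluded_middle_informative _); auto.
  - exact E.
Qed.

Lemma NIN_fails : ~ models FM NIN.
Proof.
  intro H. destruct (generic_injection nf_skolem nf_fixed) as [Y [HY Inj]].
  assert (HC : reparam nf_skolem nf_fixed canon) by exact (computable_fixed _ _ 0).
  (* Precomposition with [canon] makes the injection respect equality of reals, and it stays
     injective on equality classes. *)
  set (Z := functional_dom (computable_reparam HY HC) : dom FM ty2).
  assert (R : forall x : dom FM ty1, forall G (e : env FM G),
    sat (in_unit v0) (econs x e) -> is_realv (val (s := ty1) x)).
  { intros x G e [K _].
    apply (sat_full (A := is_real v0)) in K; [|simpl; tauto].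
    rewrite venv_econs in K. exact K. }
  assert (E : forall (x y : dom FM ty1) G (e : env FM G),
    sat (real_eq v1 v0) (econs y (econs x e)) <->
    real_eqv (val (s := ty1) x) (val (s := ty1) y)).
  { intros x y G e. rewrite (sat_full (A := real_eq v1 v0)) by (simpl; tauto).
    rewrite !venv_econs. reflexivity. }
  destruct (H Z) as [x [y [Hx [Hy [N K]]]]].
  - intros x y Hx Hy Hxy.
    change (Y (canon (val (s := ty1) x)) = Y (canon (val (s := ty1) y))). f_equal.
    apply canon_eq.
    + exact (R x _ (econs Z enil) Hx).
    + exact (R y _ (econs x (econs Z enil)) Hy).
    + exact (proj1 (E x y _ (econs Z enil)) Hxy).
  - apply N. apply E. apply canon_eq.
    + exact (R x _ (econs Z enil) Hx).
    + exact (R y _ (econs x (econs Z enil)) Hy).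
    + apply Inj; [| |exact K];
        apply (ground_reparam HC), real_dom_ground.
Qed.

Theorem theorem3p2 :
  ~ proves (union Z2_omega (QF_AC ty0 ty1)) NIN /\
  proves (union Z2_Omega (QF_AC ty0 ty1)) NIN.
Proof.
  split.
  - intro H. apply NIN_fails.
    refine (proves_models (forcing_eq_ok nf_skolem nf_fixed) _ H).
    intros B [[HB|HB]|HB].
    + now apply forcing_RCA0.
    + now apply forcing_S.
    + now apply forcing_choice01.
  - apply completeness. intros M HE HT. apply nin_holds; auto.
    + intros B HB. apply HT. left. now left.
    + intros B HB. apply HT. now right.
    + apply HT. left. right. constructor.
Qed.
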